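(* Let a curve $\gamma(r)=(a(r),-1,k(r))$ be given, $r\in I=[0,L]\setminus\{r_1,\dots,r_n\}$, for some points $0<r_1<\dots<r_n<L$. This curve satisfies the following conditions (i* )–(iv* ): (i* ) the projective curve $P\gamma(r)=(a(r):-1:k(r))$, $r\in I$, extends by continuity to the punctured points $r_i\in(0,L)$ by points $P\gamma(r_i)=(1:0:-f_i)$ ''at infinity'' with $f_i>0$ to a good projective curve $P\gamma(r)$, $0\le r\le L$, having no inflection points; (ii* ) the tangent line to $P\gamma$ at any point $P\gamma(r)$, $r\in[0,L]$ (including the points $P\gamma(r_i)$ at infinity and the cusp points), is different from the line at infinity and is not vertical, and moreover this line has a negative slope for any point except for the endpoints $p_0=P\gamma(0)$, $p_1=P\gamma(L)$; (iii* ) all cusp points of the projective curve $P\gamma(r)$, $0\le r\le L$, are finite and do not lie on the axis $a=0$; (iv* ) the projective curve $P\gamma(r)$, $0\le r\le L$, is smoothly glued at both endpoints $p_0$ and $p_1$ with its reflection $P\gamma_-(r)=(-a(-r):-1:k(-r))$, $-L\le r\le0$, $r\notin\{-r_i\}$, $P\gamma_-(-r_i)=(-1:0:-f_i)$, with respect to the vertical axis $a=0$ into a smoothly parametrized closed projective curve such that $|\gamma'(0)|=|\gamma''(0)|$ and $|\gamma'(L)|=|\gamma''(L)|$; if and only if there exists a generic pair of functions $f(r),\Lambda(r)$, $r\in[0,L]$, such that the curve $\gamma=(a,-1,k)$ coincides with the curve obtained from the bifurcation curve $\gamma_1=(h,k)$ of the magnetic geodesic flow $S(f,\Lambda)$ by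 the construction $(h,k)\mapsto(\pm\sqrt{2h},-1,k)=(a,-1,k)$, with the sign chosen so that $k'(r)a'(r)\le0$. Suppose that a planar curve $\gamma$ is realized in this way by a system $S(f,\Lambda)$ for some pair $(f,\Lambda)$. Then: (a) such a pair $(f,\Lambda)$ is unique and is expressed in terms of the curve $\gamma=(a,-1,k)$ by the formulas $$f(r)=-\frac{k'(r)}{a'(r)},\qquad \Lambda(r)=k(r)-a(r)\frac{k'(r)}{a'(r)}$$ everywhere except for a finite number of points $r_i,r_\ell^\circ$; geometrically, these formulas mean that the tangent line to the curve $P\gamma$ at a point $P\gamma(r)$ is given by the equation $f(r)a-\Lambda(r)+k=0$; (b) for any admissible parameter change $r=r(\widetilde r)$, the curve $\widetilde\gamma(\widetilde r):=\gamma(r(\widetilde r))$ is realized by the system $S(\widetilde f,\widetilde\Lambda)$, where $\widetilde f(\widetilde r):=f(r(\widetilde r))$ and $\widetilde\Lambda(\widetilde r):=\Lambda(r(\widetilde r))$.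
   Context: Generic pairs. For $L>0$, a pair of $C^\infty$ functions $f,\Lambda:[0,L]\to\mathbb R$ is generic if: (1) $f>0$ on $(0,L)$ and $f$ extends to a smooth odd $2L$-periodic function on $\mathbb R$; (2) $\Lambda$ extends to a smooth even $2L$-periodic function on $\mathbb R$; (3) $f'(0)=1$, $f'(L)=-1$; (4) $f$ and $\Lambda$ are Morse functions (all critical points on $[0,L]$, endpoints included, are non-degenerate); (5) $(\Lambda'(r))^2+(f'(r))^2>0$ on $[0,L]$; (6) the function $f'\Lambda''-f''\Lambda'$ has only simple zeros. The system and its bifurcation curve. $S(f,\Lambda)$ is the Hamiltonian system on $T^*M$, where $M$ is the 2-sphere with poles $r=0$, $r=L$ and coordinates $(r,\varphi)$ elsewhere, with Hamiltonian $H=\frac{p_r^2}{2}+\frac{p_\varphi^2}{2f^2(r)}$, symplectic form $\widetilde\omega=dp_r\wedge dr+dp_\varphi\wedge d\varphi+\Lambda'(r)dr\wedge d\varphi$ (extended by continuity over the poles) and additional first integral $K=p_\varphi+\Lambda(r)$. The bifurcation diagram of $(H,K)$ in the $(h,k)$-plane consists of the curve $$\gamma_1(r)=(h(r),k(r))=\left(\frac12\left(\frac{\Lambda'(r)}{f'(r)}\right)^2,\ \Lambda(r)-f(r)\frac{\Lambda'(r)}{f'(r)}\right),\quad r\in[0,L]\setminus\{r:f'(r)=0\},$$ called the bifurcation curve, and of the segment $\gamma_2(r)=(0,\Lambda(r))$, $r\in[0,L]$. In the construction $(h,k)\mapsto(\pm\sqrt{2h},-1,k)$, $a=\pm\sqrt{2h}$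 is a differentiable function of $r$. When $\gamma$ is realized by $S(f,\Lambda)$, the $r_i$ are the zeros of $f'$ and the $r_\ell^\circ$ are the zeros of $f'\Lambda''-f''\Lambda'$ on $[0,L]$. Projective curves. All curves are $C^\infty$-parametrized. For a curve $\gamma(t)\in\mathbb R^3\setminus\{0\}$ let $P\gamma(t)\in\mathbb RP^2$ be its projectivization, and put $\gamma^*=[\gamma,\dot\gamma]$ (vector product), $\varkappa_\gamma=\langle\gamma^*,\ddot\gamma\rangle=\det(\gamma,\dot\gamma,\ddot\gamma)$. A point of $P\gamma$ is a point of straightening if $\gamma^*\neq0$ and $\varkappa_\gamma=0$ there; it is an inflection point if in addition $\dot\varkappa_\gamma\ne0$. It is a singular point if $\gamma^*=0$ there; a singular point is a cusp point if $\ddot\varkappa_\gamma\neq0$ there. $P\gamma$ (and $\gamma$) is good if all its points of straightening are inflection points and all its singular points are cusp points. These notions do not depend on the lift $\gamma$ of $P\gamma$. The tangent line to a good projective curve is well defined at every point, being defined by continuity at cusp points. Affine chart. Points $(x:y:z)$ of $\mathbb RP^2$ with $y\ne0$ are written $(a:-1:k)$ with affine coordinates $(a,k)$; the line at infinity is $y=0$; points not on it are finite; a vertical line is a line $a=\mathrm{const}$; slope means $dk/da$. In (iv* ), $\gamma'$ and $\gamma''$ are the derivatives in this chart. Admissible parameter change. This is a regular parameter change $[0,\widetilde L]\to[0,L]$, $\widetilde r\mapsto r=r(\widetilde r)$, such that $dr(0)/d\widetilde r=dr(\widetilde L)/d\widetilde r=\pm1$ and the function $dr(\widetilde r)/d\widetilde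 r$ extends to a $C^\infty$-smooth $2\widetilde L$-periodic even function on $\mathbb R$. *)

(* Defs.v *)
From Stdlib Require Import Reals List Sorted.
From Coquelicot Require Import Coquelicot.
Open Scope R_scope.

(* A function on a subset D of the line is a total function R -> R of which
   only the values on D are used; in particular a derivative at an endpoint
   of an interval is one-sided. *)

Definition has_deriv_in (D : R -> Prop) (f : R -> R) (x l : R) : Prop :=
  D_in f (fun _ => l) D x.

(* Meaningful at those x that are accumulation points of D and at which f is
   differentiable relative to D. *)
Definition deriv_in (D : R -> Prop) (f : R -> R) (x : R) : R :=
  iota (fun l => has_deriv_in D f x l).

Fixpoint deriv_in_n (D : R -> Prop) (f : R -> R) (n : nat) : R -> R :=
  match n with
  | O => f
  | S m => deriv_in D (deriv_in_n D f m)
  end.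

Definition diff_in (D : R -> Prop) (f : R -> R) (x : R) : Prop :=
  exists l, has_deriv_in D f x l.

Definition smooth_on (D : R -> Prop) (f : R -> R) : Prop :=
  forall (n : nat) (x : R), D x -> diff_in D (deriv_in_n D f n) x.

Definition smooth (F : R -> R) : Prop :=
  forall (n : nat) (x : R), ex_derive_n F n x.

Definition even (F : R -> R) : Prop := forall x, F (- x) = F x.
Definition odd (F : R -> R) : Prop := forall x, F (- x) = - F x.
Definition periodic (T : R) (F : R -> R) : Prop := forall x, F (x + T) = F x.

Definition seg (L : R) : R -> Prop := fun r => 0 <= r <= L.

Definition punctured (L : R) (rs : list R) : R -> Prop :=
  fun r => seg L r /\ ~ In r rs.

Definition morse_on (L : R) (f : R -> R) : Prop :=
  forall r, seg L r ->
    deriv_in (seg L) f r = 0 -> deriv_in_n (seg L) f 2 r <> 0.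

Definition wronsk (L : R) (f Lam : R -> R) (r : R) : R :=
  deriv_in (seg L) f r * deriv_in_n (seg L) Lam 2 r
  - deriv_in_n (seg L) f 2 r * deriv_in (seg L) Lam r.

Record generic_pair (L : R) (f Lam : R -> R) : Prop := {
  gp_length : 0 < L;
  gp_pos : forall r, 0 < r < L -> 0 < f r;
  gp_ext_f : exists F, smooth F /\ odd F /\ periodic (2 * L) F /\
    (forall r, seg L r -> F r = f r);
  gp_ext_Lam : exists F, smooth F /\ even F /\ periodic (2 * L) F /\
    (forall r, seg L r -> F r = Lam r);
  gp_start : deriv_in (seg L) f 0 = 1;
  gp_end : deriv_in (seg L) f L = -1;
  gp_morse_f : morse_on L f;
  gp_morse_Lam : morse_on L Lam;
  gp_immersed : forall r, seg L r ->
    0 < (deriv_in (seg L) Lam r) ^ 2 + (deriv_in (seg L) f r) ^ 2;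
  gp_simple_zeros : forall r, seg L r ->
    wronsk L f Lam r = 0 -> deriv_in (seg L) (wronsk L f Lam) r <> 0
}.

(* The bifurcation curve r |-> (h(r), k(r)) of S(f,Lambda), for f'(r) <> 0. *)
Definition bif_h (L : R) (f Lam : R -> R) (r : R) : R :=
  / 2 * (deriv_in (seg L) Lam r / deriv_in (seg L) f r) ^ 2.

Definition bif_k (L : R) (f Lam : R -> R) (r : R) : R :=
  Lam r - f r * (deriv_in (seg L) Lam r / deriv_in (seg L) f r).

(* gamma = (a,-1,k), defined on I, is the curve obtained from the bifurcation
   curve (h,k) of S(f,Lambda) by (h,k) |-> (+-sqrt(2h),-1,k). The sign may
   depend on r, subject to differentiability of a and to k' a' <= 0. *)
Record realized_by (L : R) (I : R -> Prop) (a k f Lam : R -> R) : Prop := {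
  rb_generic : generic_pair L f Lam;
  rb_domain : forall r, I r <-> seg L r /\ deriv_in (seg L) f r <> 0;
  rb_a : forall r, I r ->
    a r = sqrt (2 * bif_h L f Lam r) \/ a r = - sqrt (2 * bif_h L f Lam r);
  rb_k : forall r, I r -> k r = bif_k L f Lam r;
  rb_diff : forall r, I r -> diff_in I a r /\ diff_in I k r;
  rb_sign : forall r, I r -> deriv_in I k r * deriv_in I a r <= 0
}.

Definition vec : Type := (R * R * R)%type.
Definition px (v : vec) : R := fst (fst v).
Definition py (v : vec) : R := snd (fst v).
Definition pz (v : vec) : R := snd v.
Definition vzero : vec := (0, 0, 0).

Definition cross (u v : vec) : vec :=
  (py u * pz v - pz u * py v,
   pz u * px v - px u * pz v,
   px u * py v - py u * px v).

Definition dot (u v : vec) : R := px u * px v + py u * py v + pz u * pz v.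

(* Equality of the points (or lines) of the projective plane with homogeneous
   coordinates u and v, for nonzero u and v. *)
Definition proj_eq (u v : vec) : Prop :=
  exists c : R, c <> 0 /\ u = scal c v.

(* A smooth projective curve on D is given by a smooth lift G with values in
   R^3 \ {0}; over an interval every such curve has one. *)
Definition is_lift (D : R -> Prop) (G : R -> vec) : Prop :=
  smooth_on D (fun t => px (G t)) /\
  smooth_on D (fun t => py (G t)) /\
  smooth_on D (fun t => pz (G t)) /\
  (forall t, D t -> G t <> vzero).

Definition dvec (D : R -> Prop) (G : R -> vec) (n : nat) (t : R) : vec :=
  (deriv_in_n D (fun s => px (G s)) n t,
   deriv_in_n D (fun s => py (G s)) n t,
   deriv_in_n D (fun s => pz (G s)) n t).

Definition star (D : R -> Prop) (G : R -> vec) (t : R) : vec :=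
  cross (G t) (dvec D G 1 t).

Definition kappa (D : R -> Prop) (G : R -> vec) (t : R) : R :=
  dot (star D G t) (dvec D G 2 t).

Definition straightening (D : R -> Prop) (G : R -> vec) (t : R) : Prop :=
  star D G t <> vzero /\ kappa D G t = 0.

Definition inflection (D : R -> Prop) (G : R -> vec) (t : R) : Prop :=
  straightening D G t /\ deriv_in D (kappa D G) t <> 0.

Definition singular (D : R -> Prop) (G : R -> vec) (t : R) : Prop :=
  star D G t = vzero.

Definition cusp (D : R -> Prop) (G : R -> vec) (t : R) : Prop :=
  singular D G t /\ deriv_in_n D (kappa D G) 2 t <> 0.

Definition good (D : R -> Prop) (G : R -> vec) : Prop :=
  forall t, D t ->
    (straightening D G t -> inflection D G t) /\
    (singular D G t -> cusp D G t).

(* The covector l stands for the line l.x X + l.y Y + l.z Z = 0. At a singular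
   point the tangent line is the limit, in the dual projective plane, of the
   tangent lines [star D G s] at the points s <> t. *)
Definition tangent_line (D : R -> Prop) (G : R -> vec) (t : R) (l : vec)
  : Prop :=
  l <> vzero /\
  (~ singular D G t -> proj_eq l (star D G t)) /\
  (singular D G t ->
     exists c : R -> R, (forall s, c s <> 0) /\
       filterlim (fun s => scal (c s) (star D G s))
         (within D (locally' t)) (locally l)).

(* Affine chart: (X:Y:Z) = (a:-1:k). The line Y = 0 is the line at infinity,
   a = c is the line X + c Y = 0, and k = m a + b is - m X + b Y + Z = 0. *)
Definition finite_point (v : vec) : Prop := py v <> 0.
Definition on_vertical_axis (v : vec) : Prop := px v = 0.
Definition line_at_infinity (l : vec) : Prop := proj_eq l (0, 1, 0).
Definition vertical_line (l : vec) : Prop := exists c, proj_eq l (1, c, 0).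
Definition line_slope (l : vec) (m : R) : Prop :=
  exists b, proj_eq l (- m, b, 1).

Definition lifts_gamma (L : R) (rs : list R) (a k : R -> R) (G : R -> vec)
  : Prop :=
  is_lift (seg L) G /\
  (forall r, punctured L rs r -> proj_eq (G r) (a r, -1, k r)).

Definition extends_to_good (L : R) (rs : list R) (a k : R -> R) (G : R -> vec)
  : Prop :=
  lifts_gamma L rs a k G /\
  (forall p, In p rs -> exists fp, 0 < fp /\ proj_eq (G p) (1, 0, - fp)) /\
  good (seg L) G /\
  (forall r, seg L r -> ~ inflection (seg L) G r).

Definition tangents_condition (L : R) (G : R -> vec) : Prop :=
  forall r, seg L r ->
    exists l, tangent_line (seg L) G r l /\
      ~ line_at_infinity l /\ ~ vertical_line l /\
      (0 < r < L -> exists m, m < 0 /\ line_slope l m).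

Definition cusps_condition (L : R) (G : R -> vec) : Prop :=
  forall r, seg L r -> cusp (seg L) G r ->
    finite_point (G r) /\ ~ on_vertical_axis (G r).

Definition reflect (v : vec) : vec := (- px v, py v, pz v).

Definition smoothly_glued (L : R) (G : R -> vec) : Prop :=
  exists Gam : R -> vec,
    smooth (fun t => px (Gam t)) /\
    smooth (fun t => py (Gam t)) /\
    smooth (fun t => pz (Gam t)) /\
    (forall t, Gam t <> vzero) /\
    (forall t, proj_eq (Gam (t + 2 * L)) (Gam t)) /\
    (forall t, seg L t -> proj_eq (Gam t) (G t)) /\
    (forall t, seg L t -> proj_eq (Gam (- t)) (reflect (G t))).

Definition chart_norm (I : R -> Prop) (a k : R -> R) (n : nat) (r : R) : R :=
  sqrt ((deriv_in_n I a n r) ^ 2 + (deriv_in_n I k n r) ^ 2).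

Definition gluing_condition (L : R) (rs : list R) (a k : R -> R)
    (G : R -> vec) : Prop :=
  smoothly_glued L G /\
  chart_norm (punctured L rs) a k 1 0 = chart_norm (punctured L rs) a k 2 0 /\
  chart_norm (punctured L rs) a k 1 L = chart_norm (punctured L rs) a k 2 L.

Record admissible (L Lt : R) (rho : R -> R) : Prop := {
  adm_length : 0 < Lt;
  adm_smooth : smooth_on (seg Lt) rho;
  adm_maps : forall t, seg Lt t -> seg L (rho t);
  adm_bij : forall r, seg L r -> exists! t, seg Lt t /\ rho t = r;
  adm_regular : forall t, seg Lt t -> deriv_in (seg Lt) rho t <> 0;
  adm_ends :
    (deriv_in (seg Lt) rho 0 = 1 /\ deriv_in (seg Lt) rho Lt = 1) \/
    (deriv_in (seg Lt) rho 0 = -1 /\ deriv_in (seg Lt) rho Lt = -1);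
  adm_ext : exists g, smooth g /\ even g /\ periodic (2 * Lt) g /\
    (forall t, seg Lt t -> g t = deriv_in (seg Lt) rho t)
}.

(* Main.v *)
(* The pair (f, Lambda) is the dual curve: the line f a - Lambda + k = 0, with
   covector l = (f, Lambda, 1), is the tangent to the projective curve G.
   Conversely G is proportional to the vector product l x l', and then
   G x G' = W l and det(G, G', G'') = W^2 with W = f' Lambda'' - f'' Lambda'.
   Hence there are no inflections, cusps are the simple zeros of W, points at
   infinity are the zeros of f', and points on the axis a = 0 are the zeros of
   Lambda'; a Morse degeneracy of f or Lambda would be a singular point there, or
   a tangent that is vertical or at infinity.
   Given G, the product G x G' has a simple zero at a cusp; dividing it out
   (Hadamard's lemma) extends f and Lambda smoothly over the cusps, and the
   gluing with the mirror image gives their parity and periodicity. At an endpoint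
   f = f'' = Lambda' = Lambda''' = 0, so the two norms |gamma'| and |gamma''| are
   |W| / f'^2 and |W| / |f'|, and their equality says |f'| = 1. *)

Require Import Defs.
From Stdlib Require Import Reals List Sorted Lra Classical.
From Coquelicot Require Import Coquelicot.
Open Scope R_scope.

(** * Derivatives relative to a set *)

(** A projective curve is known only up to a nonvanishing factor, so the glued curve is symmetric
    and [2 * L]-periodic only up to such a factor. The factor enters the three components of G x G'
    through one common square. Hence their quotients, which are f and Lambda, have exact parity and
    period. For the same reason they only have to be studied on [0, L]: reflections and shifts carry
    a local representation to every other point. One-sided derivatives at the endpoints are awkward
    to compute with. Every pair is therefore traded for an extension to the line, where ordinary
    derivatives and the symmetries apply, and the result is carried back to the segment. The sign of
    the square root is governed by the identity k' = - f a': as f > 0 inside, the rule k' a' <= 0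
    selects a = Lambda' / f'. The gluing norms give only |f'| = 1 at the ends; the signs 1 and -1
    come from f > 0 between two zeros. Uniqueness and the passage through the points at infinity
    rest on one principle: a relation that holds off a finite set persists by continuity. The
    relevant sets are finite because simple zeros are isolated in a compact segment. *)

Definition everywhere : R -> Prop := fun _ => True.

(** Every point of [D] is an accumulation point. This makes a relative derivative unique, hence
    makes the [iota] in [deriv_in] pick it. *)
Definition perfect (D : R -> Prop) : Prop :=
  forall x, D x -> forall eps, 0 < eps ->
    exists y, D y /\ y <> x /\ Rabs (y - x) < eps.

Lemma hd_const (D : R -> Prop) (c x : R) : has_deriv_in D (fun _ => c) x 0.
Proof. exact (Dconst D c x). Qed.

Lemma hd_id (D : R -> Prop) (x : R) : has_deriv_in D (fun t => t) x 1.
Proof. exact (Dx D x). Qed.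

Lemma hd_plus (D : R -> Prop) (f g : R -> R) (x l m : R) :
  has_deriv_in D f x l -> has_deriv_in D g x m ->
  has_deriv_in D (fun t => f t + g t) x (l + m).
Proof. intros Hf Hg. exact (Dadd _ _ _ _ _ _ Hf Hg). Qed.

Lemma hd_opp (D : R -> Prop) (f : R -> R) (x l : R) :
  has_deriv_in D f x l -> has_deriv_in D (fun t => - f t) x (- l).
Proof. intros Hf. exact (Dopp _ _ _ _ Hf). Qed.

Lemma hd_minus (D : R -> Prop) (f g : R -> R) (x l m : R) :
  has_deriv_in D f x l -> has_deriv_in D g x m ->
  has_deriv_in D (fun t => f t - g t) x (l - m).
Proof. intros Hf Hg. exact (Dminus _ _ _ _ _ _ Hf Hg). Qed.

Lemma hd_mult (D : R -> Prop) (f g : R -> R) (x l m : R) :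
  has_deriv_in D f x l -> has_deriv_in D g x m ->
  has_deriv_in D (fun t => f t * g t) x (l * g x + f x * m).
Proof. intros Hf Hg. exact (Dmult _ _ _ _ _ _ Hf Hg). Qed.

Lemma hd_mono (D D' : R -> Prop) (f : R -> R) (x l : R) :
  (forall y, D' y -> D y) -> has_deriv_in D f x l -> has_deriv_in D' f x l.
Proof. intros H. exact (D_in_imp _ _ _ _ _ H). Qed.

Lemma hd_comp (D D' : R -> Prop) (f g : R -> R) (x l m : R) :
  (forall y, D y -> D' (f y)) ->
  has_deriv_in D f x l -> has_deriv_in D' g (f x) m ->
  has_deriv_in D (fun t => g (f t)) x (l * m).
Proof.
  intros H Hf Hg. apply hd_mono with (D := Dgf D D' f).
  - intros y Hy; split; auto.
  - exact (Dcomp _ _ _ _ _ _ _ Hf Hg).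
Qed.

Lemma hd_everywhere (f : R -> R) (x l : R) :
  has_deriv_in everywhere f x l <-> is_derive f x l.
Proof.
  rewrite is_derive_Reals. exact (derivable_pt_lim_D_in f (fun _ => l) x).
Qed.

Lemma hd_of_is_derive (D : R -> Prop) (f : R -> R) (x l : R) :
  is_derive f x l -> has_deriv_in D f x l.
Proof.
  intros H. apply hd_mono with (D := everywhere).
  - intros; exact I.
  - now apply hd_everywhere.
Qed.

Lemma hd_inv (D : R -> Prop) (f : R -> R) (x l : R) :
  has_deriv_in D f x l -> f x <> 0 ->
  has_deriv_in D (fun t => / f t) x (- l / (f x) ^ 2).
Proof.
  intros Hf Hx.
  replace (- l / f x ^ 2) with (l * (- / (f x) ^ 2)) by (field; auto).
  apply (hd_comp D everywhere f Rinv).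
  - intros; exact I.
  - exact Hf.
  - apply hd_of_is_derive. auto_derive; [exact Hx | field; exact Hx].
Qed.

Lemma hd_div (D : R -> Prop) (f g : R -> R) (x l m : R) :
  has_deriv_in D f x l -> has_deriv_in D g x m -> g x <> 0 ->
  has_deriv_in D (fun t => f t / g t) x ((l * g x - f x * m) / (g x) ^ 2).
Proof.
  intros Hf Hg Hx.
  replace ((l * g x - f x * m) / (g x) ^ 2)
    with (l * / g x + f x * (- m / (g x) ^ 2)) by (field; auto).
  apply (hd_mult D f (fun t => / g t)); [exact Hf | now apply hd_inv].
Qed.

Lemma hd_eq (D : R -> Prop) (f : R -> R) (x l l' : R) :
  has_deriv_in D f x l -> l = l' -> has_deriv_in D f x l'.
Proof. now intros H <-. Qed.

Lemma hd_ext_loc (D : R -> Prop) (f g : R -> R) (x l eps : R) :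
  0 < eps -> (forall y, D y -> Rabs (y - x) < eps -> f y = g y) ->
  D x -> has_deriv_in D f x l -> has_deriv_in D g x l.
Proof.
  intros He Hfg Hx Hf e0 He0.
  destruct (Hf e0 He0) as [d [Hd H]].
  exists (Rmin d eps); split; [now apply Rmin_pos|].
  intros y [[Hy Hyx] Hlt].
  assert (Hy1 : Rabs (y - x) < d).
  { eapply Rlt_le_trans; [exact Hlt | apply Rmin_l]. }
  assert (Hy2 : Rabs (y - x) < eps).
  { eapply Rlt_le_trans; [exact Hlt | apply Rmin_r]. }
  rewrite <- (Hfg y Hy Hy2), <- (Hfg x Hx).
  - apply H. split; [split; auto | exact Hy1].
  - rewrite Rminus_diag, Rabs_R0; exact He.
Qed.

Lemma hd_ext (D : R -> Prop) (f g : R -> R) (x l : R) :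
  (forall y, D y -> f y = g y) -> D x ->
  has_deriv_in D f x l -> has_deriv_in D g x l.
Proof.
  intros H. apply hd_ext_loc with (eps := 1); [lra | auto].
Qed.

Lemma hd_unique (D : R -> Prop) (f : R -> R) (x l m : R) :
  perfect D -> D x -> has_deriv_in D f x l -> has_deriv_in D f x m -> l = m.
Proof.
  intros HD Hx Hl Hm.
  refine (single_limit _ _ _ _ x _ Hl Hm).
  intros e He. destruct (HD x Hx e He) as [y [Hy [Hyx Hlt]]].
  exists y; split; [split; auto | exact Hlt].
Qed.

Lemma hd_cont (D : R -> Prop) (f : R -> R) (x l : R) :
  has_deriv_in D f x l -> forall eps, 0 < eps ->
  exists d, 0 < d /\ forall y, D y -> Rabs (y - x) < d -> Rabs (f y - f x) < eps.
Proof.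
  intros H eps He.
  destruct (cont_deriv _ _ _ _ H eps He) as [d [Hd Hc]].
  exists d; split; [exact Hd|].
  intros y Hy Hlt. destruct (Req_dec y x) as [->|Hyx].
  - rewrite Rminus_diag, Rabs_R0; exact He.
  - apply Hc. split; [split; auto | exact Hlt].
Qed.

Lemma hd_neq0 (D : R -> Prop) (f : R -> R) (x l : R) :
  has_deriv_in D f x l -> f x <> 0 ->
  exists d, 0 < d /\ forall y, D y -> Rabs (y - x) < d -> f y <> 0.
Proof.
  intros H H0.
  destruct (hd_cont _ _ _ _ H (Rabs (f x)) (Rabs_pos_lt _ H0)) as [d [Hd Hc]].
  exists d; split; [exact Hd|]. intros y Hy Hlt E.
  specialize (Hc y Hy Hlt). rewrite E, Rminus_0_l, Rabs_Ropp in Hc. lra.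
Qed.

Lemma hd_isolated_zero (D : R -> Prop) (f : R -> R) (x l : R) :
  has_deriv_in D f x l -> f x = 0 -> l <> 0 ->
  exists d, 0 < d /\
    forall y, D y -> y <> x -> Rabs (y - x) < d -> f y <> 0.
Proof.
  intros H H0 Hl.
  destruct (H (Rabs l) (Rabs_pos_lt _ Hl)) as [d [Hd Hc]].
  exists d; split; [exact Hd|]. intros y Hy Hyx Hlt E.
  specialize (Hc y (conj (conj Hy (not_eq_sym Hyx)) Hlt)). simpl in Hc.
  unfold Rdist in Hc. rewrite E, H0 in Hc.
  replace ((0 - 0) / (y - x) - l) with (- l) in Hc by (unfold Rdiv; ring).
  rewrite Rabs_Ropp in Hc. lra.
Qed.

Lemma hd_zero (D : R -> Prop) (f : R -> R) (x l : R) :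
  perfect D -> D x -> (forall y, D y -> f y = 0) ->
  has_deriv_in D f x l -> l = 0.
Proof.
  intros HD Hx H0 Hf. apply (hd_unique D f x); auto.
  apply hd_ext with (f := fun _ => 0); auto using hd_const.
  intros; now rewrite H0.
Qed.

Lemma deriv_in_eq (D : R -> Prop) (f : R -> R) (x l : R) :
  perfect D -> D x -> has_deriv_in D f x l -> deriv_in D f x = l.
Proof.
  intros HD Hx Hf. apply (iota_unique (V := R_CompleteNormedModule)).
  - intros m Hm. now apply (hd_unique D f x).
  - exact Hf.
Qed.

Lemma hd_deriv_in (D : R -> Prop) (f : R -> R) (x : R) :
  perfect D -> D x -> diff_in D f x -> has_deriv_in D f x (deriv_in D f x).
Proof. intros HD Hx [l Hl]. now rewrite (deriv_in_eq D f x l). Qed.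

(** Valid even where no derivative exists: the two predicates given to [iota] are equivalent. *)
Lemma deriv_in_ext (D : R -> Prop) (f g : R -> R) (x : R) :
  (forall y, D y -> f y = g y) -> D x -> deriv_in D f x = deriv_in D g x.
Proof.
  intros H Hx. 
  apply eq_close.
  apply (close_iota (T := R_CompleteNormedModule)).
  intros l; split; apply hd_ext; auto. intros; now rewrite H.
Qed.

(** * Smooth functions relative to a set *)

Definition deriv_on (D : R -> Prop) (f g : R -> R) : Prop :=
  forall x, D x -> has_deriv_in D f x (g x).

(** Differentiability of order [n] through witnesses for the derivatives instead of iterated [iota].
    Closure under the operations then becomes a plain induction on [n]. *)
Fixpoint cn (D : R -> Prop) (n : nat) (f : R -> R) : Prop :=
  match n with
  | O => True
  | S m => exists g, deriv_on D f g /\ cn D m g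
  end.

Definition csmooth (D : R -> Prop) (f : R -> R) : Prop := forall n, cn D n f.

Lemma cn_S (D : R -> Prop) (n : nat) (f : R -> R) : cn D (S n) f -> cn D n f.
Proof.
  revert f; induction n as [|n IH]; intros f; [easy|].
  intros [g [Hg Hn]]. exists g; split; auto.
Qed.

Lemma cn_ext (D : R -> Prop) (n : nat) (f g : R -> R) :
  (forall x, D x -> f x = g x) -> cn D n f -> cn D n g.
Proof.
  destruct n as [|n]; [easy|]. intros H [h [Hh Hn]].
  exists h; split; [|exact Hn]. intros x Hx. apply hd_ext with f; auto.
Qed.

Lemma csmooth_ext (D : R -> Prop) (f g : R -> R) :
  (forall x, D x -> f x = g x) -> csmooth D f -> csmooth D g.
Proof. intros H Hf n. now apply cn_ext with f. Qed.

Lemma cn_mono (D D' : R -> Prop) (n : nat) (f : R -> R) :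
  (forall y, D' y -> D y) -> cn D n f -> cn D' n f.
Proof.
  intros H; revert f; induction n as [|n IH]; intros f; [easy|].
  intros [g [Hg Hn]]. exists g; split; [|auto].
  intros x Hx. apply hd_mono with D; auto.
Qed.

Lemma csmooth_mono (D D' : R -> Prop) (f : R -> R) :
  (forall y, D' y -> D y) -> csmooth D f -> csmooth D' f.
Proof. intros H Hf n. now apply cn_mono with D. Qed.

Lemma cn_const (D : R -> Prop) (c : R) (n : nat) : cn D n (fun _ => c).
Proof.
  revert c; induction n as [|n IH]; intros c; [easy|].
  exists (fun _ => 0); split; [|apply IH]. intros x _; apply hd_const.
Qed.

Lemma cn_id (D : R -> Prop) (n : nat) : cn D n (fun t => t).
Proof.
  destruct n as [|n]; [easy|].
  exists (fun _ => 1); split; [|apply cn_const]. intros x _; apply hd_id.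
Qed.

Lemma cn_opp (D : R -> Prop) (n : nat) (f : R -> R) :
  cn D n f -> cn D n (fun t => - f t).
Proof.
  revert f; induction n as [|n IH]; intros f; [easy|].
  intros [g [Hg Hn]]. exists (fun t => - g t); split; [|auto].
  intros x Hx; apply hd_opp; auto.
Qed.

Lemma cn_plus (D : R -> Prop) (n : nat) (f g : R -> R) :
  cn D n f -> cn D n g -> cn D n (fun t => f t + g t).
Proof.
  revert f g; induction n as [|n IH]; intros f g; [easy|].
  intros [f' [Hf Hn]] [g' [Hg Hm]].
  exists (fun t => f' t + g' t); split; [|auto].
  intros x Hx; apply hd_plus; auto.
Qed.

Lemma cn_minus (D : R -> Prop) (n : nat) (f g : R -> R) :
  cn D n f -> cn D n g -> cn D n (fun t => f t - g t).
Proof. intros Hf Hg. apply (cn_plus D n f (fun t => - g t)); auto using cn_opp. Qed.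

Lemma cn_mult (D : R -> Prop) (n : nat) (f g : R -> R) :
  cn D n f -> cn D n g -> cn D n (fun t => f t * g t).
Proof.
  revert f g; induction n as [|n IH]; intros f g; [easy|].
  intros HF HG. pose proof (cn_S _ _ _ HF) as Hf0. pose proof (cn_S _ _ _ HG) as Hg0.
  destruct HF as [f' [Hf Hn]]. destruct HG as [g' [Hg Hm]].
  exists (fun t => f' t * g t + f t * g' t); split.
  - intros x Hx; apply hd_mult; auto.
  - apply (cn_plus D n (fun t => f' t * g t) (fun t => f t * g' t)); auto.
Qed.

Lemma cn_inv (D : R -> Prop) (n : nat) (f : R -> R) :
  (forall x, D x -> f x <> 0) -> cn D n f -> cn D n (fun t => / f t).
Proof.
  intros H0; induction n as [|n IH]; [easy|].
  intros HF. pose proof (cn_S _ _ _ HF) as Hf0. destruct HF as [f' [Hf Hn]].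
  (* Written as a product containing [/ f] itself, so that the induction hypothesis on [/ f] applies
     to the derivative. *)
  exists (fun t => - f' t * (/ f t * / f t)); split.
  - intros x Hx. eapply hd_eq; [apply hd_inv; auto|]. simpl. field. auto.
  - apply (cn_mult D n (fun t => - f' t) (fun t => / f t * / f t)).
    + now apply cn_opp.
    + apply (cn_mult D n (fun t => / f t) (fun t => / f t)); auto.
Qed.

Lemma cn_comp (D D' : R -> Prop) (n : nat) (f g : R -> R) :
  (forall x, D x -> D' (f x)) -> cn D n f -> cn D' n g ->
  cn D n (fun t => g (f t)).
Proof.
  intros H0; revert g; induction n as [|n IH]; intros g; [easy|].
  intros HF [g' [Hg Hm]]. pose proof (cn_S _ _ _ HF) as Hf0.
  destruct HF as [f' [Hf Hn]].
  exists (fun t => f' t * g' (f t)); split.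
  - intros x Hx. apply hd_comp with (D' := D'); auto.
  - apply (cn_mult D n f' (fun t => g' (f t))); auto.
Qed.

Lemma csmooth_const (D : R -> Prop) (c : R) : csmooth D (fun _ => c).
Proof. intros n; apply cn_const. Qed.

Lemma csmooth_id (D : R -> Prop) : csmooth D (fun t => t).
Proof. intros n; apply cn_id. Qed.

Lemma csmooth_opp (D : R -> Prop) (f : R -> R) :
  csmooth D f -> csmooth D (fun t => - f t).
Proof. intros Hf n. now apply cn_opp. Qed.

Lemma csmooth_plus (D : R -> Prop) (f g : R -> R) :
  csmooth D f -> csmooth D g -> csmooth D (fun t => f t + g t).
Proof. intros Hf Hg n. now apply cn_plus. Qed.

Lemma csmooth_minus (D : R -> Prop) (f g : R -> R) :
  csmooth D f -> csmooth D g -> csmooth D (fun t => f t - g t).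
Proof. intros Hf Hg n. now apply cn_minus. Qed.

Lemma csmooth_mult (D : R -> Prop) (f g : R -> R) :
  csmooth D f -> csmooth D g -> csmooth D (fun t => f t * g t).
Proof. intros Hf Hg n. now apply cn_mult. Qed.

Lemma csmooth_div (D : R -> Prop) (f g : R -> R) :
  (forall x, D x -> g x <> 0) ->
  csmooth D f -> csmooth D g -> csmooth D (fun t => f t / g t).
Proof.
  intros H0 Hf Hg. apply (csmooth_mult D f (fun t => / g t)); [exact Hf|].
  intros n. now apply cn_inv.
Qed.

Lemma csmooth_comp (D D' : R -> Prop) (f g : R -> R) :
  (forall x, D x -> D' (f x)) -> csmooth D f -> csmooth D' g ->
  csmooth D (fun t => g (f t)).
Proof. intros H Hf Hg n. now apply cn_comp with D'. Qed.

Lemma csmooth_deriv (D : R -> Prop) (f g : R -> R) :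
  perfect D -> csmooth D f -> deriv_on D f g -> csmooth D g.
Proof.
  intros HD Hf Hg n. destruct (Hf (S n)) as [h [Hh Hn]].
  apply cn_ext with h; [|exact Hn].
  intros x Hx. apply (hd_unique D f x); auto.
Qed.

Lemma csmooth_intro (D : R -> Prop) (u : nat -> R -> R) :
  (forall n, deriv_on D (u n) (u (S n))) -> csmooth D (u O).
Proof.
  intros H n. assert (Hm : forall n m, cn D n (u m)).
  { clear n; induction n as [|n IH]; intros m; [easy|].
    exists (u (S m)); auto. }
  apply Hm.
Qed.

(** [deriv_in_n] adds each new derivative on the outside. This peels one off from the inside, so
    that an explicit first derivative can be substituted. *)
Lemma deriv_in_n_shift (D : R -> Prop) (f g : R -> R) (n : nat) (x : R) :
  perfect D -> deriv_on D f g -> D x ->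
  deriv_in_n D f (S n) x = deriv_in_n D g n x.
Proof.
  intros HD Hfg; revert x; induction n as [|n IH]; intros x Hx.
  - apply deriv_in_eq; auto.
  - change (deriv_in D (deriv_in_n D f (S n)) x
            = deriv_in D (deriv_in_n D g n) x).
    apply deriv_in_ext; auto.
Qed.

Lemma smooth_on_deriv_on (D : R -> Prop) (f : R -> R) (n : nat) :
  perfect D -> smooth_on D f ->
  deriv_on D (deriv_in_n D f n) (deriv_in_n D f (S n)).
Proof. intros HD Hf x Hx. apply hd_deriv_in; auto. Qed.

Lemma smooth_on_csmooth (D : R -> Prop) (f : R -> R) :
  perfect D -> smooth_on D f <-> csmooth D f.
Proof.
  intros HD; split.
  - intros Hf. apply (csmooth_intro D (deriv_in_n D f)).
    intros n. now apply smooth_on_deriv_on.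
  - intros Hf n. revert f Hf; induction n as [|n IH]; intros f Hf x Hx.
    + destruct (Hf 1%nat) as [g [Hg _]]. exists (g x). auto.
    + destruct (Hf 1%nat) as [g [Hg _]].
      destruct (IH g (csmooth_deriv D f g HD Hf Hg) x Hx) as [l Hl].
      exists l. apply hd_ext with (deriv_in_n D g n); auto.
      intros y Hy. symmetry. now apply deriv_in_n_shift.
Qed.

Lemma perfect_everywhere : perfect everywhere.
Proof.
  intros x _ e He. exists (x + e / 2). split; [exact I|]. split; [lra|].
  replace (x + e / 2 - x) with (e / 2) by ring. rewrite Rabs_pos_eq; lra.
Qed.

Lemma smooth_is_derive (F : R -> R) (n : nat) (x : R) :
  smooth F -> is_derive (Derive_n F n) x (Derive_n F (S n) x).
Proof. intros H. apply Derive_correct. exact (H (S n) x). Qed.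

Lemma smooth_hd (D : R -> Prop) (F : R -> R) (n : nat) (x : R) :
  smooth F -> has_deriv_in D (Derive_n F n) x (Derive_n F (S n) x).
Proof. intros H. apply hd_of_is_derive, smooth_is_derive, H. Qed.

Lemma smooth_csmooth (D : R -> Prop) (F : R -> R) (n : nat) :
  smooth F -> csmooth D (Derive_n F n).
Proof.
  intros H. replace (Derive_n F n) with (Derive_n F (0 + n)) by reflexivity.
  apply (csmooth_intro D (fun m => Derive_n F (m + n))).
  intros m x Hx. apply (smooth_hd D F (m + n) x H).
Qed.

(** On such a set relative derivatives are ordinary ones; it is the bridge from [csmooth] to
    [Derive_n]. *)
Definition open_dom (D : R -> Prop) : Prop :=
  forall x, D x -> locally x D.

Lemma hd_open (D : R -> Prop) (f : R -> R) (x l : R) :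
  open_dom D -> D x -> has_deriv_in D f x l -> is_derive f x l.
Proof.
  intros HD Hx Hf. apply hd_everywhere. intros e He.
  destruct (Hf e He) as [d [Hd H]].
  destruct (HD x Hx) as [r Hr].
  exists (Rmin d r); split; [apply Rmin_pos; [exact Hd | apply cond_pos]|].
  intros y [[_ Hy] Hlt]. apply H. split; [split; auto|].
  - apply Hr. eapply Rlt_le_trans; [exact Hlt | apply Rmin_r].
  - eapply Rlt_le_trans; [exact Hlt | apply Rmin_l].
Qed.

Lemma cn_ex_derive_n (D : R -> Prop) (n : nat) (f : R -> R) (x : R) :
  open_dom D -> cn D n f -> D x -> ex_derive_n f n x.
Proof.
  intros HD; revert f x; induction n as [|n IH]; intros f x; [easy|].
  intros [g [Hg Hn]] Hx.
  assert (E : forall y, D y -> Derive f y = g y).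
  { intros y Hy. apply is_derive_unique, (hd_open D); auto. }
  destruct n as [|n].
  - exists (g x). apply (hd_open D); auto.
  - change (ex_derive (Derive_n f (S n)) x).
    apply ex_derive_ext with (Derive_n (Derive f) n).
    (* [Derive_n] also differentiates last on the outside, whereas the induction needs the innermost
       derivative replaced by [g]. *)
    { intros t. rewrite <- (PeanoNat.Nat.add_1_r n). exact (Derive_n_comp f n 1 t). }
    change (ex_derive_n (Derive f) (S n) x).
    apply ex_derive_n_ext_loc with g.
    + generalize (HD x Hx); apply filter_imp. intros y Hy. now rewrite E.
    + now apply IH.
Qed.

(** Allows a different formula near each point, as needed for a quotient whose denominator has
    zeros. *)
Lemma smooth_of_local (F : R -> R) :
  (forall x, exists D, open_dom D /\ D x /\ csmooth D F) -> smooth F.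
Proof.
  intros H n x. destruct (H x) as [D [HD [Hx HF]]].
  now apply cn_ex_derive_n with D.
Qed.

Lemma smooth_everywhere (F : R -> R) : smooth F <-> csmooth everywhere F.
Proof.
  split.
  - intros H. exact (smooth_csmooth everywhere F 0 H).
  - intros H. apply smooth_of_local. intros x. exists everywhere.
    split; [|split; [exact I | exact H]].
    intros y _. exists (mkposreal 1 Rlt_0_1). intros; exact I.
Qed.

(** One-sided derivatives at the ends of a segment thus become ordinary derivatives of any smooth
    extension. *)
Lemma deriv_in_n_global (D : R -> Prop) (f F : R -> R) (n : nat) (x : R) :
  perfect D -> smooth F -> (forall y, D y -> F y = f y) -> D x ->
  deriv_in_n D f n x = Derive_n F n x.
Proof.
  intros HD HF Hf; revert x; induction n as [|n IH]; intros x Hx.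
  - simpl. now rewrite Hf.
  - apply deriv_in_eq; auto. apply hd_ext with (Derive_n F n); auto.
    + intros y Hy. now rewrite IH.
    + now apply smooth_hd.
Qed.

Lemma deriv_in_global (D : R -> Prop) (f F : R -> R) (x : R) :
  perfect D -> smooth F -> (forall y, D y -> F y = f y) -> D x ->
  deriv_in D f x = Derive_n F 1 x.
Proof. intros. now apply (deriv_in_n_global D f F 1). Qed.

Lemma is_derive_Derive_n_S (F : R -> R) (n : nat) (g : R -> R) (x l : R) :
  (forall y, Derive_n F n y = g y) -> is_derive g x l -> Derive_n F (S n) x = l.
Proof.
  intros H Hg. change (Derive (Derive_n F n) x = l).
  rewrite (Derive_ext _ g); [now apply is_derive_unique | exact H].
Qed.

(** * Division by a linear factor *)

Section Hadamard.

Variables (F : R -> R) (t0 : R).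
Hypothesis HF : smooth F.

(** The n-th derivative in [x] of F'(t0 + s (x - t0)); each derivative brings out one more factor
    [s]. *)
Let slope_integrand (n : nat) (x s : R) : R :=
  s ^ n * Derive_n F (S n) (t0 + s * (x - t0)).

Local Lemma is_derive_slope_integrand (n : nat) (x s : R) :
  is_derive (fun x => slope_integrand n x s) x (slope_integrand (S n) x s).
Proof.
  unfold slope_integrand.
  assert (H : is_derive (fun x => Derive_n F (S n) (t0 + s * (x - t0))) x
                (s * Derive_n F (S (S n)) (t0 + s * (x - t0)))).
  { apply (is_derive_comp (Derive_n F (S n)) (fun x => t0 + s * (x - t0))).
    - apply smooth_is_derive, HF.
    - auto_derive; [easy | ring]. }
  apply (is_derive_scal _ _ (s ^ n)) in H.
  replace (s ^ S n * Derive_n F (S (S n)) (t0 + s * (x - t0)))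
    with (s ^ n * (s * Derive_n F (S (S n)) (t0 + s * (x - t0))))
    by (simpl pow; ring).
  exact H.
Qed.

Local Lemma continuity_2d_slope_integrand (n : nat) (x s : R) :
  continuity_2d_pt (slope_integrand n) x s.
Proof.
  unfold slope_integrand. apply continuity_2d_pt_mult.
  - apply (continuity_1d_2d_pt_comp (fun s => s ^ n) (fun _ s => s)).
    + apply derivable_continuous_pt, derivable_pt_pow.
    + apply continuity_2d_pt_id2.
  - apply (continuity_1d_2d_pt_comp (Derive_n F (S n))
             (fun x s => t0 + s * (x - t0))).
    + apply continuity_pt_filterlim, (ex_derive_continuous (Derive_n F (S n))).
      exact (HF (S (S n)) _).
    + apply continuity_2d_pt_plus; [apply continuity_2d_pt_const|].
      apply continuity_2d_pt_mult; [apply continuity_2d_pt_id2|].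
      apply continuity_2d_pt_minus; [apply continuity_2d_pt_id1|].
      apply continuity_2d_pt_const.
Qed.

Local Lemma continuous_slope_integrand (n : nat) (x s : R) :
  continuous (slope_integrand n x) s.
Proof.
  apply continuity_pt_filterlim.
  pose proof (continuity_2d_slope_integrand n x s) as H.
  intros e He. destruct (H (mkposreal e He)) as [d Hd].
  exists d; split; [apply cond_pos|].
  intros y [_ Hy]. apply Hd; [|exact Hy].
  rewrite Rminus_diag, Rabs_R0. apply cond_pos.
Qed.

Local Lemma ex_RInt_slope_integrand (n : nat) (x : R) :
  ex_RInt (slope_integrand n x) 0 1.
Proof.
  apply (ex_RInt_continuous (V := R_CompleteNormedModule)). intros s _.
  apply continuous_slope_integrand.
Qed.

(** Differentiation under the integral sign, justified by joint continuity of the differentiated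
    integrand. *)
Local Lemma is_derive_slope (n : nat) (x : R) :
  is_derive (fun x => RInt (slope_integrand n x) 0 1) x
    (RInt (slope_integrand (S n) x) 0 1).
Proof.
  assert (E : forall u v, Derive (fun z => slope_integrand n z v) u
                          = slope_integrand (S n) u v).
  { intros u v. apply is_derive_unique, is_derive_slope_integrand. }
  rewrite (RInt_ext (slope_integrand (S n) x)
             (fun s => Derive (fun z => slope_integrand n z s) x))
    by (intros; now rewrite E).
  apply (is_derive_RInt_param (slope_integrand n)).
  - apply filter_forall. intros y s _.
    eexists; apply is_derive_slope_integrand.
  - intros s _. apply continuity_2d_pt_ext with (slope_integrand (S n)).
    + intros; now rewrite E.
    + apply continuity_2d_slope_integrand.
  - apply filter_forall. intros y. apply ex_RInt_slope_integrand.
Qed.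

(* The quotient is the integral of [F'(t0 + s (x - t0))] over [0 <= s <= 1]. *)
Lemma hadamard :
  exists M, csmooth everywhere M /\
    forall x, F x = F t0 + (x - t0) * M x.
Proof.
  exists (fun x => RInt (slope_integrand 0 x) 0 1). split.
  - apply (csmooth_intro everywhere
             (fun n x => RInt (slope_integrand n x) 0 1)).
    intros n x _. apply hd_everywhere, is_derive_slope.
  - intros x.
    assert (H : is_RInt (fun s => scal (x - t0) (slope_integrand 0 x s)) 0 1
                  (minus (F (t0 + 1 * (x - t0))) (F (t0 + 0 * (x - t0))))).
    { apply (is_RInt_derive (fun s => F (t0 + s * (x - t0)))).
      - intros s _.
        replace (scal (x - t0) (slope_integrand 0 x s))
          with ((x - t0) * Derive_n F 1 (t0 + s * (x - t0)))
          by (unfold slope_integrand, scal; simpl; unfold mult; simpl; ring).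
        apply (is_derive_comp F (fun s => t0 + s * (x - t0))).
        + apply (smooth_is_derive F 0), HF.
        + auto_derive; [easy | ring].
      - intros s _. apply (continuous_scal_r (x - t0) (slope_integrand 0 x)).
        apply continuous_slope_integrand. }
    apply (is_RInt_unique (V := R_CompleteNormedModule)) in H.
    rewrite (RInt_scal (V := R_CompleteNormedModule)) in H
      by apply ex_RInt_slope_integrand.
    unfold scal, minus, plus, opp in H; simpl in H; unfold mult in H; simpl in H.
    replace (t0 + 1 * (x - t0)) with x in H by ring.
    replace (t0 + 0 * (x - t0)) with t0 in H by ring.
    lra.
Qed.

End Hadamard.

(** * Generic pairs and their extensions *)

Lemma list_separated (l : list R) (x : R) :
  exists d, 0 < d /\ forall y, y <> x -> Rabs (y - x) < d -> ~ In y l.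
Proof.
  induction l as [|z l [d [Hd IH]]].
  - exists 1; split; [lra | easy].
  - destruct (Req_dec z x) as [->|Hz].
    + exists d; split; [exact Hd|]. intros y Hy Hlt [E|E]; [auto|].
      now apply (IH y).
    + exists (Rmin d (Rabs (z - x))). split.
      { apply Rmin_pos; [exact Hd | apply Rabs_pos_lt; lra]. }
      intros y Hy Hlt [E|E].
      * subst z. pose proof (Rmin_r d (Rabs (y - x))). lra.
      * apply (IH y); auto.
        pose proof (Rmin_l d (Rabs (z - x))). lra.
Qed.

(** General position: a nearby interior point can avoid finitely many exceptions. It moves to the
    right of [x], except at the right end, where it moves to the left. *)
Lemma seg_dense (L : R) (l : list R) (x eps : R) :
  0 < L -> seg L x -> 0 < eps ->
  exists y, 0 < y < L /\ y <> x /\ Rabs (y - x) < eps /\ ~ In y l.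
Proof.
  intros HL [Hx0 HxL] He. destruct (list_separated l x) as [d [Hd Hl]].
  destruct (Rlt_le_dec x L) as [Hlt|Hge].
  - set (m := Rmin (Rmin eps d) (L - x)).
    assert (Hm : 0 < m) by (unfold m; repeat apply Rmin_pos; lra).
    assert (m <= eps /\ m <= d /\ m <= L - x) as [H1 [H2 H3]].
    { unfold m. pose proof (Rmin_l (Rmin eps d) (L - x)).
      pose proof (Rmin_r (Rmin eps d) (L - x)).
      pose proof (Rmin_l eps d). pose proof (Rmin_r eps d). lra. }
    exists (x + m / 2).
    assert (Ha : Rabs (x + m / 2 - x) = m / 2).
    { replace (x + m / 2 - x) with (m / 2) by ring. apply Rabs_pos_eq; lra. }
    repeat split; try lra. apply Hl; [lra | rewrite Ha; lra].
  - set (m := Rmin (Rmin eps d) x).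
    assert (Hm : 0 < m) by (unfold m; repeat apply Rmin_pos; lra).
    assert (m <= eps /\ m <= d /\ m <= x) as [H1 [H2 H3]].
    { unfold m. pose proof (Rmin_l (Rmin eps d) x).
      pose proof (Rmin_r (Rmin eps d) x).
      pose proof (Rmin_l eps d). pose proof (Rmin_r eps d). lra. }
    exists (x - m / 2).
    assert (Ha : Rabs (x - m / 2 - x) = m / 2).
    { replace (x - m / 2 - x) with (- (m / 2)) by ring.
      rewrite Rabs_Ropp. apply Rabs_pos_eq; lra. }
    repeat split; try lra. apply Hl; [lra | rewrite Ha; lra].
Qed.

Lemma perfect_punctured (L : R) (l : list R) : 0 < L -> perfect (punctured L l).
Proof.
  intros HL x [Hx _] e He.
  destruct (seg_dense L l x e HL Hx He) as [y [Hy [Hyx [Hlt Hl]]]].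
  exists y. repeat split; auto; lra.
Qed.

Lemma perfect_seg (L : R) : 0 < L -> perfect (seg L).
Proof.
  intros HL x Hx e He.
  destruct (seg_dense L nil x e HL Hx He) as [y [Hy [Hyx [Hlt _]]]].
  exists y. repeat split; auto; lra.
Qed.

Lemma perfect_iff (D D' : R -> Prop) :
  (forall x, D x <-> D' x) -> perfect D -> perfect D'.
Proof.
  intros H HD x Hx e He. apply H in Hx.
  destruct (HD x Hx e He) as [y [Hy Hr]]. exists y. split; [now apply H | exact Hr].
Qed.

Lemma zero_of_dense (L : R) (l : list R) (u u' : R -> R) :
  0 < L -> deriv_on (seg L) u u' ->
  (forall y, 0 < y < L -> ~ In y l -> u y = 0) ->
  forall x, seg L x -> u x = 0.
Proof.
  intros HL Hu H0 x Hx. apply NNPP; intros Hne.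
  destruct (hd_neq0 _ _ _ _ (Hu x Hx) Hne) as [d [Hd H]].
  destruct (seg_dense L l x d HL Hx Hd) as [y [Hy [_ [Hlt Hl]]]].
  apply (H y); auto. split; lra.
Qed.

Lemma list_filter_prop (P : R -> Prop) (l : list R) :
  exists l', forall x, In x l' <-> In x l /\ P x.
Proof.
  induction l as [|z l [l' IH]].
  - exists nil. simpl; tauto.
  - destruct (classic (P z)) as [Hz|Hz].
    + exists (z :: l'). intros x; simpl. rewrite IH.
      split; [intros [<-|[H1 H2]]; auto | intros [[<-|H1] H2]; auto].
    + exists l'. intros x; simpl. rewrite IH.
      split; [intros [H1 H2]; auto|].
      intros [[<-|H1] H2]; [contradiction | auto].
Qed.

(** Compactness by a supremum: take the [x] for which the zeros in [0, x] fit into a list. Since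
    zeros are isolated, the supremum of these [x] can be passed unless it is [L]. *)
Lemma finite_simple_zeros (L : R) (u u' : R -> R) :
  0 < L -> deriv_on (seg L) u u' ->
  (forall x, seg L x -> u x = 0 -> u' x <> 0) ->
  exists l, forall x, In x l <-> seg L x /\ u x = 0.
Proof.
  intros HL Hu Hs.
  assert (Hiso : forall x, seg L x -> exists d, 0 < d /\
            forall y, seg L y -> y <> x -> Rabs (y - x) < d -> u y <> 0).
  { intros x Hx. destruct (Req_dec (u x) 0) as [E|E].
    - exact (hd_isolated_zero _ _ _ _ (Hu x Hx) E (Hs x Hx E)).
    - destruct (hd_neq0 _ _ _ _ (Hu x Hx) E) as [d [Hd H]].
      exists d; split; auto. }
  set (E := fun x => seg L x /\ exists l, forall r, 0 <= r <= x -> u r = 0 -> In r l).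
  assert (HE0 : E 0).
  { split; [split; lra|]. exists (0 :: nil). intros r Hr _. left. lra. }
  destruct (completeness E) as [s [Hub Hlub]].
  { exists L. intros x [[_ Hx] _]. exact Hx. }
  { now exists 0. }
  assert (Hs0 : 0 <= s) by (apply Hub; exact HE0).
  assert (HsL : s <= L) by (apply Hlub; intros x [[_ Hx] _]; exact Hx).
  destruct (Hiso s (conj Hs0 HsL)) as [d [Hd Hds]].
  assert (Hx : exists x, E x /\ s - d < x).
  { apply NNPP; intros Hn. assert (Hb : is_upper_bound E (s - d)).
    { intros x Hx. apply Rnot_lt_le. intros Hlt. apply Hn. now exists x. }
    specialize (Hlub _ Hb). lra. }
  destruct Hx as [x [[[Hx0 HxL] [l Hl]] Hxs]].
  (* Beyond [x] and up to s + d / 2 only [s] itself can be a zero, so one more entry suffices. *)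
  assert (HEm : E (Rmin L (s + d / 2))).
  { split.
    - split; [apply Rmin_glb; lra | apply Rmin_l].
    - exists (s :: l). intros r [Hr0 Hr] Hur.
      pose proof (Rmin_l L (s + d / 2)). pose proof (Rmin_r L (s + d / 2)).
      destruct (Rle_dec r x) as [Hrx|Hrx]; [right; apply Hl; auto|].
      destruct (Req_dec r s) as [->|Hrs]; [now left|]. exfalso.
      apply (Hds r); auto; [split; lra | apply Rabs_def1; lra]. }
  assert (HLs : L <= s).
  { pose proof (Hub _ HEm) as H. unfold Rmin in H.
    destruct (Rle_dec L (s + d / 2)); lra. }
  destruct HEm as [_ [l0 Hl0]].
  (* The list built so far may contain points that are not zeros. *)
  destruct (list_filter_prop (fun r => seg L r /\ u r = 0) l0) as [l1 Hl1].
  exists l1. intros r. rewrite Hl1. split; [tauto|]. intros [Hr Hur].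
  split; [|auto]. apply Hl0; [|exact Hur].
  destruct Hr as [Hr0 Hr]. split; [exact Hr0|]. apply Rmin_glb; lra.
Qed.

(** [c] is twice the centre of the reflection and [s] the parity sign; each derivative contributes a
    further factor -1. *)
Lemma Derive_n_reflect (F : R -> R) (c s : R) :
  smooth F -> (forall x, F (c - x) = s * F x) ->
  forall n x, Derive_n F n (c - x) = s * (-1) ^ n * Derive_n F n x.
Proof.
  intros HF H n; induction n as [|n IH]; intros x.
  - simpl. rewrite H. ring.
  - assert (H1 : is_derive (fun y => Derive_n F n (c - y)) x
                   (- Derive_n F (S n) (c - x))).
    { replace (- Derive_n F (S n) (c - x))
        with (-1 * Derive_n F (S n) (c - x)) by ring.
      apply (is_derive_comp (Derive_n F n) (fun y => c - y)).
      - now apply smooth_is_derive.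
      - auto_derive; [easy | ring]. }
    assert (H2 : is_derive (fun y => Derive_n F n (c - y)) x
                   (s * (-1) ^ n * Derive_n F (S n) x)).
    { apply (is_derive_ext (fun y => s * (-1) ^ n * Derive_n F n y)).
      - intros t. now rewrite IH.
      - apply (is_derive_scal (Derive_n F n)). now apply smooth_is_derive. }
    apply is_derive_unique in H1. apply is_derive_unique in H2.
    rewrite H1 in H2. simpl pow. lra.
Qed.

Definition dual_wronsk (F Lm : R -> R) (t : R) : R :=
  Derive_n F 1 t * Derive_n Lm 2 t - Derive_n F 2 t * Derive_n Lm 1 t.

(** The derivative of [dual_wronsk], in which the two terms F'' Lm'' have cancelled. *)
Definition dual_wronsk' (F Lm : R -> R) (t : R) : R :=
  Derive_n F 1 t * Derive_n Lm 3 t - Derive_n F 3 t * Derive_n Lm 1 t.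

Lemma hd_dual_wronsk (D : R -> Prop) (F Lm : R -> R) (t : R) :
  smooth F -> smooth Lm ->
  has_deriv_in D (dual_wronsk F Lm) t (dual_wronsk' F Lm t).
Proof.
  intros HF HL. eapply hd_eq.
  - apply hd_minus; apply hd_mult; now apply smooth_hd.
  - unfold dual_wronsk'. ring.
Qed.

(* The conditions on a generic pair, in terms of extensions of its members to
   the whole line. *)
Record global_pair (L : R) (F Lm : R -> R) : Prop := {
  glp_length : 0 < L;
  glp_smooth_F : smooth F;
  glp_smooth_Lm : smooth Lm;
  glp_odd : odd F;
  glp_even : even Lm;
  glp_per_F : periodic (2 * L) F;
  glp_per_Lm : periodic (2 * L) Lm;
  glp_pos : forall t, 0 < t < L -> 0 < F t;
  glp_start : Derive_n F 1 0 = 1;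
  glp_end : Derive_n F 1 L = -1;
  glp_morse_F : forall t, seg L t -> Derive_n F 1 t = 0 -> Derive_n F 2 t <> 0;
  glp_morse_Lm : forall t, seg L t -> Derive_n Lm 1 t = 0 -> Derive_n Lm 2 t <> 0;
  glp_immersed : forall t, seg L t -> Derive_n F 1 t = 0 -> Derive_n Lm 1 t <> 0;
  glp_simple : forall t, seg L t ->
    dual_wronsk F Lm t = 0 -> dual_wronsk' F Lm t <> 0
}.

Lemma wronsk_global (L : R) (f Lam F Lm : R -> R) (t : R) :
  0 < L -> smooth F -> smooth Lm ->
  (forall r, seg L r -> F r = f r) -> (forall r, seg L r -> Lm r = Lam r) ->
  seg L t -> wronsk L f Lam t = dual_wronsk F Lm t.
Proof.
  intros HL HF HLm Hf HLam Ht. unfold wronsk, dual_wronsk.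
  pose proof (perfect_seg L HL) as HD.
  rewrite (deriv_in_global _ f F), (deriv_in_global _ Lam Lm),
    (deriv_in_n_global _ f F), (deriv_in_n_global _ Lam Lm); auto.
Qed.

Lemma deriv_wronsk_global (L : R) (f Lam F Lm : R -> R) (t : R) :
  0 < L -> smooth F -> smooth Lm ->
  (forall r, seg L r -> F r = f r) -> (forall r, seg L r -> Lm r = Lam r) ->
  seg L t -> deriv_in (seg L) (wronsk L f Lam) t = dual_wronsk' F Lm t.
Proof.
  intros HL HF HLm Hf HLam Ht. pose proof (perfect_seg L HL) as HD.
  apply deriv_in_eq; auto. apply hd_ext with (dual_wronsk F Lm); auto.
  - intros y Hy. symmetry. now apply wronsk_global.
  - now apply hd_dual_wronsk.
Qed.

Lemma generic_of_global (L : R) (f Lam F Lm : R -> R) :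
  global_pair L F Lm ->
  (forall r, seg L r -> F r = f r) -> (forall r, seg L r -> Lm r = Lam r) ->
  generic_pair L f Lam.
Proof.
  intros H Hf HLam. pose proof (glp_length _ _ _ H) as HL.
  pose proof (perfect_seg L HL) as HD.
  pose proof (glp_smooth_F _ _ _ H) as HF.
  pose proof (glp_smooth_Lm _ _ _ H) as HLm.
  assert (E1 : forall r, seg L r -> deriv_in (seg L) f r = Derive_n F 1 r)
    by (intros; now apply deriv_in_global).
  assert (E2 : forall r, seg L r -> deriv_in (seg L) Lam r = Derive_n Lm 1 r)
    by (intros; now apply deriv_in_global).
  constructor.
  - exact HL.
  - intros r Hr. rewrite <- Hf by (split; lra). now apply (glp_pos _ _ _ H).
  - exists F. repeat split; auto; apply H.
  - exists Lm. repeat split; auto; apply H.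
  - rewrite E1 by (split; lra). apply H.
  - rewrite E1 by (split; lra). apply H.
  - intros r Hr. rewrite E1, (deriv_in_n_global _ f F) by auto.
    now apply (glp_morse_F _ _ _ H).
  - intros r Hr. rewrite E2, (deriv_in_n_global _ Lam Lm) by auto.
    now apply (glp_morse_Lm _ _ _ H).
  - intros r Hr. rewrite E1, E2 by auto.
    destruct (Req_dec (Derive_n F 1 r) 0) as [E|E].
    + pose proof (pow2_gt_0 _ (glp_immersed _ _ _ H r Hr E)).
      pose proof (pow2_ge_0 (Derive_n F 1 r)). lra.
    + pose proof (pow2_gt_0 _ E).
      pose proof (pow2_ge_0 (Derive_n Lm 1 r)). lra.
  - intros r Hr. rewrite (wronsk_global L f Lam F Lm),
      (deriv_wronsk_global L f Lam F Lm) by auto.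
    now apply (glp_simple _ _ _ H).
Qed.

Lemma global_of_generic (L : R) (f Lam : R -> R) :
  generic_pair L f Lam ->
  exists F Lm, global_pair L F Lm /\
    (forall r, seg L r -> F r = f r) /\ (forall r, seg L r -> Lm r = Lam r).
Proof.
  intros H. pose proof (gp_length _ _ _ H) as HL.
  pose proof (perfect_seg L HL) as HD.
  destruct (gp_ext_f _ _ _ H) as [F [HF [Hodd [HperF Hf]]]].
  destruct (gp_ext_Lam _ _ _ H) as [Lm [HLm [Heven [HperL HLam]]]].
  exists F, Lm. split; [|auto].
  assert (E1 : forall r, seg L r -> deriv_in (seg L) f r = Derive_n F 1 r)
    by (intros; now apply deriv_in_global).
  assert (E2 : forall r, seg L r -> deriv_in (seg L) Lam r = Derive_n Lm 1 r)
    by (intros; now apply deriv_in_global).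
  constructor; auto.
  - intros t Ht. rewrite Hf by (split; lra). now apply (gp_pos _ _ _ H).
  - rewrite <- E1 by (split; lra). apply H.
  - rewrite <- E1 by (split; lra). apply H.
  - intros r Hr. rewrite <- E1, <- (deriv_in_n_global (seg L) f F) by auto.
    now apply (gp_morse_f _ _ _ H).
  - intros r Hr. rewrite <- E2, <- (deriv_in_n_global (seg L) Lam Lm) by auto.
    now apply (gp_morse_Lam _ _ _ H).
  - intros r Hr Ef El. pose proof (gp_immersed _ _ _ H r Hr) as Hi.
    rewrite E1, E2, Ef, El in Hi by auto. lra.
  - intros r Hr. rewrite <- (wronsk_global L f Lam F Lm),
      <- (deriv_wronsk_global L f Lam F Lm) by auto.
    now apply (gp_simple_zeros _ _ _ H).
Qed.

(* By periodicity, [F] is odd and [Lm] is even about both endpoints. *)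
Lemma global_pair_endpoint (L : R) (F Lm : R -> R) (e : R) :
  smooth F -> smooth Lm -> odd F -> even Lm ->
  periodic (2 * L) F -> periodic (2 * L) Lm -> e = 0 \/ e = L ->
  F e = 0 /\ Derive_n F 2 e = 0 /\ Derive_n Lm 1 e = 0 /\ Derive_n Lm 3 e = 0.
Proof.
  intros HF HLm Ho He HpF HpL Hel.
  assert (HFr : forall x, F (2 * e - x) = -1 * F x).
  { intros x. destruct Hel as [-> | ->].
    - replace (2 * 0 - x) with (- x) by ring. rewrite Ho. ring.
    - replace (2 * L - x) with (- x + 2 * L) by ring. rewrite HpF, Ho. ring. }
  assert (HLr : forall x, Lm (2 * e - x) = 1 * Lm x).
  { intros x. destruct Hel as [-> | ->].
    - replace (2 * 0 - x) with (- x) by ring. rewrite He. ring.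
    - replace (2 * L - x) with (- x + 2 * L) by ring. rewrite HpL, He. ring. }
  pose proof (Derive_n_reflect F _ _ HF HFr 0 e) as H0.
  pose proof (Derive_n_reflect F _ _ HF HFr 2 e) as H2.
  pose proof (Derive_n_reflect Lm _ _ HLm HLr 1 e) as H1.
  pose proof (Derive_n_reflect Lm _ _ HLm HLr 3 e) as H3.
  replace (2 * e - e) with e in * by ring.
  simpl pow in *. simpl (Derive_n F 0 e) in H0. repeat split; lra.
Qed.

(** The square root of 2h with its sign already resolved; [chart_sign] shows that the sign rule
    forces this choice. *)
Definition chart_a (F Lm : R -> R) (t : R) : R :=
  Derive_n Lm 1 t / Derive_n F 1 t.

Definition chart_k (F Lm : R -> R) (t : R) : R :=
  Lm t - F t * chart_a F Lm t.

Lemma hd_chart_a (D : R -> Prop) (F Lm : R -> R) (t : R) :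
  smooth F -> smooth Lm -> Derive_n F 1 t <> 0 ->
  has_deriv_in D (chart_a F Lm) t (dual_wronsk F Lm t / (Derive_n F 1 t) ^ 2).
Proof.
  intros HF HL H0. eapply hd_eq.
  - apply hd_div; [now apply smooth_hd | now apply smooth_hd | exact H0].
  - unfold dual_wronsk. field. exact H0.
Qed.

(** The identity k' = - F a': in (Lm - F a)' the terms Lm' and F' a cancel by the definition of
    [chart_a]. *)
Lemma hd_chart_k (D : R -> Prop) (F Lm : R -> R) (t : R) :
  smooth F -> smooth Lm -> Derive_n F 1 t <> 0 ->
  has_deriv_in D (chart_k F Lm) t
    (- F t * (dual_wronsk F Lm t / (Derive_n F 1 t) ^ 2)).
Proof.
  intros HF HL H0. eapply hd_eq.
  - apply hd_minus; [exact (smooth_hd D Lm 0 t HL)|].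
    apply hd_mult; [exact (smooth_hd D F 0 t HF) | now apply hd_chart_a].
  - unfold dual_wronsk, chart_a. field. exact H0.
Qed.

Record global_realization (L : R) (I : R -> Prop) (a k F Lm : R -> R) : Prop := {
  glr_pair : global_pair L F Lm;
  glr_domain : forall r, I r <-> seg L r /\ Derive_n F 1 r <> 0;
  glr_a : forall r, I r -> a r = chart_a F Lm r;
  glr_k : forall r, I r -> k r = chart_k F Lm r
}.

Lemma global_pair_critical_F (L : R) (F Lm : R -> R) :
  global_pair L F Lm ->
  exists l, forall x, In x l <-> seg L x /\ Derive_n F 1 x = 0.
Proof.
  intros H. apply (finite_simple_zeros L _ (Derive_n F 2)).
  - apply H.
  - intros x _. apply smooth_hd, H.
  - apply H.
Qed.

Lemma global_pair_wronsk_zeros (L : R) (F Lm : R -> R) :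
  global_pair L F Lm ->
  exists l, forall x, In x l <-> seg L x /\ dual_wronsk F Lm x = 0.
Proof.
  intros H. apply (finite_simple_zeros L _ (dual_wronsk' F Lm)).
  - apply H.
  - intros x _. apply hd_dual_wronsk; apply H.
  - apply H.
Qed.

Lemma perfect_regular (L : R) (F Lm : R -> R) (I : R -> Prop) :
  global_pair L F Lm -> (forall r, I r <-> seg L r /\ Derive_n F 1 r <> 0) ->
  perfect I.
Proof.
  intros H HI. destruct (global_pair_critical_F L F Lm H) as [l Hl].
  apply (perfect_iff (punctured L l)).
  - intros x. unfold punctured. rewrite HI, Hl. tauto.
  - apply perfect_punctured, H.
Qed.

Lemma sqrt_2_bif_h (u : R) : sqrt (2 * (/ 2 * u ^ 2)) = Rabs u.
Proof.
  replace (2 * (/ 2 * u ^ 2)) with (Rsqr u) by (unfold Rsqr; field).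
  apply sqrt_Rsqr_abs.
Qed.

(* Where the sign is wrong it is wrong on a neighbourhood, and there [k' a' > 0]
   at every point at which the Wronskian does not vanish. *)
Lemma chart_sign (L : R) (I : R -> Prop) (a k F Lm : R -> R) :
  global_pair L F Lm -> (forall r, I r <-> seg L r /\ Derive_n F 1 r <> 0) ->
  (forall r, I r -> a r = chart_a F Lm r \/ a r = - chart_a F Lm r) ->
  (forall r, I r -> k r = chart_k F Lm r) ->
  (forall r, I r -> diff_in I a r) ->
  (forall r, I r -> deriv_in I k r * deriv_in I a r <= 0) ->
  forall r, I r -> a r = chart_a F Lm r.
Proof.
  intros H HI Ha Hk Hd Hs r Hr.
  pose proof (perfect_regular L F Lm I H HI) as HP.
  pose proof (glp_smooth_F _ _ _ H) as HF.
  pose proof (glp_smooth_Lm _ _ _ H) as HLm.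
  apply NNPP; intros Hne.
  destruct (Hd r Hr) as [l Hl].
  destruct (hd_neq0 I (fun s => a s - chart_a F Lm s) r
              (l - dual_wronsk F Lm r / (Derive_n F 1 r) ^ 2))
    as [d [Hd0 Hdn]].
  { apply hd_minus; [exact Hl|]. apply hd_chart_a; auto. now apply HI. }
  { simpl; lra. }
  (* The next point [s] must avoid the zeros of F' and of the Wronskian, so that a' does not vanish
     there. *)
  destruct (global_pair_critical_F L F Lm H) as [l1 Hl1].
  destruct (global_pair_wronsk_zeros L F Lm H) as [l2 Hl2].
  destruct (seg_dense L (l1 ++ l2) r d (glp_length _ _ _ H)
              (proj1 (proj1 (HI r) Hr)) Hd0) as [s [Hs0 [_ [Hsr Hsl]]]].
  assert (Hseg : seg L s) by (split; lra).
  assert (HF1 : Derive_n F 1 s <> 0).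
  { intros E. apply Hsl, in_or_app. left. apply Hl1. auto. }
  assert (HW : dual_wronsk F Lm s <> 0).
  { intros E. apply Hsl, in_or_app. right. apply Hl2. auto. }
  assert (HsI : I s) by (apply HI; auto).
  assert (Da : deriv_in I a s
               = - (dual_wronsk F Lm s / (Derive_n F 1 s) ^ 2)).
  { apply deriv_in_eq; auto.
    (* This radius keeps the ball about [s] inside the ball of radius [d] about [r], where only the
       wrong sign is possible. *)
    apply hd_ext_loc with (f := fun t => - chart_a F Lm t)
                          (eps := d - Rabs (s - r)); auto; [lra| |].
    - intros y Hy Hlt. destruct (Ha y Hy) as [E|E]; [|now rewrite E].
      exfalso. apply (Hdn y Hy); [|lra].
      replace (y - r) with ((y - s) + (s - r)) by ring.
      pose proof (Rabs_triang (y - s) (s - r)). lra.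
    - apply hd_opp, hd_chart_a; auto. }
  assert (Dk : deriv_in I k s
               = - F s * (dual_wronsk F Lm s / (Derive_n F 1 s) ^ 2)).
  { apply deriv_in_eq; auto. apply hd_ext with (chart_k F Lm); auto.
    - intros y Hy. now rewrite Hk.
    - apply hd_chart_k; auto. }
  specialize (Hs s HsI). rewrite Da, Dk in Hs.
  pose proof (glp_pos _ _ _ H s Hs0) as HFs.
  assert (Hq : dual_wronsk F Lm s / (Derive_n F 1 s) ^ 2 <> 0).
  { apply Rmult_integral_contrapositive_currified; [exact HW|].
    apply Rinv_neq_0_compat, pow_nonzero, HF1. }
  (* With q the quotient in [Hq], the product k' a' equals F q^2 with F > 0, against the sign
     rule. *)
  pose proof (pow2_gt_0 _ Hq). nra.
Qed.

Lemma global_of_realized (L : R) (I : R -> Prop) (a k f Lam : R -> R) :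
  realized_by L I a k f Lam ->
  exists F Lm, global_realization L I a k F Lm /\
    (forall r, seg L r -> F r = f r) /\ (forall r, seg L r -> Lm r = Lam r).
Proof.
  intros H.
  destruct (global_of_generic _ _ _ (rb_generic _ _ _ _ _ _ H))
    as [F [Lm [HG [Hf HLam]]]].
  exists F, Lm. split; [|auto].
  pose proof (perfect_seg L (glp_length _ _ _ HG)) as HD.
  assert (E1 : forall r, seg L r -> deriv_in (seg L) f r = Derive_n F 1 r)
    by (intros; apply deriv_in_global; auto; apply HG).
  assert (E2 : forall r, seg L r -> deriv_in (seg L) Lam r = Derive_n Lm 1 r)
    by (intros; apply deriv_in_global; auto; apply HG).
  assert (HI : forall r, I r <-> seg L r /\ Derive_n F 1 r <> 0).
  { intros r. rewrite (rb_domain _ _ _ _ _ _ H r).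
    split; intros [Hr H0]; split; auto.
    - now rewrite <- E1.
    - now rewrite E1. }
  assert (Hk : forall r, I r -> k r = chart_k F Lm r).
  { intros r Hr. rewrite (rb_k _ _ _ _ _ _ H r Hr).
    apply HI in Hr. destruct Hr as [Hr _].
    unfold bif_k, chart_k, chart_a. now rewrite E1, E2, Hf, HLam. }
  constructor; auto.
  apply (chart_sign L I a k F Lm); auto.
  - intros r Hr. pose proof (rb_a _ _ _ _ _ _ H r Hr) as Ha.
    apply HI in Hr. destruct Hr as [Hr _].
    unfold bif_h in Ha. rewrite sqrt_2_bif_h, E1, E2 in Ha by auto.
    fold (chart_a F Lm r) in Ha.
    unfold Rabs in Ha. destruct (Rcase_abs (chart_a F Lm r)); lra.
  - intros r Hr. apply (rb_diff _ _ _ _ _ _ H r Hr).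
  - apply (rb_sign _ _ _ _ _ _ H).
Qed.

Lemma realized_of_global (L : R) (I : R -> Prop) (a k f Lam F Lm : R -> R) :
  global_realization L I a k F Lm ->
  (forall r, seg L r -> F r = f r) -> (forall r, seg L r -> Lm r = Lam r) ->
  realized_by L I a k f Lam.
Proof.
  intros [HG HI Ha Hk] Hf HLam.
  pose proof (glp_smooth_F _ _ _ HG) as HF.
  pose proof (glp_smooth_Lm _ _ _ HG) as HLm.
  pose proof (perfect_seg L (glp_length _ _ _ HG)) as HD.
  pose proof (perfect_regular L F Lm I HG HI) as HP.
  assert (E1 : forall r, seg L r -> deriv_in (seg L) f r = Derive_n F 1 r)
    by (intros; apply deriv_in_global; auto).
  assert (E2 : forall r, seg L r -> deriv_in (seg L) Lam r = Derive_n Lm 1 r)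
    by (intros; apply deriv_in_global; auto).
  assert (Da : forall r, I r ->
            has_deriv_in I a r (dual_wronsk F Lm r / (Derive_n F 1 r) ^ 2)).
  { intros r Hr. apply hd_ext with (chart_a F Lm); auto.
    - intros y Hy. now rewrite Ha.
    - apply hd_chart_a; auto. now apply HI. }
  assert (Dk : forall r, I r -> has_deriv_in I k r
            (- F r * (dual_wronsk F Lm r / (Derive_n F 1 r) ^ 2))).
  { intros r Hr. apply hd_ext with (chart_k F Lm); auto.
    - intros y Hy. now rewrite Hk.
    - apply hd_chart_k; auto. now apply HI. }
  constructor.
  - now apply (generic_of_global L f Lam F Lm).
  - intros r. rewrite HI. split; intros [Hr H0]; split; auto.
    + now rewrite E1.
    + now rewrite <- E1.
  - intros r Hr. rewrite (Ha r Hr). apply HI in Hr. destruct Hr as [Hr _].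
    unfold bif_h. rewrite sqrt_2_bif_h, E1, E2 by auto.
    fold (chart_a F Lm r).
    unfold Rabs. destruct (Rcase_abs (chart_a F Lm r)); lra.
  - intros r Hr. rewrite (Hk r Hr). apply HI in Hr. destruct Hr as [Hr _].
    unfold bif_k, chart_k, chart_a. now rewrite E1, E2, Hf, HLam.
  - intros r Hr. split; eexists; eauto.
  - intros r Hr. rewrite (deriv_in_eq _ _ _ _ HP Hr (Da r Hr)),
      (deriv_in_eq _ _ _ _ HP Hr (Dk r Hr)).
    apply HI in Hr. destruct Hr as [[H0 HL] _].
    (* Since k' a' = - F a'^2, the sign rule amounts to F >= 0, which has to include the two
       endpoints, where F vanishes. *)
    assert (HFr : 0 <= F r).
    { destruct (global_pair_endpoint L F Lm 0) as [F0 _]; try apply HG; auto.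
      destruct (global_pair_endpoint L F Lm L) as [FL _]; try apply HG; auto.
      destruct (Req_dec r 0) as [->|N0]; [lra|].
      destruct (Req_dec r L) as [->|NL]; [lra|].
      apply Rlt_le, (glp_pos _ _ _ HG). lra. }
    pose proof (pow2_ge_0 (dual_wronsk F Lm r / Derive_n F 1 r ^ 2)). nra.
Qed.

(** The vanishing derivatives give k' = 0 and a'' = 0 at the endpoint, because W' = F'' = 0 there.
    So the norms reduce to |a'| and |k''|, and k'' = - F' a'. *)
Lemma chart_norm_endpoint (I : R -> Prop) (a k F Lm : R -> R) (e : R) :
  perfect I -> I e -> smooth F -> smooth Lm ->
  (forall r, I r -> Derive_n F 1 r <> 0) ->
  (forall r, I r -> a r = chart_a F Lm r) ->
  (forall r, I r -> k r = chart_k F Lm r) ->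
  F e = 0 -> Derive_n F 2 e = 0 -> Derive_n Lm 1 e = 0 -> Derive_n Lm 3 e = 0 ->
  chart_norm I a k 1 e = Rabs (dual_wronsk F Lm e / (Derive_n F 1 e) ^ 2) /\
  chart_norm I a k 2 e = Rabs (dual_wronsk F Lm e / Derive_n F 1 e).
Proof.
  intros HP He HF HLm H1 Ha Hk F0 F2 L1 L3.
  assert (HW' : dual_wronsk' F Lm e = 0).
  { unfold dual_wronsk'. rewrite L1, L3. ring. }
  set (a' := fun r => dual_wronsk F Lm r / (Derive_n F 1 r) ^ 2).
  set (k' := fun r => - F r * a' r).
  assert (Da : deriv_on I a a').
  { intros r Hr. apply hd_ext with (chart_a F Lm); auto.
    - intros y Hy. now rewrite Ha.
    - apply hd_chart_a; auto. }
  assert (Dk : deriv_on I k k').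
  { intros r Hr. apply hd_ext with (chart_k F Lm); auto.
    - intros y Hy. now rewrite Hk.
    - apply hd_chart_k; auto. }
  assert (D2a : has_deriv_in I a' e 0).
  { eapply hd_eq.
    - apply hd_div with (g := fun r => (Derive_n F 1 r) * (Derive_n F 1 r * 1)).
      + now apply hd_dual_wronsk.
      + apply hd_mult; [now apply smooth_hd|].
        apply hd_mult; [now apply smooth_hd | apply hd_const].
      + apply (pow_nonzero _ 2). auto.
    - rewrite HW', F2. field. auto. }
  assert (D2k : has_deriv_in I k' e (- (dual_wronsk F Lm e / Derive_n F 1 e))).
  { eapply hd_eq.
    - apply hd_mult; [apply hd_opp; exact (smooth_hd I F 0 e HF) | exact D2a].
    - cbv beta. unfold a'. field. auto. }
  unfold chart_norm.
  rewrite !(deriv_in_n_shift I a a' _ e), !(deriv_in_n_shift I k k' _ e) by auto.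
  simpl deriv_in_n.
  rewrite (deriv_in_eq I a' e 0), (deriv_in_eq I k' e _ HP He D2k) by auto.
  unfold k'. rewrite F0. fold (a' e).
  split; rewrite <- sqrt_Rsqr_abs; f_equal; unfold Rsqr; ring.
Qed.

(** * Projective curves *)

Lemma vec_eq (u v : vec) : px u = px v -> py u = py v -> pz u = pz v -> u = v.
Proof.
  destruct u as [[u1 u2] u3], v as [[v1 v2] v3]; unfold px, py, pz; simpl.
  now intros -> -> ->.
Qed.

Lemma vec_neq0 (v : vec) : px v <> 0 \/ py v <> 0 \/ pz v <> 0 -> v <> vzero.
Proof. intros H ->. unfold px, py, pz in H. simpl in H. tauto. Qed.

Lemma vec_neq0_inv (v : vec) :
  v <> vzero -> px v <> 0 \/ py v <> 0 \/ pz v <> 0.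
Proof.
  intros H. apply NNPP; intros Hn. apply H. apply vec_eq; simpl; apply NNPP; tauto.
Qed.

Lemma proj_eq_iff (u v : vec) :
  proj_eq u v <->
  exists c, c <> 0 /\ px u = c * px v /\ py u = c * py v /\ pz u = c * pz v.
Proof.
  split; intros [c [Hc H]]; exists c; (split; [exact Hc|]).
  - subst u. repeat split.
  - apply vec_eq; apply H.
Qed.

Lemma proj_eq_sym (u v : vec) : proj_eq u v -> proj_eq v u.
Proof.
  rewrite !proj_eq_iff. intros [c [Hc [H1 [H2 H3]]]]. exists (/ c).
  split; [now apply Rinv_neq_0_compat|].
  rewrite H1, H2, H3. repeat split; field; exact Hc.
Qed.

Lemma proj_eq_trans (u v w : vec) : proj_eq u v -> proj_eq v w -> proj_eq u w.
Proof.
  rewrite !proj_eq_iff. intros [c [Hc [H1 [H2 H3]]]] [d [Hd [K1 [K2 K3]]]].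
  exists (c * d). split; [now apply Rmult_integral_contrapositive_currified|].
  rewrite H1, H2, H3, K1, K2, K3. repeat split; ring.
Qed.

Lemma proj_eq_cross (u v : vec) : proj_eq u v -> cross u v = vzero.
Proof.
  rewrite proj_eq_iff. intros [c [_ [H1 [H2 H3]]]].
  destruct u as [[u1 u2] u3], v as [[v1 v2] v3]; unfold px, py, pz in *; simpl in *.
  subst. apply vec_eq; unfold cross, px, py, pz; simpl; ring.
Qed.

Lemma cross_eq0 (u v : vec) :
  cross u v = vzero ->
  py u * pz v = pz u * py v /\ pz u * px v = px u * pz v /\
  px u * py v = py u * px v.
Proof.
  intros H. injection H as H1 H2 H3. unfold px, py, pz in *. repeat split; lra.
Qed.

Lemma dot_self_pos (v : vec) : v <> vzero -> 0 < dot v v.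
Proof.
  intros H. unfold dot.
  pose proof (pow2_ge_0 (px v)). pose proof (pow2_ge_0 (py v)).
  pose proof (pow2_ge_0 (pz v)).
  destruct (vec_neq0_inv v H) as [N|[N|N]]; apply pow2_gt_0 in N; nra.
Qed.

(** The factor is expressed by dot products, so that it is smooth when [u] and [v] run along smooth
    curves; [parallel_curves_scale] relies on this. *)
Lemma parallel_scale (u v : vec) :
  v <> vzero -> cross u v = vzero ->
  px u = dot u v / dot v v * px v /\ py u = dot u v / dot v v * py v /\
  pz u = dot u v / dot v v * pz v.
Proof.
  intros Hv Hc. pose proof (dot_self_pos v Hv) as Hp.
  apply cross_eq0 in Hc. destruct Hc as [H1 [H2 H3]].
  assert (E : forall a b, a * dot v v = dot u v * b -> a = dot u v / dot v v * b).
  { intros a b Eab. replace (dot u v / dot v v * b) with (dot u v * b / dot v v)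
      by (field; lra). rewrite <- Eab. field. lra. }
  repeat split; apply E; unfold dot.
  - replace ((px u * px v + py u * py v + pz u * pz v) * px v)
      with (px u * px v * px v + (py u * px v) * py v + (pz u * px v) * pz v) by ring.
    rewrite <- H3, H2. ring.
  - replace ((px u * px v + py u * py v + pz u * pz v) * py v)
      with ((px u * py v) * px v + py u * py v * py v + (pz u * py v) * pz v) by ring.
    rewrite H3, <- H1. ring.
  - replace ((px u * px v + py u * py v + pz u * pz v) * pz v)
      with ((px u * pz v) * px v + (py u * pz v) * py v + pz u * pz v * pz v) by ring.
    rewrite H1, <- H2. ring.
Qed.

Lemma cross_proj_eq (u v : vec) :
  u <> vzero -> v <> vzero -> cross u v = vzero -> proj_eq u v.
Proof.
  intros Hu Hv Hc. apply proj_eq_iff. exists (dot u v / dot v v).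
  destruct (parallel_scale u v Hv Hc) as [H1 [H2 H3]].
  repeat split; auto. intros E. rewrite E, Rmult_0_l in H1, H2, H3.
  apply Hu, vec_eq; auto.
Qed.

Lemma px_scal (c : R) (v : vec) : px (scal c v) = c * px v.
Proof. reflexivity. Qed.

Lemma py_scal (c : R) (v : vec) : py (scal c v) = c * py v.
Proof. reflexivity. Qed.

Lemma pz_scal (c : R) (v : vec) : pz (scal c v) = c * pz v.
Proof. reflexivity. Qed.

Lemma px_cross (u v : vec) : px (cross u v) = py u * pz v - pz u * py v.
Proof. reflexivity. Qed.

Lemma py_cross (u v : vec) : py (cross u v) = pz u * px v - px u * pz v.
Proof. reflexivity. Qed.

Lemma pz_cross (u v : vec) : pz (cross u v) = px u * py v - py u * px v.
Proof. reflexivity. Qed.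

Definition curve_smooth (D : R -> Prop) (G : R -> vec) : Prop :=
  csmooth D (fun t => px (G t)) /\ csmooth D (fun t => py (G t)) /\
  csmooth D (fun t => pz (G t)).

Lemma dvec_deriv (D : R -> Prop) (G G' : R -> vec) (n : nat) (t : R) :
  perfect D -> D t ->
  deriv_on D (fun s => px (G s)) (fun s => px (G' s)) ->
  deriv_on D (fun s => py (G s)) (fun s => py (G' s)) ->
  deriv_on D (fun s => pz (G s)) (fun s => pz (G' s)) ->
  dvec D G (S n) t = dvec D G' n t.
Proof.
  intros HD Ht Hx Hy Hz. unfold dvec.
  now rewrite (deriv_in_n_shift D _ _ n t HD Hx Ht),
    (deriv_in_n_shift D _ _ n t HD Hy Ht), (deriv_in_n_shift D _ _ n t HD Hz Ht).
Qed.

Lemma dvec_0 (D : R -> Prop) (G : R -> vec) (t : R) : dvec D G 0 t = G t.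
Proof. apply vec_eq; reflexivity. Qed.

Lemma hd_dvec (D : R -> Prop) (G : R -> vec) (n : nat) (t : R) :
  perfect D -> curve_smooth D G -> D t ->
  has_deriv_in D (fun s => px (dvec D G n s)) t (px (dvec D G (S n) t)) /\
  has_deriv_in D (fun s => py (dvec D G n s)) t (py (dvec D G (S n) t)) /\
  has_deriv_in D (fun s => pz (dvec D G n s)) t (pz (dvec D G (S n) t)).
Proof.
  intros HD [Hx [Hy Hz]] Ht. apply (smooth_on_csmooth D _ HD) in Hx, Hy, Hz.
  exact (conj (smooth_on_deriv_on D _ n HD Hx t Ht)
    (conj (smooth_on_deriv_on D _ n HD Hy t Ht)
          (smooth_on_deriv_on D _ n HD Hz t Ht))).
Qed.

Lemma is_lift_curve_smooth (D : R -> Prop) (G : R -> vec) :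
  perfect D -> is_lift D G <-> curve_smooth D G /\ forall t, D t -> G t <> vzero.
Proof.
  intros HD. unfold is_lift, curve_smooth.
  rewrite !(smooth_on_csmooth D _ HD). tauto.
Qed.

(** Independence of the lift. The terms with c' and c'' are multiples of earlier columns of the
    determinants and drop out. *)
Lemma star_kappa_scale (D : R -> Prop) (G H : R -> vec) (c : R -> R) :
  perfect D -> csmooth D c -> curve_smooth D H ->
  (forall t, D t -> px (G t) = c t * px (H t) /\ py (G t) = c t * py (H t) /\
                    pz (G t) = c t * pz (H t)) ->
  forall t, D t ->
    star D G t = scal ((c t) ^ 2) (star D H t) /\
    kappa D G t = (c t) ^ 3 * kappa D H t.
Proof.
  intros HD Hc HH HG t Ht.
  apply (smooth_on_csmooth D _ HD) in Hc.
  pose proof (smooth_on_deriv_on D c 0 HD Hc) as C1.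
  pose proof (smooth_on_deriv_on D c 1 HD Hc) as C2.
  set (c1 := deriv_in_n D c 1) in *. set (c2 := deriv_in_n D c 2) in *.
  change (deriv_in_n D c 0) with c in C1.
  set (H1 := dvec D H 1). set (H2 := dvec D H 2).
  pose proof (fun s Hs => hd_dvec D H 0 s HD HH Hs) as HH1.
  pose proof (fun s Hs => hd_dvec D H 1 s HD HH Hs) as HH2.
  fold H1 in HH1, HH2. fold H2 in HH2.
  (* The first two derivatives of c H by the Leibniz rule, written out so that they can replace the
     iterated [deriv_in]. *)
  set (G1 := fun s => (c1 s * px (H s) + c s * px (H1 s),
                       c1 s * py (H s) + c s * py (H1 s),
                       c1 s * pz (H s) + c s * pz (H1 s)) : vec).
  set (G2 := fun s =>
    ((c2 s * px (H s) + c1 s * px (H1 s)) + (c1 s * px (H1 s) + c s * px (H2 s)),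
     (c2 s * py (H s) + c1 s * py (H1 s)) + (c1 s * py (H1 s) + c s * py (H2 s)),
     (c2 s * pz (H s) + c1 s * pz (H1 s)) + (c1 s * pz (H1 s) + c s * pz (H2 s)))
    : vec).
  assert (E1 : forall n s, D s -> dvec D G (S n) s = dvec D G1 n s).
  { intros n s Hs; apply dvec_deriv; auto; intros r Hr;
      destruct (HH1 r Hr) as [Kx [Ky Kz]].
    - apply hd_ext with (fun s => c s * px (H s)); auto.
      + intros y Hy. symmetry. now apply HG.
      + exact (hd_mult D c _ r _ _ (C1 r Hr) Kx).
    - apply hd_ext with (fun s => c s * py (H s)); auto.
      + intros y Hy. symmetry. now apply HG.
      + exact (hd_mult D c _ r _ _ (C1 r Hr) Ky).
    - apply hd_ext with (fun s => c s * pz (H s)); auto.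
      + intros y Hy. symmetry. now apply HG.
      + exact (hd_mult D c _ r _ _ (C1 r Hr) Kz). }
  assert (E2 : dvec D G 2 t = G2 t).
  { rewrite E1 by exact Ht. rewrite (dvec_deriv D G1 G2); auto using dvec_0;
      intros r Hr; destruct (HH1 r Hr) as [Kx [Ky Kz]];
      destruct (HH2 r Hr) as [Jx [Jy Jz]].
    - exact (hd_plus D _ _ r _ _ (hd_mult D c1 _ r _ _ (C2 r Hr) Kx)
                                 (hd_mult D c _ r _ _ (C1 r Hr) Jx)).
    - exact (hd_plus D _ _ r _ _ (hd_mult D c1 _ r _ _ (C2 r Hr) Ky)
                                 (hd_mult D c _ r _ _ (C1 r Hr) Jy)).
    - exact (hd_plus D _ _ r _ _ (hd_mult D c1 _ r _ _ (C2 r Hr) Kz)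
                                 (hd_mult D c _ r _ _ (C1 r Hr) Jz)). }
  destruct (HG t Ht) as [Gx [Gy Gz]].
  assert (Es : star D G t = scal ((c t) ^ 2) (star D H t)).
  { unfold star. rewrite E1, dvec_0 by exact Ht. fold H1.
    assert (Px : px (G1 t) = c1 t * px (H t) + c t * px (H1 t)) by reflexivity.
    assert (Py : py (G1 t) = c1 t * py (H t) + c t * py (H1 t)) by reflexivity.
    assert (Pz : pz (G1 t) = c1 t * pz (H t) + c t * pz (H1 t)) by reflexivity.
    apply vec_eq; rewrite ?px_scal, ?py_scal, ?pz_scal, ?px_cross, ?py_cross,
      ?pz_cross, ?Gx, ?Gy, ?Gz, ?Px, ?Py, ?Pz; ring. }
  split; [exact Es|].
  unfold kappa. rewrite Es, E2. fold H2.
  assert (Px : px (G2 t) = (c2 t * px (H t) + c1 t * px (H1 t))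
                           + (c1 t * px (H1 t) + c t * px (H2 t))) by reflexivity.
  assert (Py : py (G2 t) = (c2 t * py (H t) + c1 t * py (H1 t))
                           + (c1 t * py (H1 t) + c t * py (H2 t))) by reflexivity.
  assert (Pz : pz (G2 t) = (c2 t * pz (H t) + c1 t * pz (H1 t))
                           + (c1 t * pz (H1 t) + c t * pz (H2 t))) by reflexivity.
  unfold star, dot. fold H1.
  rewrite px_scal, py_scal, pz_scal, px_cross, py_cross, pz_cross, Px, Py, Pz. ring.
Qed.

Lemma csmooth_dot (D : R -> Prop) (G H : R -> vec) :
  curve_smooth D G -> curve_smooth D H -> csmooth D (fun t => dot (G t) (H t)).
Proof.
  intros [Gx [Gy Gz]] [Hx [Hy Hz]].
  apply (csmooth_plus D (fun t => px (G t) * px (H t) + py (G t) * py (H t))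
           (fun t => pz (G t) * pz (H t))).
  - apply (csmooth_plus D (fun t => px (G t) * px (H t))
             (fun t => py (G t) * py (H t))); now apply csmooth_mult.
  - now apply csmooth_mult.
Qed.

Lemma parallel_curves_scale (D : R -> Prop) (G H : R -> vec) :
  curve_smooth D G -> curve_smooth D H ->
  (forall t, D t -> G t <> vzero) -> (forall t, D t -> H t <> vzero) ->
  (forall t, D t -> cross (G t) (H t) = vzero) ->
  exists c, csmooth D c /\ (forall t, D t -> c t <> 0) /\
    forall t, D t -> px (G t) = c t * px (H t) /\ py (G t) = c t * py (H t) /\
                     pz (G t) = c t * pz (H t).
Proof.
  intros HsG HsH HG HH Hc.
  exists (fun t => dot (G t) (H t) / dot (H t) (H t)). split; [|split].
  - apply (csmooth_div D (fun t => dot (G t) (H t)) (fun t => dot (H t) (H t))).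
    + intros t Ht. apply Rgt_not_eq, dot_self_pos; auto.
    + now apply csmooth_dot.
    + now apply csmooth_dot.
  - intros t Ht E. destruct (parallel_scale _ _ (HH t Ht) (Hc t Ht)) as [E1 [E2 E3]].
    rewrite E, Rmult_0_l in E1, E2, E3. now apply (HG t Ht), vec_eq.
  - intros t Ht. apply parallel_scale; auto.
Qed.

(** The reflection in 0 and the shift by [2 * L] generate a group whose translates of [0, L] cover
    the line. *)
Lemma symmetric_ind (L : R) (P : R -> Prop) :
  0 < L -> (forall t, seg L t -> P t) -> (forall t, P t -> P (- t)) ->
  (forall t, P t -> P (t + 2 * L)) -> forall t, P t.
Proof.
  intros HL Hs Hn Hp.
  assert (Hm : forall t, P (t - 2 * L) -> P t).
  { intros t Ht. replace t with (t - 2 * L + 2 * L) by ring. auto. }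
  assert (H : forall (n : nat) t, 0 <= t <= L + 2 * L * INR n -> P t).
  { induction n as [|n IH]; intros t Ht.
    - simpl in Ht. apply Hs. split; lra.
    - rewrite S_INR in Ht. destruct (Rle_dec t L) as [H1|H1].
      + apply Hs. split; lra.
      + apply Hm. destruct (Rle_dec (t - 2 * L) 0) as [H2|H2].
        (* A point between L and 2 L is the mirror image of a point of [0, L], shifted by one
           period. *)
        * replace (t - 2 * L) with (- (2 * L - t)) by ring. apply Hn, Hs. split; lra.
        * apply IH. lra. }
  assert (H0 : forall t, 0 <= t -> P t).
  { intros t Ht. destruct (INR_archimed (2 * L) t) as [n Hn0]; [lra|].
    apply (H n). nra. }
  intros t. destruct (Rle_dec 0 t) as [H1|H1]; [auto|].
  replace t with (- - t) by ring. apply Hn, H0. lra.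
Qed.

(** * From the pair to the curve *)

(* The vector product of [(F, Lm, 1)] with its derivative: the curve whose
   tangent lines are the lines [(F, Lm, 1)]. *)
Definition envelope (F Lm : R -> R) (t : R) : vec :=
  (- Derive_n Lm 1 t, Derive_n F 1 t,
   F t * Derive_n Lm 1 t - Lm t * Derive_n F 1 t).

Lemma envelope_smooth (D : R -> Prop) (F Lm : R -> R) :
  smooth F -> smooth Lm -> curve_smooth D (envelope F Lm).
Proof.
  intros HF HL. repeat split.
  - apply (csmooth_opp D (Derive_n Lm 1)). now apply smooth_csmooth.
  - apply (smooth_csmooth D F 1 HF).
  - apply (csmooth_minus D (fun t => F t * Derive_n Lm 1 t)
             (fun t => Lm t * Derive_n F 1 t)); apply csmooth_mult.
    + apply (smooth_csmooth D F 0 HF).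
    + now apply smooth_csmooth.
    + apply (smooth_csmooth D Lm 0 HL).
    + now apply smooth_csmooth.
Qed.

(** With l = (F, Lm, 1) the envelope is l x l' and its derivative is l x l''. Both are orthogonal to
    l, so their product is det(l, l', l'') l, and this determinant is the Wronskian. *)
Lemma envelope_star_kappa (D : R -> Prop) (F Lm : R -> R) (t : R) :
  perfect D -> smooth F -> smooth Lm -> D t ->
  star D (envelope F Lm) t = scal (dual_wronsk F Lm t) (F t, Lm t, 1) /\
  kappa D (envelope F Lm) t = (dual_wronsk F Lm t) ^ 2.
Proof.
  intros HD HF HL Ht.
  set (E1 := fun s => (- Derive_n Lm 2 s, Derive_n F 2 s,
                       F s * Derive_n Lm 2 s - Lm s * Derive_n F 2 s) : vec).
  set (E2 := fun s => (- Derive_n Lm 3 s, Derive_n F 3 s,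
      Derive_n F 1 s * Derive_n Lm 2 s + F s * Derive_n Lm 3 s
      - (Derive_n Lm 1 s * Derive_n F 2 s + Lm s * Derive_n F 3 s)) : vec).
  assert (D1 : forall n s, D s -> dvec D (envelope F Lm) (S n) s = dvec D E1 n s).
  { intros n s Hs. apply dvec_deriv; auto; intros r Hr; 
      unfold px, py, pz, envelope, E1; cbn [fst snd].
    - apply (hd_opp D (Derive_n Lm 1)). now apply smooth_hd.
    - now apply smooth_hd.
    - eapply hd_eq.
      + apply hd_minus; apply hd_mult.
        * apply (smooth_hd D F 0 r HF).
        * now apply smooth_hd.
        * apply (smooth_hd D Lm 0 r HL).
        * now apply smooth_hd.
      + cbv beta. ring. }
  assert (D2 : dvec D E1 1 t = E2 t).
  { rewrite (dvec_deriv D E1 E2); auto using dvec_0; intros r Hr;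
      unfold px, py, pz, E1, E2; cbn [fst snd].
    - apply (hd_opp D (Derive_n Lm 2)). now apply smooth_hd.
    - now apply smooth_hd.
    - apply hd_minus; apply hd_mult.
      + apply (smooth_hd D F 0 r HF).
      + now apply smooth_hd.
      + apply (smooth_hd D Lm 0 r HL).
      + now apply smooth_hd. }
  assert (Es : star D (envelope F Lm) t = scal (dual_wronsk F Lm t) (F t, Lm t, 1)).
  { unfold star. rewrite D1, dvec_0 by exact Ht.
    apply vec_eq; rewrite ?px_scal, ?py_scal, ?pz_scal, ?px_cross, ?py_cross,
      ?pz_cross; unfold E1, envelope, px, py, pz, dual_wronsk;
      cbn [fst snd]; ring. }
  split; [exact Es|].
  unfold kappa. rewrite Es, D1, D2 by exact Ht. unfold dot.
  rewrite px_scal, py_scal, pz_scal.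
  unfold E2, px, py, pz, dual_wronsk; cbn [fst snd]. ring.
Qed.

Lemma hd_dual_wronsk' (D : R -> Prop) (F Lm : R -> R) (t : R) :
  smooth F -> smooth Lm -> diff_in D (dual_wronsk' F Lm) t.
Proof.
  intros HF HL. eexists. apply hd_minus; apply hd_mult; now apply smooth_hd.
Qed.

(** Turns a simple zero of the Wronskian into a cusp, as [kappa] of the envelope is its square. *)
Lemma deriv2_square_at_zero (D : R -> Prop) (u w w' : R -> R) (t : R) :
  perfect D -> D t -> (forall s, D s -> u s = (w s) ^ 2) ->
  deriv_on D w w' -> diff_in D w' t -> w t = 0 ->
  deriv_in_n D u 2 t = 2 * (w' t) ^ 2.
Proof.
  intros HD Ht Hu Hw [w2 Hw2] H0.
  rewrite (deriv_in_n_shift D u (fun s => 2 * (w s * w' s)) 1 t HD); auto.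
  - apply deriv_in_eq; auto. eapply hd_eq.
    + apply hd_mult; [apply hd_const|]. apply hd_mult; [exact (Hw t Ht) | exact Hw2].
    + simpl. rewrite H0. ring.
  - intros s Hs. apply hd_ext with (fun s => w s * w s); auto.
    + intros y Hy. rewrite Hu by exact Hy. ring.
    + eapply hd_eq; [apply hd_mult; exact (Hw s Hs) | cbv beta; ring].
Qed.

(** If F' vanished as well, the Wronskian would be - F'' Lm', nonzero by the Morse and immersion
    conditions; symmetrically for Lm'. *)
Lemma global_pair_singular (L : R) (F Lm : R -> R) (t : R) :
  global_pair L F Lm -> seg L t -> dual_wronsk F Lm t = 0 ->
  Derive_n F 1 t <> 0 /\ Derive_n Lm 1 t <> 0.
Proof.
  intros H Ht HW. unfold dual_wronsk in HW.
  assert (H1 : Derive_n F 1 t <> 0).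
  { intros E. pose proof (glp_immersed _ _ _ H t Ht E).
    pose proof (glp_morse_F _ _ _ H t Ht E).
    rewrite E in HW. apply (Rmult_integral_contrapositive_currified
      (Derive_n F 2 t) (Derive_n Lm 1 t)); lra. }
  split; [exact H1|]. intros E.
  pose proof (glp_morse_Lm _ _ _ H t Ht E). rewrite E in HW.
  apply (Rmult_integral_contrapositive_currified
      (Derive_n F 1 t) (Derive_n Lm 2 t)); lra.
Qed.

Lemma envelope_neq0 (L : R) (F Lm : R -> R) (t : R) :
  global_pair L F Lm -> seg L t -> envelope F Lm t <> vzero.
Proof.
  intros H Ht. apply vec_neq0. unfold envelope, px, py, pz; cbn [fst snd].
  destruct (Req_dec (Derive_n F 1 t) 0) as [E|E]; [|auto].
  left. pose proof (glp_immersed _ _ _ H t Ht E). lra.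
Qed.

(** [star] and [kappa] vanish together, both being controlled by the Wronskian, so straightening
    never occurs. *)
Lemma envelope_good (L : R) (F Lm : R -> R) (t : R) :
  global_pair L F Lm -> seg L t ->
  ~ straightening (seg L) (envelope F Lm) t /\
  (singular (seg L) (envelope F Lm) t -> cusp (seg L) (envelope F Lm) t) /\
  (singular (seg L) (envelope F Lm) t -> dual_wronsk F Lm t = 0).
Proof.
  intros H Ht. pose proof (perfect_seg L (glp_length _ _ _ H)) as HD.
  pose proof (glp_smooth_F _ _ _ H) as HF.
  pose proof (glp_smooth_Lm _ _ _ H) as HL.
  destruct (envelope_star_kappa (seg L) F Lm t HD HF HL Ht) as [Es Ek].
  assert (HS : singular (seg L) (envelope F Lm) t -> dual_wronsk F Lm t = 0).
  { intros S. unfold singular in S. rewrite Es in S.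
    apply (f_equal pz) in S. rewrite pz_scal in S. unfold pz in S; simpl in S. lra. }
  split; [|split; [|exact HS]].
  - intros [Hs Hk]. apply Hs. rewrite Es. rewrite Ek in Hk.
    assert (HW : dual_wronsk F Lm t = 0).
    { destruct (Req_dec (dual_wronsk F Lm t) 0) as [E|E]; [exact E|].
      exfalso. now apply (pow_nonzero _ 2 E). }
    rewrite HW. apply vec_eq; rewrite ?px_scal, ?py_scal, ?pz_scal, Rmult_0_l;
      reflexivity.
  - intros S. split; [exact S|]. specialize (HS S).
    rewrite (deriv2_square_at_zero _ _ (dual_wronsk F Lm) (dual_wronsk' F Lm)); auto.
    + pose proof (pow2_gt_0 _ (glp_simple _ _ _ H t Ht HS)). lra.
    + intros s Hs. now apply envelope_star_kappa.
    + intros s Hs. now apply hd_dual_wronsk.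
    + now apply hd_dual_wronsk'.
Qed.

Lemma envelope_chart (F Lm : R -> R) (t : R) :
  Derive_n F 1 t <> 0 ->
  proj_eq (envelope F Lm t) (chart_a F Lm t, -1, chart_k F Lm t).
Proof.
  intros H0. apply proj_eq_iff. exists (- Derive_n F 1 t).
  split; [lra|]. unfold envelope, chart_k, chart_a, px, py, pz; cbn [fst snd].
  repeat split; field; exact H0.
Qed.

Lemma sorted_rs (L : R) (rs : list R) :
  StronglySorted Rlt (0 :: rs ++ L :: nil) ->
  0 < L /\ forall r, In r rs -> 0 < r < L.
Proof.
  intros H. apply StronglySorted_inv in H. destruct H as [H H0].
  rewrite Forall_forall in H0. split.
  - apply H0, in_or_app. right; now left.
  - intros r Hr. split; [apply H0, in_or_app; now left|].
    clear H0. induction rs as [|q rs IH]; [easy|]. simpl in H.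
    apply StronglySorted_inv in H. destruct H as [H H1].
    rewrite Forall_forall in H1. destruct Hr as [<-|Hr].
    + apply H1, in_or_app. right; now left.
    + now apply IH.
Qed.

Lemma locally_within_punctured (D : R -> Prop) (t d : R) (P : R -> Prop) :
  0 < d -> (forall s, D s -> s <> t -> Rabs (s - t) < d -> P s) ->
  within D (locally' t) P.
Proof.
  intros Hd H. exists (mkposreal d Hd). intros s Hs Hne HDs. now apply H.
Qed.

Lemma filterlim_dual (D : R -> Prop) (F Lm : R -> R) (t : R) :
  smooth F -> smooth Lm ->
  filterlim (fun s => (F s, Lm s, 1) : vec) (within D (locally' t))
    (locally ((F t, Lm t, 1) : vec)).
Proof.
  intros HF HL. apply filterlim_locally. intros eps.
  destruct (hd_cont _ _ _ _ (smooth_hd everywhere F 0 t HF) eps (cond_pos eps))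
    as [d1 [Hd1 H1]].
  destruct (hd_cont _ _ _ _ (smooth_hd everywhere Lm 0 t HL) eps (cond_pos eps))
    as [d2 [Hd2 H2]].
  apply locally_within_punctured with (Rmin d1 d2); [now apply Rmin_pos|].
  intros s _ _ Hs. split; [split|].
  - apply H1; [exact I|]. eapply Rlt_le_trans; [exact Hs | apply Rmin_l].
  - apply H2; [exact I|]. eapply Rlt_le_trans; [exact Hs | apply Rmin_r].
  - apply ball_center.
Qed.

(** Any lift agrees projectively with the envelope in the chart. The vector product of the two is
    continuous, so it vanishes at the points at infinity and at the ends too. *)
Lemma lift_parallel_envelope (L : R) (rs : list R) (a k F Lm : R -> R)
    (G : R -> vec) :
  global_realization L (punctured L rs) a k F Lm -> lifts_gamma L rs a k G ->
  exists c, csmooth (seg L) c /\ (forall t, seg L t -> c t <> 0) /\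
    forall t, seg L t -> px (G t) = c t * px (envelope F Lm t) /\
      py (G t) = c t * py (envelope F Lm t) /\
      pz (G t) = c t * pz (envelope F Lm t).
Proof.
  intros HR [HG Hp]. pose proof (glr_pair _ _ _ _ _ _ HR) as HP.
  pose proof (glp_length _ _ _ HP) as HL0.
  pose proof (perfect_seg L HL0) as HD.
  apply (is_lift_curve_smooth _ _ HD) in HG. destruct HG as [HGs HG0].
  assert (HEs : curve_smooth (seg L) (envelope F Lm)) by (apply envelope_smooth; apply HP).
  apply parallel_curves_scale; auto.
  { intros t Ht. now apply (envelope_neq0 L). }
  assert (Hc : forall y, 0 < y < L -> ~ In y rs ->
            cross (G y) (envelope F Lm y) = vzero).
  { intros y Hy Hn. assert (Hpy : punctured L rs y) by (split; [split; lra | exact Hn]).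
    apply proj_eq_cross, proj_eq_trans with (a y, -1, k y); [now apply Hp|].
    apply proj_eq_sym. rewrite (glr_a _ _ _ _ _ _ HR y Hpy), (glr_k _ _ _ _ _ _ HR y Hpy).
    apply envelope_chart. now apply (glr_domain _ _ _ _ _ _ HR). }
  pose proof (fun s Hs => hd_dvec (seg L) G 0 s HD HGs Hs) as K1.
  pose proof (fun s Hs => hd_dvec (seg L) (envelope F Lm) 0 s HD HEs Hs) as K2.
  intros t Ht. apply vec_eq.
  - apply (zero_of_dense L rs (fun t => px (cross (G t) (envelope F Lm t)))
      (fun s => (py (dvec (seg L) G 1 s) * pz (envelope F Lm s)
                 + py (G s) * pz (dvec (seg L) (envelope F Lm) 1 s))
                - (pz (dvec (seg L) G 1 s) * py (envelope F Lm s)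
                 + pz (G s) * py (dvec (seg L) (envelope F Lm) 1 s)))); auto.
    + intros s Hs. destruct (K1 s Hs) as [A1 [A2 A3]]. destruct (K2 s Hs) as [B1 [B2 B3]].
      exact (hd_minus _ _ _ _ _ _ (hd_mult _ _ _ _ _ _ A2 B3)
                                  (hd_mult _ _ _ _ _ _ A3 B2)).
    + intros y Hy Hn. now rewrite Hc.
  - apply (zero_of_dense L rs (fun t => py (cross (G t) (envelope F Lm t)))
      (fun s => (pz (dvec (seg L) G 1 s) * px (envelope F Lm s)
                 + pz (G s) * px (dvec (seg L) (envelope F Lm) 1 s))
                - (px (dvec (seg L) G 1 s) * pz (envelope F Lm s)
                 + px (G s) * pz (dvec (seg L) (envelope F Lm) 1 s)))); auto.
    + intros s Hs. destruct (K1 s Hs) as [A1 [A2 A3]]. destruct (K2 s Hs) as [B1 [B2 B3]].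
      exact (hd_minus _ _ _ _ _ _ (hd_mult _ _ _ _ _ _ A3 B1)
                                  (hd_mult _ _ _ _ _ _ A1 B3)).
    + intros y Hy Hn. now rewrite Hc.
  - apply (zero_of_dense L rs (fun t => pz (cross (G t) (envelope F Lm t)))
      (fun s => (px (dvec (seg L) G 1 s) * py (envelope F Lm s)
                 + px (G s) * py (dvec (seg L) (envelope F Lm) 1 s))
                - (py (dvec (seg L) G 1 s) * px (envelope F Lm s)
                 + py (G s) * px (dvec (seg L) (envelope F Lm) 1 s)))); auto.
    + intros s Hs. destruct (K1 s Hs) as [A1 [A2 A3]]. destruct (K2 s Hs) as [B1 [B2 B3]].
      exact (hd_minus _ _ _ _ _ _ (hd_mult _ _ _ _ _ _ A1 B2)
                                  (hd_mult _ _ _ _ _ _ A2 B1)).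
    + intros y Hy Hn. now rewrite Hc.
Qed.

Lemma lift_tangent_line (L : R) (rs : list R) (a k F Lm : R -> R)
    (G : R -> vec) (t : R) :
  global_realization L (punctured L rs) a k F Lm -> lifts_gamma L rs a k G ->
  seg L t -> tangent_line (seg L) G t (F t, Lm t, 1).
Proof.
  intros HR HG Ht. pose proof (glr_pair _ _ _ _ _ _ HR) as HP.
  pose proof (perfect_seg L (glp_length _ _ _ HP)) as HD.
  pose proof (glp_smooth_F _ _ _ HP) as HF.
  pose proof (glp_smooth_Lm _ _ _ HP) as HLm.
  destruct (lift_parallel_envelope L rs a k F Lm G HR HG) as [c [Hcs [Hc0 HcG]]].
  (* The tangent covector of [G] is m (F, Lm, 1). Dividing by m leaves a covector that is smooth
     through the cusps. *)
  set (m := fun s => (c s) ^ 2 * dual_wronsk F Lm s).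
  assert (Hst : forall s, seg L s -> star (seg L) G s = scal (m s) (F s, Lm s, 1)).
  { intros s Hs.
    destruct (star_kappa_scale (seg L) G (envelope F Lm) c HD Hcs) with (t := s)
      as [E _]; auto; [now apply envelope_smooth|].
    destruct (envelope_star_kappa (seg L) F Lm s HD HF HLm Hs) as [E' _].
    rewrite E, E'. unfold m. apply vec_eq; rewrite ?px_scal, ?py_scal, ?pz_scal; ring. }
  assert (Hm : forall s, seg L s -> dual_wronsk F Lm s <> 0 -> m s <> 0).
  { intros s Hs HW. apply Rmult_integral_contrapositive_currified; [|exact HW].
    apply pow_nonzero; auto. }
  assert (Hinv : forall s, seg L s -> m s <> 0 ->
            (F s, Lm s, 1) = scal (/ m s) (star (seg L) G s) :> vec).
  { intros s Hs H0. rewrite Hst by exact Hs.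
    apply vec_eq; rewrite ?px_scal, ?py_scal, ?pz_scal; field; exact H0. }
  repeat split.
  - apply vec_neq0. right; right. unfold pz; simpl. lra.
  - intros HS. assert (H0 : m t <> 0).
    { intros E. apply HS. unfold singular. rewrite Hst, E by exact Ht.
      apply vec_eq; rewrite ?px_scal, ?py_scal, ?pz_scal, Rmult_0_l; reflexivity. }
    exists (/ m t). split; [now apply Rinv_neq_0_compat | now apply Hinv].
  - intros HS. assert (HW : dual_wronsk F Lm t = 0).
    { apply NNPP; intros HW. apply (Hm t Ht HW). unfold singular in HS.
      rewrite Hst in HS by exact Ht. apply (f_equal pz) in HS.
      rewrite pz_scal in HS. unfold pz in HS; simpl in HS. lra. }
    (* The scaling must be nonzero for every [s], hence the filler 1. It is not met near [t] inside
       the segment, where the zero at [t] is isolated. *)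
    exists (fun s => if Req_EM_T (m s) 0 then 1 else / m s). split.
    { intros s. destruct (Req_EM_T (m s) 0); [lra | now apply Rinv_neq_0_compat]. }
    destruct (hd_isolated_zero _ _ _ _ (hd_dual_wronsk (seg L) F Lm t HF HLm) HW
                (glp_simple _ _ _ HP t Ht HW)) as [d [Hd Hiso]].
    apply filterlim_ext_loc with (fun s => (F s, Lm s, 1) : vec);
      [|now apply filterlim_dual].
    apply locally_within_punctured with d; [exact Hd|]. intros s Hs Hne Hlt.
    pose proof (Hm s Hs (Hiso s Hs Hne Hlt)) as H0.
    destruct (Req_EM_T (m s) 0); [contradiction | now apply Hinv].
Qed.

Lemma curve_of_realization (L : R) (rs : list R) (a k F Lm : R -> R) :
  StronglySorted Rlt (0 :: rs ++ L :: nil) ->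
  global_realization L (punctured L rs) a k F Lm ->
  exists G, extends_to_good L rs a k G /\ tangents_condition L G /\
    cusps_condition L G /\ gluing_condition L rs a k G.
Proof.
  intros Hrs HR. destruct (sorted_rs L rs Hrs) as [HL0 Hin].
  pose proof (glr_pair _ _ _ _ _ _ HR) as HP.
  pose proof (perfect_seg L HL0) as HD.
  pose proof (glp_smooth_F _ _ _ HP) as HF.
  pose proof (glp_smooth_Lm _ _ _ HP) as HLm.
  pose proof (glr_domain _ _ _ _ _ _ HR) as HI.
  assert (HG : lifts_gamma L rs a k (envelope F Lm)).
  { split.
    - apply (is_lift_curve_smooth _ _ HD). split; [now apply envelope_smooth|].
      intros t Ht. now apply (envelope_neq0 L).
    - intros r Hr.
      rewrite (glr_a _ _ _ _ _ _ HR r Hr), (glr_k _ _ _ _ _ _ HR r Hr).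
      apply envelope_chart. now apply HI. }
  exists (envelope F Lm). split; [|split; [|split]].
  - split; [exact HG|]. split; [|split].
    + intros p Hp. pose proof (Hin p Hp) as Hp0.
      assert (Hs : seg L p) by (split; lra).
      assert (H1 : Derive_n F 1 p = 0).
      { apply NNPP; intros H1. destruct (proj2 (HI p) (conj Hs H1)); contradiction. }
      exists (F p). split; [now apply (glp_pos _ _ _ HP)|].
      apply proj_eq_iff. exists (- Derive_n Lm 1 p).
      pose proof (glp_immersed _ _ _ HP p Hs H1).
      split; [lra|]. unfold envelope, px, py, pz; cbn [fst snd].
      rewrite H1. repeat split; ring.
    + intros t Ht. destruct (envelope_good L F Lm t HP Ht) as [Hns [Hc _]].
      split; [contradiction | exact Hc].
    + intros t Ht [Hs _]. now destruct (envelope_good L F Lm t HP Ht).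
  - intros r Hr. exists (F r, Lm r, 1).
    split; [now apply lift_tangent_line with rs a k|].
    split; [|split].
    + intros Hl. apply proj_eq_iff in Hl. destruct Hl as [c [_ [H1 [_ H3]]]].
      unfold px, pz in *; simpl in *. lra.
    + intros [b Hl]. apply proj_eq_iff in Hl. destruct Hl as [c [_ [_ [_ H3]]]].
      unfold pz in *; simpl in *. lra.
    + intros Hr0. exists (- F r). split.
      * pose proof (glp_pos _ _ _ HP r Hr0). lra.
      * exists (Lm r). apply proj_eq_iff. exists 1.
        unfold px, py, pz; simpl. repeat split; lra.
  - intros r Hr [HS _]. destruct (envelope_good L F Lm r HP Hr) as [_ [_ HW]].
    destruct (global_pair_singular L F Lm r HP Hr (HW HS)) as [H1 H2].
    split; [exact H1|]. unfold on_vertical_axis, envelope, px; cbn [fst snd]. lra.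
  - assert (Hn1 : forall t, Derive_n F 1 (- t) = Derive_n F 1 t).
    { intros t. pose proof (Derive_n_reflect F 0 (-1) HF) as H.
      specialize (H (fun x => ltac:(rewrite Rminus_0_l, (glp_odd _ _ _ HP); ring)) 1%nat t).
      rewrite Rminus_0_l in H. rewrite H. ring. }
    assert (Hn2 : forall t, Derive_n Lm 1 (- t) = - Derive_n Lm 1 t).
    { intros t. pose proof (Derive_n_reflect Lm 0 1 HLm) as H.
      specialize (H (fun x => ltac:(rewrite Rminus_0_l, (glp_even _ _ _ HP); ring)) 1%nat t).
      rewrite Rminus_0_l in H. rewrite H. ring. }
    assert (Hp : forall G T n t, smooth G -> periodic T G ->
              Derive_n G n (t + T) = Derive_n G n t).
    { intros G T n t HGs HT. rewrite <- (Derive_n_comp_trans G n t T).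
      apply Derive_n_ext. intros s. apply HT. }
    assert (Hn : forall t, envelope F Lm (- t) = reflect (envelope F Lm t)).
    { intros t. unfold envelope, reflect, px, py, pz; cbn [fst snd].
      rewrite Hn1, Hn2, (glp_odd _ _ _ HP t), (glp_even _ _ _ HP t).
      apply vec_eq; unfold px, py, pz; cbn [fst snd]; ring. }
    assert (HT : forall t, envelope F Lm (t + 2 * L) = envelope F Lm t).
    { intros t. unfold envelope.
      rewrite !(Hp F), !(Hp Lm) by (auto; apply HP).
      now rewrite (glp_per_F _ _ _ HP t), (glp_per_Lm _ _ _ HP t). }
    assert (Hrefl : forall v, proj_eq v v).
    { intros v. apply proj_eq_iff. exists 1. repeat split; lra. }
    split; [|].
    + exists (envelope F Lm).
      destruct (envelope_smooth everywhere F Lm HF HLm) as [Sx [Sy Sz]].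
      split; [now apply smooth_everywhere|]. split; [now apply smooth_everywhere|].
      split; [now apply smooth_everywhere|].
      split; [|repeat split; intros; rewrite ?HT, ?Hn; apply Hrefl].
      (* Genericity speaks only of [0, L]; the symmetries carry the nonvanishing of the envelope to
         the whole line. *)
      apply (symmetric_ind L); auto.
      * intros t Ht. now apply (envelope_neq0 L).
      * intros t Ht. rewrite Hn. apply vec_neq0_inv in Ht. apply vec_neq0.
        unfold reflect, px, py, pz in *; cbn [fst snd]. lra.
      * intros t Ht. now rewrite HT.
    (* Once F' is 1 or -1, the two norms |W / F'^2| and |W / F'| coincide. *)
    + assert (HE : forall e, (e = 0 \/ e = L) -> Derive_n F 1 e = 1 \/ Derive_n F 1 e = -1 ->
        chart_norm (punctured L rs) a k 1 e = chart_norm (punctured L rs) a k 2 e).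
      { intros e He H1.
        destruct (global_pair_endpoint L F Lm e) as [F0 [F2 [L1 L3]]]; try apply HP; auto.
        assert (HeI : punctured L rs e).
        { apply HI. split; [destruct He; subst; split; lra | lra]. }
        destruct (chart_norm_endpoint (punctured L rs) a k F Lm e) as [C1 C2]; auto.
        - now apply perfect_punctured.
        - intros r Hr. now apply HI.
        - apply (glr_a _ _ _ _ _ _ HR).
        - apply (glr_k _ _ _ _ _ _ HR).
        - rewrite C1, C2. destruct H1 as [-> | ->].
          + f_equal. field.
          + rewrite <- Rabs_Ropp. f_equal. field. }
      split; apply HE; auto.
      * left. apply (glp_start _ _ _ HP).
      * right. apply (glp_end _ _ _ HP).
Qed.

(** * The dual of a given curve *)

(** For G = (X, Y, Z), the components of G x G' are [wr Y Z], [wr Z X], [wr X Y]. Likewise [wr']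
    gives G x G'', and [wr''] gives G' x G'' + G x G'''. *)
Definition wr (A B : R -> R) (t : R) : R :=
  A t * Derive_n B 1 t - B t * Derive_n A 1 t.

Definition wr' (A B : R -> R) (t : R) : R :=
  A t * Derive_n B 2 t - B t * Derive_n A 2 t.

Definition wr'' (A B : R -> R) (t : R) : R :=
  (Derive_n A 1 t * Derive_n B 2 t - Derive_n B 1 t * Derive_n A 2 t)
  + (A t * Derive_n B 3 t - B t * Derive_n A 3 t).

Lemma hd_wr (D : R -> Prop) (A B : R -> R) (t : R) :
  smooth A -> smooth B -> has_deriv_in D (wr A B) t (wr' A B t).
Proof.
  intros HA HB. eapply hd_eq.
  - apply hd_minus; apply hd_mult.
    + exact (smooth_hd D A 0 t HA).
    + now apply smooth_hd.
    + exact (smooth_hd D B 0 t HB).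
    + now apply smooth_hd.
  - unfold wr'. ring.
Qed.

Lemma hd_wr' (D : R -> Prop) (A B : R -> R) (t : R) :
  smooth A -> smooth B -> has_deriv_in D (wr' A B) t (wr'' A B t).
Proof.
  intros HA HB. eapply hd_eq.
  - apply hd_minus; apply hd_mult.
    + exact (smooth_hd D A 0 t HA).
    + now apply smooth_hd.
    + exact (smooth_hd D B 0 t HB).
    + now apply smooth_hd.
  - unfold wr''. ring.
Qed.

Lemma csmooth_wr (D : R -> Prop) (A B : R -> R) :
  smooth A -> smooth B -> csmooth D (wr A B).
Proof.
  intros HA HB.
  apply (csmooth_minus D (fun t => A t * Derive_n B 1 t)
           (fun t => B t * Derive_n A 1 t)); apply csmooth_mult.
  - exact (smooth_csmooth D A 0 HA).
  - now apply smooth_csmooth.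
  - exact (smooth_csmooth D B 0 HB).
  - now apply smooth_csmooth.
Qed.

(* [(X, Y, Z)] is a curve whose tangent lines are the lines [(F, Lm, 1)]; it is
   singular exactly where [wr X Y] vanishes. *)
Record dual_curve (L : R) (X Y Z F Lm : R -> R) : Prop := {
  dc_length : 0 < L;
  dc_smooth_X : smooth X;
  dc_smooth_Y : smooth Y;
  dc_smooth_Z : smooth Z;
  dc_smooth_F : smooth F;
  dc_smooth_Lm : smooth Lm;
  dc_neq0 : forall t, seg L t -> X t <> 0 \/ Y t <> 0 \/ Z t <> 0;
  dc_slope : forall t, wr Y Z t = wr X Y t * F t;
  dc_intercept : forall t, wr Z X t = wr X Y t * Lm t;
  dc_regular : forall t, seg L t -> wr X Y t <> 0 ->
    wr Y Z t * Derive_n X 2 t + wr Z X t * Derive_n Y 2 t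
    + wr X Y t * Derive_n Z 2 t <> 0;
  dc_singular : forall t, seg L t -> wr X Y t = 0 ->
    wr' Y Z t * Derive_n X 3 t + wr' Z X t * Derive_n Y 3 t
    + wr' X Y t * Derive_n Z 3 t <> 0;
  dc_cusp : forall t, seg L t -> wr X Y t = 0 -> X t <> 0 /\ Y t <> 0
}.

Section DualCurve.

Variables (L : R) (X Y Z F Lm : R -> R).
Hypothesis Hdual : dual_curve L X Y Z F Lm.

Let HL := dc_length _ _ _ _ _ _ Hdual.
Let HX := dc_smooth_X _ _ _ _ _ _ Hdual.
Let HY := dc_smooth_Y _ _ _ _ _ _ Hdual.
Let HZ := dc_smooth_Z _ _ _ _ _ _ Hdual.
Let HF := dc_smooth_F _ _ _ _ _ _ Hdual.
Let HLm := dc_smooth_Lm _ _ _ _ _ _ Hdual.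
Let Hne := dc_neq0 _ _ _ _ _ _ Hdual.
Let Hs1 := dc_slope _ _ _ _ _ _ Hdual.
Let Hs2 := dc_intercept _ _ _ _ _ _ Hdual.
Let Hregular := dc_regular _ _ _ _ _ _ Hdual.
Let Hsingular := dc_singular _ _ _ _ _ _ Hdual.
Let Hcusp := dc_cusp _ _ _ _ _ _ Hdual.

(** Derivative of G x G' = w l with w = [wr X Y] and l = (F, Lm, 1). Where w = 0 it reads G x G'' =
    w' l, which replaces the relation lost at a cusp. *)
Lemma wr'_dual (t : R) :
  wr' Y Z t = wr' X Y t * F t + wr X Y t * Derive_n F 1 t /\
  wr' Z X t = wr' X Y t * Lm t + wr X Y t * Derive_n Lm 1 t.
Proof.
  split.
  apply (hd_unique everywhere (wr Y Z) t _ _ perfect_everywhere I).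
  - exact (hd_wr everywhere Y Z t HY HZ).
  - apply hd_ext with (fun t => wr X Y t * F t); [now intros | exact I |].
    apply hd_mult; [now apply hd_wr | exact (smooth_hd everywhere F 0 t HF)].
  apply (hd_unique everywhere (wr Z X) t _ _ perfect_everywhere I).
  - exact (hd_wr everywhere Z X t HZ HX).
  - apply hd_ext with (fun t => wr X Y t * Lm t); [now intros | exact I |].
    apply hd_mult; [now apply hd_wr | exact (smooth_hd everywhere Lm 0 t HLm)].
Qed.

Lemma wr''_dual (t : R) :
  wr'' Y Z t = wr'' X Y t * F t + 2 * (wr' X Y t * Derive_n F 1 t)
               + wr X Y t * Derive_n F 2 t /\
  wr'' Z X t = wr'' X Y t * Lm t + 2 * (wr' X Y t * Derive_n Lm 1 t)
               + wr X Y t * Derive_n Lm 2 t.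
Proof.
  split.
  apply (hd_unique everywhere (wr' Y Z) t _ _ perfect_everywhere I).
  - exact (hd_wr' everywhere Y Z t HY HZ).
  - apply hd_ext with (fun t => wr' X Y t * F t + wr X Y t * Derive_n F 1 t);
      [intros; symmetry; apply wr'_dual | exact I |].
    eapply hd_eq.
    + apply hd_plus; apply hd_mult.
      * now apply hd_wr'.
      * exact (smooth_hd everywhere F 0 t HF).
      * now apply hd_wr.
      * now apply smooth_hd.
    + cbv beta. change (Derive_n F 0) with F. ring.
  apply (hd_unique everywhere (wr' Z X) t _ _ perfect_everywhere I).
  - exact (hd_wr' everywhere Z X t HZ HX).
  - apply hd_ext with (fun t => wr' X Y t * Lm t + wr X Y t * Derive_n Lm 1 t);
      [intros; symmetry; apply wr'_dual | exact I |].
    eapply hd_eq.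
    + apply hd_plus; apply hd_mult.
      * now apply hd_wr'.
      * exact (smooth_hd everywhere Lm 0 t HLm).
      * now apply hd_wr.
      * now apply smooth_hd.
    + cbv beta. change (Derive_n Lm 0) with Lm. ring.
Qed.

(** If w and w' both vanished, so would G x G'' and with it det(G, G'', G'''), contrary to the cusp
    condition. *)
Lemma dual_cusp (t : R) : seg L t -> wr X Y t = 0 -> wr' X Y t <> 0.
Proof.
  intros Ht H0 H1. apply (Hsingular t Ht H0).
  destruct (wr'_dual t) as [E1 E2]. rewrite E1, E2, H0, H1. ring.
Qed.

(** G is orthogonal to G x G' = w l; at a cusp it is orthogonal to G x G'' = w' l with w'
    nonzero. *)
Lemma dual_incidence (t : R) : seg L t -> F t * X t + Lm t * Y t + Z t = 0.
Proof.
  intros Ht. destruct (Req_dec (wr X Y t) 0) as [H0|H0].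
  - apply Rmult_eq_reg_l with (wr' X Y t); [|now apply dual_cusp].
    destruct (wr'_dual t) as [E1 E2]. rewrite H0 in E1, E2.
    transitivity (wr' Y Z t * X t + wr' Z X t * Y t + wr' X Y t * Z t).
    + rewrite E1, E2. ring.
    + unfold wr'. ring.
  - apply Rmult_eq_reg_l with (wr X Y t); [|exact H0].
    transitivity (wr Y Z t * X t + wr Z X t * Y t + wr X Y t * Z t).
    + rewrite Hs1, Hs2. ring.
    + unfold wr. ring.
Qed.

(** Off the cusps G' is orthogonal to G x G' = w l. At a cusp G' is parallel to G, and incidence
    suffices; a nonzero coordinate of G makes this explicit. *)
Lemma dual_tangency (t : R) :
  seg L t ->
  F t * Derive_n X 1 t + Lm t * Derive_n Y 1 t + Derive_n Z 1 t = 0.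
Proof.
  intros Ht. destruct (Req_dec (wr X Y t) 0) as [H0|H0].
  - pose proof (dual_incidence t Ht) as E.
    pose proof (Hs1 t) as E1. pose proof (Hs2 t) as E2.
    pose proof H0 as E3. rewrite H0, Rmult_0_l in E1, E2.
    unfold wr in E1, E2, E3.
    destruct (Hne t Ht) as [N|[N|N]].
    + apply Rmult_eq_reg_l with (X t); [|exact N].
      transitivity (Derive_n X 1 t * (F t * X t + Lm t * Y t + Z t)
        + Lm t * (X t * Derive_n Y 1 t - Y t * Derive_n X 1 t)
        - (Z t * Derive_n X 1 t - X t * Derive_n Z 1 t)); [ring|].
      rewrite E, E2, E3. ring.
    + apply Rmult_eq_reg_l with (Y t); [|exact N].
      transitivity (Derive_n Y 1 t * (F t * X t + Lm t * Y t + Z t)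
        - F t * (X t * Derive_n Y 1 t - Y t * Derive_n X 1 t)
        + (Y t * Derive_n Z 1 t - Z t * Derive_n Y 1 t)); [ring|].
      rewrite E, E1, E3. ring.
    + apply Rmult_eq_reg_l with (Z t); [|exact N].
      transitivity (Derive_n Z 1 t * (F t * X t + Lm t * Y t + Z t)
        + F t * (Z t * Derive_n X 1 t - X t * Derive_n Z 1 t)
        - Lm t * (Y t * Derive_n Z 1 t - Z t * Derive_n Y 1 t)); [ring|].
      rewrite E, E1, E2. ring.
  - apply Rmult_eq_reg_l with (wr X Y t); [|exact H0].
    transitivity (wr Y Z t * Derive_n X 1 t + wr Z X t * Derive_n Y 1 t
                  + wr X Y t * Derive_n Z 1 t).
    + rewrite Hs1, Hs2. ring.
    + unfold wr. ring.
Qed.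

(** Differentiate incidence and subtract tangency: l' annihilates G, so the roles of the curve and
    its dual are exchanged. *)
Lemma dual_point_1 (t : R) :
  seg L t -> Derive_n F 1 t * X t + Derive_n Lm 1 t * Y t = 0.
Proof.
  intros Ht. pose proof (dual_tangency t Ht) as E0.
  assert (E : Derive_n F 1 t * X t + F t * Derive_n X 1 t
              + (Derive_n Lm 1 t * Y t + Lm t * Derive_n Y 1 t)
              + Derive_n Z 1 t = 0).
  { apply (hd_zero (seg L) (fun t => F t * X t + Lm t * Y t + Z t) t);
      [now apply perfect_seg | exact Ht | exact dual_incidence |].
    apply hd_plus; [apply hd_plus; apply hd_mult|].
    - exact (smooth_hd _ F 0 t HF).
    - exact (smooth_hd _ X 0 t HX).
    - exact (smooth_hd _ Lm 0 t HLm).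
    - exact (smooth_hd _ Y 0 t HY).
    - exact (smooth_hd _ Z 0 t HZ). }
  lra.
Qed.

Lemma dual_point_2 (t : R) :
  seg L t ->
  Derive_n F 2 t * X t + Derive_n F 1 t * Derive_n X 1 t
  + (Derive_n Lm 2 t * Y t + Derive_n Lm 1 t * Derive_n Y 1 t) = 0.
Proof.
  intros Ht.
  apply (hd_zero (seg L)
    (fun t => Derive_n F 1 t * X t + Derive_n Lm 1 t * Y t) t);
    [now apply perfect_seg | exact Ht | exact dual_point_1 |].
  apply hd_plus; apply hd_mult.
  - now apply smooth_hd.
  - exact (smooth_hd _ X 0 t HX).
  - now apply smooth_hd.
  - exact (smooth_hd _ Y 0 t HY).
Qed.

Lemma dual_point_3 (t : R) :
  seg L t ->
  Derive_n F 3 t * X t + Derive_n F 2 t * Derive_n X 1 t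
  + (Derive_n F 2 t * Derive_n X 1 t + Derive_n F 1 t * Derive_n X 2 t)
  + ((Derive_n Lm 3 t * Y t + Derive_n Lm 2 t * Derive_n Y 1 t)
     + (Derive_n Lm 2 t * Derive_n Y 1 t + Derive_n Lm 1 t * Derive_n Y 2 t)) = 0.
Proof.
  intros Ht.
  apply (hd_zero (seg L)
    (fun t => Derive_n F 2 t * X t + Derive_n F 1 t * Derive_n X 1 t
       + (Derive_n Lm 2 t * Y t + Derive_n Lm 1 t * Derive_n Y 1 t)) t);
    [now apply perfect_seg | exact Ht | exact dual_point_2 |].
  apply hd_plus; apply hd_plus; apply hd_mult.
  - now apply smooth_hd.
  - exact (smooth_hd _ X 0 t HX).
  - now apply smooth_hd.
  - now apply smooth_hd.
  - now apply smooth_hd.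
  - exact (smooth_hd _ Y 0 t HY).
  - now apply smooth_hd.
  - now apply smooth_hd.
Qed.

(** Suppose l' = 0. At a regular point G x G'' = w' l, and its product with G' is 0 by tangency, so
    det(G, G', G'') = 0. At a cusp the same happens one order higher: G' x G'' + G x G''' = w'' l is
    orthogonal to G'', so det(G, G'', G''') = 0. *)
Lemma dual_immersed (t : R) :
  seg L t -> Derive_n F 1 t = 0 -> Derive_n Lm 1 t <> 0.
Proof.
  intros Ht F1 L1. destruct (wr'_dual t) as [E1 E2]. rewrite F1 in E1. rewrite L1 in E2.
  destruct (Req_dec (wr X Y t) 0) as [H0|H0].
  - destruct (wr''_dual t) as [G1 G2]. rewrite F1, H0 in G1. rewrite L1, H0 in G2.
    assert (E : F t * Derive_n X 2 t + Lm t * Derive_n Y 2 t + Derive_n Z 2 t = 0).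
    { apply Rmult_eq_reg_l with (wr' X Y t); [|now apply dual_cusp].
      transitivity (wr' Y Z t * Derive_n X 2 t + wr' Z X t * Derive_n Y 2 t
                    + wr' X Y t * Derive_n Z 2 t).
      - rewrite E1, E2. ring.
      - unfold wr'. ring. }
    apply (Hsingular t Ht H0).
    transitivity (- (wr'' Y Z t * Derive_n X 2 t + wr'' Z X t * Derive_n Y 2 t
                     + wr'' X Y t * Derive_n Z 2 t)).
    + unfold wr', wr''. ring.
    + rewrite G1, G2.
      transitivity (- wr'' X Y t * (F t * Derive_n X 2 t + Lm t * Derive_n Y 2 t
                                    + Derive_n Z 2 t)); [ring|].
      rewrite E. ring.
  - apply (Hregular t Ht H0). pose proof (dual_tangency t Ht) as E.
    transitivity (- (wr' Y Z t * Derive_n X 1 t + wr' Z X t * Derive_n Y 1 t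
                     + wr' X Y t * Derive_n Z 1 t)).
    + unfold wr, wr'. ring.
    + rewrite E1, E2.
      transitivity (- wr' X Y t * (F t * Derive_n X 1 t + Lm t * Derive_n Y 1 t
                                   + Derive_n Z 1 t)); [ring|].
      rewrite E. ring.
Qed.

(** Read off from F' X + Lm' Y = 0. The degenerate case X = Y = 0 would give Z = 0 by incidence. *)
Lemma dual_infinite (t : R) : seg L t -> Derive_n F 1 t = 0 <-> Y t = 0.
Proof.
  intros Ht. pose proof (dual_point_1 t Ht) as E. split; intros H.
  - pose proof (dual_immersed t Ht H) as H1. rewrite H in E.
    apply Rmult_eq_reg_l with (Derive_n Lm 1 t); [lra | exact H1].
  - destruct (Req_dec (X t) 0) as [N|N].
    + pose proof (dual_incidence t Ht) as E0. rewrite N, H in E0.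
      exfalso. destruct (Hne t Ht) as [K|[K|K]]; apply K; lra.
    + rewrite H in E. apply Rmult_eq_reg_r with (X t); [lra | exact N].
Qed.

Lemma dual_on_axis (t : R) : seg L t -> Derive_n Lm 1 t = 0 <-> X t = 0.
Proof.
  intros Ht. pose proof (dual_point_1 t Ht) as E. split; intros H.
  - assert (H1 : Derive_n F 1 t <> 0).
    { intros N. exact (dual_immersed t Ht N H). }
    rewrite H in E. apply Rmult_eq_reg_l with (Derive_n F 1 t); [lra | exact H1].
  - destruct (Req_dec (Y t) 0) as [N|N].
    + pose proof (dual_incidence t Ht) as E0. rewrite N, H in E0.
      exfalso. destruct (Hne t Ht) as [K|[K|K]]; apply K; lra.
    + rewrite H in E. apply Rmult_eq_reg_r with (Y t); [lra | exact N].
Qed.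

(** A degenerate critical point would force Y = Y' = 0, hence a cusp at infinity. *)
Lemma dual_morse_F (t : R) :
  seg L t -> Derive_n F 1 t = 0 -> Derive_n F 2 t <> 0.
Proof.
  intros Ht F1 F2. pose proof (proj1 (dual_infinite t Ht) F1) as Y0.
  pose proof (dual_immersed t Ht F1) as L1.
  pose proof (dual_point_2 t Ht) as E. rewrite F1, F2, Y0 in E.
  assert (Y1 : Derive_n Y 1 t = 0).
  { apply Rmult_eq_reg_l with (Derive_n Lm 1 t); [lra | exact L1]. }
  destruct (Hcusp t Ht) as [_ H]; [|contradiction].
  unfold wr. rewrite Y0, Y1. ring.
Qed.

(** A degenerate critical point would force X = X' = 0, hence a cusp on the axis. *)
Lemma dual_morse_Lm (t : R) :
  seg L t -> Derive_n Lm 1 t = 0 -> Derive_n Lm 2 t <> 0.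
Proof.
  intros Ht L1 L2. pose proof (proj1 (dual_on_axis t Ht) L1) as X0.
  assert (F1 : Derive_n F 1 t <> 0).
  { intros N. exact (dual_immersed t Ht N L1). }
  pose proof (dual_point_2 t Ht) as E. rewrite L1, L2, X0 in E.
  assert (X1 : Derive_n X 1 t = 0).
  { apply Rmult_eq_reg_l with (Derive_n F 1 t); [lra | exact F1]. }
  destruct (Hcusp t Ht) as [H _]; [|contradiction].
  unfold wr. rewrite X0, X1. ring.
Qed.

(** Two expressions for a': from a = Lm' / F' it is W / F'^2, from a = - X / Y it is w / Y^2. The
    form without denominators survives at infinity and follows from [dual_point_1] and
    [dual_point_2]. *)
Lemma dual_wronsk_wr (t : R) :
  seg L t -> dual_wronsk F Lm t * (Y t) ^ 2 = (Derive_n F 1 t) ^ 2 * wr X Y t.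
Proof.
  intros Ht. pose proof (dual_point_1 t Ht) as E1.
  pose proof (dual_point_2 t Ht) as E2.
  assert (E : dual_wronsk F Lm t * (Y t) ^ 2 - (Derive_n F 1 t) ^ 2 * wr X Y t
    = Derive_n F 1 t * Y t *
      (Derive_n F 2 t * X t + Derive_n F 1 t * Derive_n X 1 t
       + (Derive_n Lm 2 t * Y t + Derive_n Lm 1 t * Derive_n Y 1 t))
      - (Derive_n F 2 t * Y t + Derive_n F 1 t * Derive_n Y 1 t)
        * (Derive_n F 1 t * X t + Derive_n Lm 1 t * Y t)).
  { unfold dual_wronsk, wr. ring. }
  rewrite E1, E2 in E. lra.
Qed.

Lemma dual_wronsk_zero (t : R) :
  seg L t -> dual_wronsk F Lm t = 0 -> wr X Y t = 0.
Proof.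
  intros Ht HW. pose proof (dual_wronsk_wr t Ht) as E. rewrite HW in E.
  destruct (Req_dec (Derive_n F 1 t) 0) as [F1|F1].
  - exfalso. unfold dual_wronsk in HW. rewrite F1 in HW.
    pose proof (dual_morse_F t Ht F1). pose proof (dual_immersed t Ht F1).
    apply (Rmult_integral_contrapositive_currified
             (Derive_n F 2 t) (Derive_n Lm 1 t)); lra.
  - apply Rmult_eq_reg_l with ((Derive_n F 1 t) ^ 2); [lra|].
    now apply pow_nonzero.
Qed.

Lemma dual_simple_zeros (t : R) :
  seg L t -> dual_wronsk F Lm t = 0 -> dual_wronsk' F Lm t <> 0.
Proof.
  intros Ht HW HW'. pose proof (dual_wronsk_zero t Ht HW) as H0.
  destruct (Hcusp t Ht H0) as [X0 Y0].
  assert (F1 : Derive_n F 1 t <> 0) by (intros N; now apply Y0, dual_infinite).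
  pose proof (dual_point_1 t Ht) as E1. pose proof (dual_point_2 t Ht) as E2.
  pose proof (dual_point_3 t Ht) as E3.
  (* At a cusp G' is parallel to G; for the two coordinates used here the ratio is q. *)
  set (q := Derive_n Y 1 t / Y t).
  assert (Y1 : Derive_n Y 1 t = q * Y t) by (unfold q; field; exact Y0).
  assert (X1 : Derive_n X 1 t = q * X t).
  { unfold wr in H0. apply Rmult_eq_reg_r with (Y t); [|exact Y0].
    rewrite Y1 in H0. lra. }
  rewrite X1, Y1 in E2, E3.
  (* Differentiating W Y^2 = F'^2 w at a common zero suggests W' Y^2 = F'^2 w'. The difference is a
     combination of the three relations [dual_point_1], [dual_point_2], [dual_point_3]. *)
  assert (E : dual_wronsk' F Lm t * (Y t) ^ 2 - (Derive_n F 1 t) ^ 2 * wr' X Y t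
    = Derive_n F 1 t * Y t *
      (Derive_n F 3 t * X t + Derive_n F 2 t * (q * X t)
       + (Derive_n F 2 t * (q * X t) + Derive_n F 1 t * Derive_n X 2 t)
       + (Derive_n Lm 3 t * Y t + Derive_n Lm 2 t * (q * Y t)
          + (Derive_n Lm 2 t * (q * Y t) + Derive_n Lm 1 t * Derive_n Y 2 t)))
      - 2 * q * Derive_n F 1 t * Y t
        * (Derive_n F 2 t * X t + Derive_n F 1 t * (q * X t)
           + (Derive_n Lm 2 t * Y t + Derive_n Lm 1 t * (q * Y t)))
      - (Derive_n F 3 t * Y t + Derive_n F 1 t * Derive_n Y 2 t
         - 2 * q * q * Derive_n F 1 t * Y t)
        * (Derive_n F 1 t * X t + Derive_n Lm 1 t * Y t)).
  { unfold dual_wronsk', wr'. ring. }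
  rewrite E1, E2, E3, HW' in E.
  apply (dual_cusp t Ht H0).
  apply Rmult_eq_reg_l with ((Derive_n F 1 t) ^ 2); [lra|].
  now apply pow_nonzero.
Qed.

End DualCurve.

(** * Smooth quotients with removable zeros of the denominator *)

(* Near [t] the quotient [u / v] is represented by the smooth quotient [M / N],
   although [v] may vanish at [t]. *)
Definition local_quotient (u v : R -> R) (t : R) (M N : R -> R) : Prop :=
  csmooth everywhere M /\ csmooth everywhere N /\ N t <> 0 /\
  exists d, 0 < d /\ forall s, Rabs (s - t) < d ->
    (s <> t -> v s <> 0) /\ u s * N s = M s * v s.

(** A global definition that does not depend on the local representation; comparing two
    representations gives parity and periodicity. *)
Definition quotient_limit (u v : R -> R) (t : R) : R :=
  real (Lim (fun s => u s / v s) t).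

Lemma csmooth_continuous (f : R -> R) (t : R) :
  csmooth everywhere f -> continuous f t.
Proof.
  intros Hf. destruct (Hf 1%nat) as [g [Hg _]].
  apply (ex_derive_continuous f). exists (g t). apply hd_everywhere, Hg, I.
Qed.

Lemma csmooth_neq0 (f : R -> R) (t : R) :
  csmooth everywhere f -> f t <> 0 ->
  exists d, 0 < d /\ forall s, Rabs (s - t) < d -> f s <> 0.
Proof.
  intros Hf H0. destruct (Hf 1%nat) as [g [Hg _]].
  destruct (hd_neq0 _ _ _ _ (Hg t I) H0) as [d [Hd H]].
  exists d; split; [exact Hd|]. intros s Hs. now apply H; [exact I|].
Qed.

Lemma quotient_limit_eq (u v M N : R -> R) (t : R) :
  local_quotient u v t M N -> quotient_limit u v t = M t / N t.
Proof.
  intros [HM [HN [HNt [d [Hd H]]]]].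
  destruct (csmooth_neq0 N t HN HNt) as [e [He HNe]].
  unfold quotient_limit. erewrite is_lim_unique with (l := Finite (M t / N t)).
  - reflexivity.
  - apply is_lim_ext_loc with (fun s => M s / N s).
    + exists (mkposreal (Rmin d e) (Rmin_pos _ _ Hd He)). intros s Hs Hst.
      assert (Hs1 : Rabs (s - t) < d).
      { eapply Rlt_le_trans; [exact Hs | apply Rmin_l]. }
      assert (Hs2 : Rabs (s - t) < e).
      { eapply Rlt_le_trans; [exact Hs | apply Rmin_r]. }
      destruct (H s Hs1) as [Hv E]. specialize (Hv Hst). specialize (HNe s Hs2).
      transitivity (u s * N s / (v s * N s)); [rewrite E; field; auto | field; auto].
    + apply (is_lim_div M N t (M t) (N t)).
      * apply is_lim_continuity, continuity_pt_filterlim, csmooth_continuous, HM.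
      * apply is_lim_continuity, continuity_pt_filterlim, csmooth_continuous, HN.
      * intros E. apply HNt. now injection E.
      * exact I.
Qed.

Lemma local_quotient_regular (u v : R -> R) (t : R) :
  csmooth everywhere u -> csmooth everywhere v -> v t <> 0 ->
  local_quotient u v t u v.
Proof.
  intros Hu Hv H0. destruct (csmooth_neq0 v t Hv H0) as [d [Hd H]].
  split; [exact Hu|]. split; [exact Hv|]. split; [exact H0|].
  exists d. split; [exact Hd|]. intros s Hs. split; [now auto | reflexivity].
Qed.

Lemma quotient_limit_spec (u v : R -> R) :
  csmooth everywhere u -> csmooth everywhere v ->
  (forall t, exists M N, local_quotient u v t M N) ->
  forall t, u t = v t * quotient_limit u v t.
Proof.
  intros Hu Hv Hex t. destruct (Hex t) as [M [N HMN]].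
  rewrite (quotient_limit_eq u v M N t HMN).
  destruct HMN as [_ [_ [HN [d [Hd H]]]]].
  destruct (H t) as [_ E]; [rewrite Rminus_diag, Rabs_R0; exact Hd|].
  transitivity (u t * N t / N t); [field; exact HN|].
  rewrite E. field. exact HN.
Qed.

Lemma quotient_limit_smooth (u v : R -> R) :
  csmooth everywhere u -> csmooth everywhere v ->
  (forall t, exists M N, local_quotient u v t M N) ->
  smooth (quotient_limit u v).
Proof.
  intros Hu Hv Hex. apply smooth_of_local. intros t.
  destruct (Hex t) as [M [N HMN]].
  pose proof (quotient_limit_eq u v M N t HMN) as Et.
  destruct HMN as [HM [HN [HNt [d [Hd H]]]]].
  destruct (csmooth_neq0 N t HN HNt) as [e [He HNe]].
  exists (fun s => Rabs (s - t) < Rmin d e). split; [|split].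
  - intros s Hs. assert (Hp : 0 < Rmin d e - Rabs (s - t)) by lra.
    exists (mkposreal _ Hp). intros y Hy.
    change (Rabs (y - s) < Rmin d e - Rabs (s - t)) in Hy.
    replace (y - t) with ((y - s) + (s - t)) by ring.
    pose proof (Rabs_triang (y - s) (s - t)). lra.
  - rewrite Rminus_diag, Rabs_R0. now apply Rmin_pos.
  - assert (HNs : forall s, Rabs (s - t) < Rmin d e -> N s <> 0).
    { intros s Hs. apply HNe. eapply Rlt_le_trans; [exact Hs | apply Rmin_r]. }
    apply csmooth_ext with (fun s => M s / N s).
    (* Away from [t] the denominator [v] is nonzero, so the limit there is the plain quotient, which
       equals M / N. *)
    + intros s Hs. destruct (Req_dec s t) as [->|Hst]; [now symmetry|].
      destruct (H s) as [Hvs E].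
      { eapply Rlt_le_trans; [exact Hs | apply Rmin_l]. }
      specialize (Hvs Hst). specialize (HNs s Hs).
      rewrite (quotient_limit_eq u v u v s) by now apply local_quotient_regular.
      transitivity (u s * N s / (v s * N s)); [rewrite E; field; auto | field; auto].
    + apply csmooth_div; [exact HNs | |]; apply csmooth_mono with everywhere; auto;
        intros; exact I.
Qed.

Lemma filterlim_Rmult (P : (R -> Prop) -> Prop) (u v : R -> R) (l m : R) :
  Filter P -> filterlim u P (locally l) -> filterlim v P (locally m) ->
  filterlim (fun s => u s * v s) P (locally (l * m)).
Proof.
  intros HP Hu Hv. pose proof (filterlim_mult (K := R_AbsRing) l m) as H.
  exact (filterlim_comp_2 (F := P) (FF := HP) u v Rmult Hu Hv H).
Qed.

(** Proportionality passes to the limit; it identifies a tangent line given only as a limit. *)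
Lemma filterlim_cross_zero (P : (R -> Prop) -> Prop) (u1 u2 v1 v2 : R -> R)
    (l1 l2 m1 m2 : R) :
  ProperFilter P ->
  filterlim u1 P (locally l1) -> filterlim u2 P (locally l2) ->
  filterlim v1 P (locally m1) -> filterlim v2 P (locally m2) ->
  P (fun s => u1 s * v2 s = u2 s * v1 s) -> l1 * m2 = l2 * m1.
Proof.
  intros HP H1 H2 K1 K2 E.
  pose proof (@filter_filter _ _ HP) as HFP.
  pose proof (filterlim_Rmult P u1 v2 l1 m2 HFP H1 K2) as A1.
  pose proof (filterlim_Rmult P u2 v1 l2 m1 HFP H2 K1) as A2.
  pose proof (Proper_StrongProper P HP) as HP'.
  refine (filterlim_locally_unique (K := R_AbsRing) (V := R_NormedModule)
            (F := P) (FF := HP') (fun s => u1 s * v2 s) _ _ A1 _).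
  apply (filterlim_ext_loc (fun s => u2 s * v1 s)); [|exact A2].
  revert E. apply filter_imp. intros s Hs. now symmetry.
Qed.

Lemma proper_within_seg (L t : R) :
  0 < L -> seg L t -> ProperFilter (within (seg L) (locally' t)).
Proof.
  intros HL Ht. split; [|].
  - intros Q [d Hd]. destruct (seg_dense L nil t d HL Ht (cond_pos d))
      as [y [Hy [Hyt [Hlt _]]]].
    exists y. apply Hd; auto. split; lra.
  - apply within_filter, within_filter, locally_filter.
Qed.

Lemma filterlim_vec (T : Type) (P : (T -> Prop) -> Prop) (g : T -> vec) (l : vec) :
  Filter P -> filterlim g P (locally l) ->
  filterlim (fun s => px (g s)) P (locally (px l)) /\
  filterlim (fun s => py (g s)) P (locally (py l)) /\
  filterlim (fun s => pz (g s)) P (locally (pz l)).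
Proof.
  intros HP H. pose proof (proj1 (filterlim_locally g l) H) as H0.
  repeat split; apply filterlim_locally; intros eps; generalize (H0 eps);
    apply filter_imp; intros s [[H1 H2] H3]; assumption.
Qed.

Lemma filterlim_within (D : R -> Prop) (f : R -> R) (t : R) :
  continuous f t -> filterlim f (within D (locally' t)) (locally (f t)).
Proof.
  intros H. apply filterlim_filter_le_1 with (2 := H).
  intros Q [d Hd]. exists d. intros y Hy _ _. now apply Hd.
Qed.

(** * From the curve to the pair *)

(** [psi] is an isometry of the line. The common factor [m] cancels from the quotient, which is
    therefore multiplied just by [e]. *)
Lemma local_quotient_transport (u v M N psi : R -> R) (t t' e : R) :
  csmooth everywhere psi -> psi t' = t ->
  (forall s, Rabs (psi s - t) = Rabs (s - t')) ->
  (forall s, exists m, m <> 0 /\ u s = m * (e * u (psi s)) /\ v s = m * v (psi s)) ->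
  local_quotient u v t M N ->
  local_quotient u v t' (fun s => e * M (psi s)) (fun s => N (psi s)).
Proof.
  intros Hpsi Ht Hd Huv [HM [HN [HNt [d [Hd0 H]]]]].
  split; [|split; [|split]].
  - apply (csmooth_mult everywhere (fun _ => e) (fun s => M (psi s))).
    + apply csmooth_const.
    + apply csmooth_comp with everywhere; auto.
  - apply csmooth_comp with everywhere; auto.
  - now rewrite Ht.
  - exists d; split; [exact Hd0|]. intros s Hs. rewrite <- Hd in Hs.
    destruct (H (psi s) Hs) as [Hv E]. destruct (Huv s) as [m [Hm [Eu Ev]]].
    split.
    + intros Hne. rewrite Ev. apply Rmult_integral_contrapositive_currified; [exact Hm|].
      apply Hv. intros E0. apply Hne.
      specialize (Hd s). rewrite E0, Rminus_diag, Rabs_R0 in Hd.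
      symmetry in Hd. apply Rabs_eq_0 in Hd. lra.
    + rewrite Eu, Ev.
      transitivity (m * e * (u (psi s) * N (psi s))); [ring|]. rewrite E. ring.
Qed.

(** The terms with c' cancel by antisymmetry; [sg] is the derivative of the parameter change, [ea]
    and [eb] are the signs of the coordinates. *)
Lemma wr_transport (A B c psi : R -> R) (sg ea eb t : R) :
  smooth A -> smooth B -> csmooth everywhere c -> is_derive psi t sg ->
  (forall s, A (psi s) = c s * (ea * A s)) ->
  (forall s, B (psi s) = c s * (eb * B s)) ->
  sg * wr A B (psi t) = (c t) ^ 2 * (ea * eb) * wr A B t.
Proof.
  intros HA HB Hc Hpsi EA EB.
  destruct (Hc 1%nat) as [c' [Hc' _]].
  assert (D : forall (C : R -> R) e, smooth C ->
            (forall s, C (psi s) = c s * (e * C s)) ->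
            sg * Derive_n C 1 (psi t) = c' t * (e * C t) + c t * (e * Derive_n C 1 t)).
  { intros C e HC EC.
    apply (hd_unique everywhere (fun s => C (psi s)) t _ _ perfect_everywhere I).
    - apply hd_comp with everywhere.
      + intros; exact I.
      + now apply hd_of_is_derive.
      + exact (smooth_hd everywhere C 0 (psi t) HC).
    - apply hd_ext with (fun s => c s * (e * C s)); [now intros | exact I|].
      eapply hd_eq.
      + apply hd_mult; [exact (Hc' t I)|].
        apply hd_mult; [apply hd_const | exact (smooth_hd everywhere C 0 t HC)].
      + cbv beta. ring. }
  pose proof (D A ea HA EA) as DA. pose proof (D B eb HB EB) as DB.
  unfold wr. rewrite EA, EB.
  transitivity (c t * (ea * A t) * (sg * Derive_n B 1 (psi t))
                - c t * (eb * B t) * (sg * Derive_n A 1 (psi t))); [ring|].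
  rewrite DA, DB. ring.
Qed.

(** Compares [kappa] for two lifts at a cusp, where they differ by the cube of a factor. *)
Lemma deriv2_product_at_zero (D : R -> Prop) (u w v v' : R -> R) (t v2 : R) :
  perfect D -> D t -> csmooth D w -> (forall s, D s -> u s = w s * v s) ->
  deriv_on D v v' -> has_deriv_in D v' t v2 -> v t = 0 -> v' t = 0 ->
  deriv_in_n D u 2 t = w t * v2.
Proof.
  intros HD Ht Hw Hu Hv Hv2 V0 V1.
  apply (smooth_on_csmooth D w HD) in Hw.
  pose proof (smooth_on_deriv_on D w 0 HD Hw) as W1.
  pose proof (smooth_on_deriv_on D w 1 HD Hw) as W2.
  rewrite (deriv_in_n_shift D u
    (fun s => deriv_in_n D w 1 s * v s + w s * v' s) 1 t HD); auto.
  - apply deriv_in_eq; auto. eapply hd_eq.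
    + apply hd_plus; apply hd_mult; [exact (W2 t Ht) | exact (Hv t Ht)
        | exact (W1 t Ht) | exact Hv2].
    + rewrite V0, V1. cbn [deriv_in_n]. ring.
  - intros s Hs. apply hd_ext with (fun s => w s * v s); auto.
    + intros y Hy. now rewrite Hu.
    + exact (hd_mult D w v s _ _ (W1 s Hs) (Hv s Hs)).
Qed.

Section CurveToPair.

Variables (L : R) (rs : list R) (a k : R -> R) (G Gam : R -> vec).
Hypothesis Hrs : StronglySorted Rlt (0 :: rs ++ L :: nil).
Hypothesis HG : extends_to_good L rs a k G.
Hypothesis Htan : tangents_condition L G.
Hypothesis Hcusps : cusps_condition L G.
Hypotheses (HX : smooth (fun t => px (Gam t))) (HY : smooth (fun t => py (Gam t)))
           (HZ : smooth (fun t => pz (Gam t))).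
Hypothesis Hne : forall t, Gam t <> vzero.
Hypothesis Hper : forall t, proj_eq (Gam (t + 2 * L)) (Gam t).
Hypothesis HGam : forall t, seg L t -> proj_eq (Gam t) (G t).
Hypothesis Hrefl : forall t, seg L t -> proj_eq (Gam (- t)) (reflect (G t)).

Hypothesis Hnorm : forall e, e = 0 \/ e = L ->
  chart_norm (punctured L rs) a k 1 e = chart_norm (punctured L rs) a k 2 e.

Let X := fun t => px (Gam t).
Let Y := fun t => py (Gam t).
Let Z := fun t => pz (Gam t).

Local Lemma Gam_curve_smooth (D : R -> Prop) : curve_smooth D Gam.
Proof.
  exact (conj (smooth_csmooth D X 0 HX)
    (conj (smooth_csmooth D Y 0 HY) (smooth_csmooth D Z 0 HZ))).
Qed.

Local Lemma Gam_comp_smooth (psi : R -> R) :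
  csmooth everywhere psi -> curve_smooth everywhere (fun t => Gam (psi t)).
Proof.
  intros Hpsi. destruct (Gam_curve_smooth everywhere) as [Sx [Sy Sz]].
  repeat split; [exact (csmooth_comp _ _ _ _ (fun _ _ => I) Hpsi Sx)
    | exact (csmooth_comp _ _ _ _ (fun _ _ => I) Hpsi Sy)
    | exact (csmooth_comp _ _ _ _ (fun _ _ => I) Hpsi Sz)].
Qed.

Local Lemma length_pos : 0 < L.
Proof. exact (proj1 (sorted_rs L rs Hrs)). Qed.

Local Lemma reflect_proj_eq (u v : vec) :
  proj_eq u v -> proj_eq (reflect u) (reflect v).
Proof.
  rewrite !proj_eq_iff. intros [c [Hc [E1 [E2 E3]]]]. exists c.
  split; [exact Hc|]. unfold reflect, px, py, pz in *; cbn [fst snd].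
  rewrite E1, E2, E3. repeat split; ring.
Qed.

Local Lemma reflect_involutive (u : vec) : reflect (reflect u) = u.
Proof. apply vec_eq; unfold reflect, px, py, pz; cbn [fst snd]; ring. Qed.

Local Lemma Gam_reflect (t : R) : proj_eq (Gam (- t)) (reflect (Gam t)).
Proof.
  revert t. apply (symmetric_ind L).
  - exact length_pos.
  - intros t Ht. apply proj_eq_trans with (reflect (G t)); [now apply Hrefl|].
    apply reflect_proj_eq, proj_eq_sym. now apply HGam.
  - intros t Ht. rewrite Ropp_involutive.
    apply reflect_proj_eq in Ht. rewrite reflect_involutive in Ht.
    now apply proj_eq_sym.
  - intros t Ht. apply proj_eq_trans with (Gam (- t)).
    + replace (- t) with (- (t + 2 * L) + 2 * L) by ring. apply proj_eq_sym, Hper.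
    + apply proj_eq_trans with (reflect (Gam t)); [exact Ht|].
      apply reflect_proj_eq, proj_eq_sym, Hper.
Qed.

Local Lemma wr_Gam_opp (t : R) :
  exists m, m <> 0 /\ wr Y Z t = m * (-1 * wr Y Z (- t)) /\
    wr Z X t = m * (1 * wr Z X (- t)) /\ wr X Y t = m * wr X Y (- t).
Proof.
  destruct (parallel_curves_scale everywhere (fun t => Gam (- t))
              (fun t => reflect (Gam t))) as [c [Hc [Hc0 E]]].
  - apply (Gam_comp_smooth (fun t => - t)), csmooth_opp, csmooth_id.
  - destruct (Gam_curve_smooth everywhere) as [Sx [Sy Sz]].
    exact (conj (csmooth_opp _ _ Sx) (conj Sy Sz)).
  - auto.
  - intros s _. specialize (Hne s). apply vec_neq0_inv in Hne. apply vec_neq0.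
    unfold reflect, px, py, pz in *; cbn [fst snd]. lra.
  - intros s _. apply proj_eq_cross, Gam_reflect.
  - assert (EX : forall s, X (- s) = c s * (-1 * X s)).
    { intros s. destruct (E s I) as [Ex _]. unfold X. rewrite Ex.
      unfold reflect, px; cbn [fst snd]. ring. }
    assert (EY : forall s, Y (- s) = c s * (1 * Y s)).
    { intros s. destruct (E s I) as [_ [Ey _]]. unfold Y. rewrite Ey.
      unfold reflect, py; cbn [fst snd]. ring. }
    assert (EZ : forall s, Z (- s) = c s * (1 * Z s)).
    { intros s. destruct (E s I) as [_ [_ Ez]]. unfold Z. rewrite Ez.
      unfold reflect, pz; cbn [fst snd]. ring. }
    assert (Hd : is_derive (fun s => - s) t (-1)) by (auto_derive; [easy | ring]).
    pose proof (wr_transport Y Z c _ _ _ _ t HY HZ Hc Hd EY EZ) as T1.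
    pose proof (wr_transport Z X c _ _ _ _ t HZ HX Hc Hd EZ EX) as T2.
    pose proof (wr_transport X Y c _ _ _ _ t HX HY Hc Hd EX EY) as T3.
    assert (Hp : (c t) ^ 2 <> 0) by (apply pow_nonzero, Hc0; exact I).
    (* The reversed parameter changes the sign of all three components, the reflection of X that of
       two of them. Up to the common factor only [wr Y Z] changes sign, which will make F odd and Lm
       even. *)
    exists (/ (c t) ^ 2). split; [now apply Rinv_neq_0_compat|].
    cbv beta in T1, T2, T3.
    split; [rewrite T1 | split].
    + field. now apply Hc0.
    + transitivity (/ c t ^ 2 * (- (-1 * wr Z X (- t)))); [rewrite T2|];
        field; now apply Hc0.
    + transitivity (/ c t ^ 2 * (- (-1 * wr X Y (- t)))); [rewrite T3|];
        field; now apply Hc0.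
Qed.

Local Lemma wr_Gam_shift (t : R) :
  exists m, m <> 0 /\ wr Y Z t = m * (1 * wr Y Z (t - 2 * L)) /\
    wr Z X t = m * (1 * wr Z X (t - 2 * L)) /\ wr X Y t = m * wr X Y (t - 2 * L).
Proof.
  assert (Hs : csmooth everywhere (fun s => s - 2 * L)).
  { apply csmooth_minus; [apply csmooth_id | apply csmooth_const]. }
  destruct (parallel_curves_scale everywhere (fun t => Gam (t - 2 * L)) Gam)
    as [c [Hc [Hc0 E]]].
  - now apply (Gam_comp_smooth (fun t => t - 2 * L)).
  - apply Gam_curve_smooth.
  - auto.
  - auto.
  - intros s _. apply proj_eq_cross, proj_eq_sym.
    replace s with (s - 2 * L + 2 * L) at 1 by ring. apply Hper.
  - assert (EX : forall s, X (s - 2 * L) = c s * (1 * X s)).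
    { intros s. destruct (E s I) as [Ex _]. unfold X. rewrite Ex. ring. }
    assert (EY : forall s, Y (s - 2 * L) = c s * (1 * Y s)).
    { intros s. destruct (E s I) as [_ [Ey _]]. unfold Y. rewrite Ey. ring. }
    assert (EZ : forall s, Z (s - 2 * L) = c s * (1 * Z s)).
    { intros s. destruct (E s I) as [_ [_ Ez]]. unfold Z. rewrite Ez. ring. }
    assert (Hd : is_derive (fun s => s - 2 * L) t 1) by (auto_derive; [easy | ring]).
    pose proof (wr_transport Y Z c _ _ _ _ t HY HZ Hc Hd EY EZ) as T1.
    pose proof (wr_transport Z X c _ _ _ _ t HZ HX Hc Hd EZ EX) as T2.
    pose proof (wr_transport X Y c _ _ _ _ t HX HY Hc Hd EX EY) as T3.
    assert (Hp : (c t) ^ 2 <> 0) by (apply pow_nonzero, Hc0; exact I).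
    exists (/ (c t) ^ 2). split; [now apply Rinv_neq_0_compat|].
    cbv beta in T1, T2, T3. rewrite Rmult_1_l in T1, T2, T3.
    rewrite T1, T2, T3. repeat split; field; now apply Hc0.
Qed.

Local Lemma Gam_star_kappa (D : R -> Prop) (t : R) :
  perfect D -> D t ->
  star D Gam t = (wr Y Z t, wr Z X t, wr X Y t) /\
  kappa D Gam t = wr Y Z t * Derive_n X 2 t + wr Z X t * Derive_n Y 2 t
                  + wr X Y t * Derive_n Z 2 t.
Proof.
  intros HD Ht.
  assert (E : forall n, dvec D Gam n t
                        = (Derive_n X n t, Derive_n Y n t, Derive_n Z n t)).
  { intros n. unfold dvec.
    rewrite (deriv_in_n_global D _ X), (deriv_in_n_global D _ Y),
      (deriv_in_n_global D _ Z); auto. }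
  assert (Es : star D Gam t = (wr Y Z t, wr Z X t, wr X Y t)).
  { unfold star. rewrite E. reflexivity. }
  split; [exact Es|]. unfold kappa. rewrite Es, E. reflexivity.
Qed.

Local Lemma G_scale :
  exists c, csmooth (seg L) c /\ (forall t, seg L t -> c t <> 0) /\
    forall t, seg L t -> px (G t) = c t * X t /\ py (G t) = c t * Y t /\
      pz (G t) = c t * Z t.
Proof.
  pose proof (perfect_seg L length_pos) as HD.
  destruct HG as [[Hlift _] _].
  apply (is_lift_curve_smooth _ _ HD) in Hlift. destruct Hlift as [HGs HG0].
  apply (parallel_curves_scale (seg L) G Gam); auto.
  - apply Gam_curve_smooth.
  - intros t Ht. apply proj_eq_cross, proj_eq_sym, HGam, Ht.
Qed.

Local Lemma G_star_kappa :
  exists c, csmooth (seg L) c /\ (forall t, seg L t -> c t <> 0) /\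
    (forall t, seg L t -> px (G t) = c t * X t /\ py (G t) = c t * Y t /\
      pz (G t) = c t * Z t) /\
    (forall t, seg L t -> star (seg L) G t
      = scal ((c t) ^ 2) ((wr Y Z t, wr Z X t, wr X Y t) : vec)) /\
    forall t, seg L t -> kappa (seg L) G t = (c t) ^ 3 *
      (wr Y Z t * Derive_n X 2 t + wr Z X t * Derive_n Y 2 t
       + wr X Y t * Derive_n Z 2 t).
Proof.
  pose proof (perfect_seg L length_pos) as HD.
  destruct G_scale as [c [Hc [Hc0 E]]]. exists c.
  split; [exact Hc|]. split; [exact Hc0|]. split; [exact E|].
  split; intros t Ht; destruct (Gam_star_kappa (seg L) t HD Ht) as [Es Ek];
    destruct (star_kappa_scale (seg L) G Gam c HD Hc
                (Gam_curve_smooth (seg L)) E t Ht) as [Fs Fk].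
  - now rewrite Fs, Es.
  - now rewrite Fk, Ek.
Qed.

Local Lemma G_singular (t : R) :
  seg L t ->
  singular (seg L) G t <-> wr Y Z t = 0 /\ wr Z X t = 0 /\ wr X Y t = 0.
Proof.
  intros Ht. destruct G_star_kappa as [c [_ [Hc0 [_ [Es _]]]]].
  unfold singular. rewrite (Es t Ht). specialize (Hc0 t Ht).
  assert (Hp : (c t) ^ 2 <> 0) by now apply pow_nonzero.
  split.
  - intros E. pose proof (f_equal px E) as E1. pose proof (f_equal py E) as E2.
    pose proof (f_equal pz E) as E3.
    rewrite px_scal in E1. rewrite py_scal in E2. rewrite pz_scal in E3.
    unfold px, py, pz in E1, E2, E3; cbn [fst snd vzero] in E1, E2, E3.
    repeat split; apply Rmult_eq_reg_l with ((c t) ^ 2); auto; lra.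
  - intros [E1 [E2 E3]]. rewrite E1, E2, E3.
    apply vec_eq; rewrite ?px_scal, ?py_scal, ?pz_scal; unfold px, py, pz;
      cbn [fst snd vzero]; ring.
Qed.

Local Lemma Gam_regular (t : R) :
  seg L t -> wr X Y t <> 0 ->
  wr Y Z t * Derive_n X 2 t + wr Z X t * Derive_n Y 2 t
  + wr X Y t * Derive_n Z 2 t <> 0.
Proof.
  intros Ht H0 HK. destruct HG as [_ [_ [Hgood Hinf]]].
  apply (Hinf t Ht). apply (Hgood t Ht). split.
  - intros HS. now apply (G_singular t Ht) in HS.
  - destruct G_star_kappa as [c [_ [_ [_ [_ Ek]]]]]. rewrite Ek, HK by exact Ht. ring.
Qed.

Local Lemma Gam_singular (t : R) :
  seg L t -> wr Y Z t = 0 /\ wr Z X t = 0 /\ wr X Y t = 0 ->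
  cusp (seg L) G t /\
  wr' Y Z t * Derive_n X 3 t + wr' Z X t * Derive_n Y 3 t
  + wr' X Y t * Derive_n Z 3 t <> 0.
Proof.
  intros Ht HS. pose proof (perfect_seg L length_pos) as HD.
  destruct HG as [_ [_ [Hgood _]]].
  pose proof (proj2 (Hgood t Ht) (proj2 (G_singular t Ht) HS)) as HC.
  split; [exact HC|]. destruct HC as [_ HC].
  destruct HS as [S1 [S2 S3]]. intros E. apply HC.
  destruct G_star_kappa as [c [Hc [Hc0 [_ [_ Ek]]]]].
  (* In the derivative of (G x G') . G'' the term (G x G'') . G'' is zero. So a second
     differentiation at a singular point leaves only (G x G'') . G'''. *)
  rewrite (deriv2_product_at_zero (seg L) _ (fun s => (c s) ^ 3)
    (fun s => wr Y Z s * Derive_n X 2 s + wr Z X s * Derive_n Y 2 s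
              + wr X Y s * Derive_n Z 2 s)
    (fun s => wr Y Z s * Derive_n X 3 s + wr Z X s * Derive_n Y 3 s
              + wr X Y s * Derive_n Z 3 s) t
    ((wr' Y Z t * Derive_n X 3 t + wr' Z X t * Derive_n Y 3 t
      + wr' X Y t * Derive_n Z 3 t)
     + (wr Y Z t * Derive_n X 4 t + wr Z X t * Derive_n Y 4 t
      + wr X Y t * Derive_n Z 4 t)) HD Ht); auto.
  - rewrite E, S1, S2, S3. ring.
  - apply csmooth_ext with (fun s => c s * (c s * (c s * 1))); [reflexivity|].
    repeat (apply (csmooth_mult (seg L) c); [exact Hc|]). apply csmooth_const.
  - intros s Hs. eapply hd_eq.
    + apply hd_plus; [apply hd_plus|]; apply hd_mult;
        (now apply hd_wr) || now apply smooth_hd.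
    + unfold wr'. ring.
  - eapply hd_eq.
    + apply hd_plus; [apply hd_plus|]; apply hd_mult;
        (now apply hd_wr) || now apply smooth_hd.
    + ring.
  - rewrite S1, S2, S3. ring.
  - rewrite S1, S2, S3. ring.
Qed.

(** A zero last coordinate means a line through (0 : 0 : 1), that is, a vertical line or the line at
    infinity. Otherwise m1 / m3 is minus the slope. *)
Local Lemma tangent_line_slope (t m1 m2 m3 : R) (l : vec) :
  l <> vzero -> proj_eq l (m1, m2, m3) ->
  ~ line_at_infinity l -> ~ vertical_line l ->
  (0 < t < L -> exists m, m < 0 /\ line_slope l m) ->
  m3 <> 0 /\ (0 < t < L -> 0 < m1 / m3).
Proof.
  intros Hl Hlm Hinf Hver Hsl.
  assert (H3 : m3 <> 0).
  { intros E. apply proj_eq_iff in Hlm. destruct Hlm as [c [Hc [E1 [E2 E3]]]].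
    assert (Ez : pz l = 0) by (rewrite E3, E; unfold pz; cbn [snd]; ring).
    destruct (Req_dec (px l) 0) as [Ex|Ex].
    - apply Hinf. apply proj_eq_iff. exists (py l).
      destruct (vec_neq0_inv l Hl) as [N|[N|N]]; try contradiction.
      split; [exact N|]. rewrite Ex, Ez. unfold px, py, pz; cbn [fst snd].
      repeat split; ring.
    - apply Hver. exists (py l / px l). apply proj_eq_iff. exists (px l).
      split; [exact Ex|]. rewrite Ez. unfold px, py, pz; cbn [fst snd].
      repeat split; field; exact Ex. }
  split; [exact H3|]. intros Ht. destruct (Hsl Ht) as [m [Hm [b Hb]]].
  pose proof (proj_eq_trans _ _ _ (proj_eq_sym _ _ Hlm) Hb) as E.
  apply proj_eq_iff in E. destruct E as [c [Hc [E1 [_ E3]]]].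
  unfold px, pz in E1, E3; cbn [fst snd] in E1, E3. rewrite E1, E3.
  replace (c * - m / (c * 1)) with (- m) by (field; exact Hc). lra.
Qed.

(** [(M1, M2, M3)] is a smooth covector field along the tangent lines near [t], defined through a
    cusp as well and with third coordinate nonzero at [t]. *)
Let dual_at (t : R) (M1 M2 M3 : R -> R) : Prop :=
  local_quotient (wr Y Z) (wr X Y) t M1 M3 /\
  local_quotient (wr Z X) (wr X Y) t M2 M3.

Local Lemma dual_at_regular (t : R) :
  seg L t -> ~ (wr Y Z t = 0 /\ wr Z X t = 0 /\ wr X Y t = 0) ->
  exists M1 M2 M3, dual_at t M1 M2 M3 /\ (0 < t < L -> 0 < M1 t / M3 t).
Proof.
  intros Ht HS. destruct (Htan t Ht) as [l [[Hl0 [Hl _]] [Hinf [Hver Hsl]]]].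
  destruct G_star_kappa as [c [_ [Hc0 [_ [Es _]]]]].
  assert (HlS : proj_eq l (wr Y Z t, wr Z X t, wr X Y t)).
  { apply proj_eq_trans with (star (seg L) G t).
    - apply Hl. intros H. now apply HS, G_singular.
    - rewrite Es by exact Ht. exists ((c t) ^ 2). split; [|reflexivity].
      now apply pow_nonzero, Hc0. }
  destruct (tangent_line_slope t _ _ _ l Hl0 HlS Hinf Hver Hsl) as [H3 Hpos].
  exists (wr Y Z), (wr Z X), (wr X Y). split; [|exact Hpos].
  split; apply local_quotient_regular; auto; now apply csmooth_wr.
Qed.

(** Hadamard's quotient at a zero; its value there is found by differentiating the product. *)
Local Lemma wr_factor (A B : R -> R) (t : R) :
  smooth A -> smooth B -> wr A B t = 0 ->
  exists M, csmooth everywhere M /\ (forall s, wr A B s = (s - t) * M s) /\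
    M t = wr' A B t.
Proof.
  intros HA HB H0.
  destruct (hadamard (wr A B) t) as [M [HM E]].
  { now apply smooth_everywhere, csmooth_wr. }
  assert (E' : forall s, wr A B s = (s - t) * M s).
  { intros s. rewrite E, H0. ring. }
  exists M. split; [exact HM|]. split; [exact E'|].
  destruct (HM 1%nat) as [M' [HM' _]].
  apply (hd_unique everywhere (wr A B) t _ _ perfect_everywhere I).
  - apply hd_ext with (fun s => (s - t) * M s); [now intros | exact I |].
    eapply hd_eq.
    + apply hd_mult; [apply hd_minus; [apply hd_id | apply hd_const] | exact (HM' t I)].
    + cbv beta. ring.
  - now apply hd_wr.
Qed.

(** The factor s - t is common to the components of G x G'. What remains after dividing it out is
    nonzero at the cusp, so it spans the limiting tangent covector, to which the conditions on
    slopes apply. *)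
Local Lemma dual_at_singular (t : R) :
  seg L t -> wr Y Z t = 0 /\ wr Z X t = 0 /\ wr X Y t = 0 ->
  exists M1 M2 M3, dual_at t M1 M2 M3 /\ (0 < t < L -> 0 < M1 t / M3 t).
Proof.
  intros Ht HS. pose proof (proj2 (G_singular t Ht) HS) as HGS.
  destruct (Gam_singular t Ht HS) as [_ Hdet].
  destruct HS as [S1 [S2 S3]].
  destruct (Htan t Ht) as [l [[Hl0 [_ Hl]] [Hinf [Hver Hsl]]]].
  destruct (Hl HGS) as [cc [Hcc Hlim]].
  destruct G_star_kappa as [c [_ [Hc0 [_ [Es _]]]]].
  destruct (wr_factor Y Z t HY HZ S1) as [M1 [HM1 [E1 T1]]].
  destruct (wr_factor Z X t HZ HX S2) as [M2 [HM2 [E2 T2]]].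
  destruct (wr_factor X Y t HX HY S3) as [M3 [HM3 [E3 T3]]].
  pose proof (proper_within_seg L t length_pos Ht) as HP.
  destruct (filterlim_vec R _ _ l (@filter_filter _ _ HP) Hlim) as [Lx [Ly Lz]].
  assert (Hst : forall s, seg L s ->
    px (scal (cc s) (star (seg L) G s)) = cc s * (c s) ^ 2 * (s - t) * M1 s /\
    py (scal (cc s) (star (seg L) G s)) = cc s * (c s) ^ 2 * (s - t) * M2 s /\
    pz (scal (cc s) (star (seg L) G s)) = cc s * (c s) ^ 2 * (s - t) * M3 s).
  { intros s Hs. rewrite Es by exact Hs. rewrite !px_scal, !py_scal, !pz_scal.
    unfold px, py, pz; cbn [fst snd]. rewrite E1, E2, E3. repeat split; ring. }
  assert (Hw : forall Q : R -> Prop, (forall s, seg L s -> Q s) ->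
            within (seg L) (locally' t) Q).
  { intros Q HQ. apply locally_within_punctured with 1; [lra|]. auto. }
  pose proof (filterlim_within (seg L) M1 t (csmooth_continuous M1 t HM1)) as K1.
  pose proof (filterlim_within (seg L) M2 t (csmooth_continuous M2 t HM2)) as K2.
  pose proof (filterlim_within (seg L) M3 t (csmooth_continuous M3 t HM3)) as K3.
  assert (HlM : proj_eq l (M1 t, M2 t, M3 t)).
  { apply cross_proj_eq; [exact Hl0| |].
    (* The values at [t] are the components of G x G''; were all zero, det(G, G'', G''') would
       vanish at the cusp. *)
    - intros E. apply Hdet. injection E as N1 N2 N3.
      rewrite <- T1, <- T2, <- T3, N1, N2, N3. ring.
    - apply vec_eq; rewrite ?px_cross, ?py_cross, ?pz_cross.
      + apply Rminus_diag_eq.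
        apply (filterlim_cross_zero _ _ _ _ _ _ _ _ _ HP Ly Lz K2 K3).
        apply Hw. intros s Hs. destruct (Hst s Hs) as [Q1 [Q2 Q3]].
        rewrite Q2, Q3. ring.
      + apply Rminus_diag_eq.
        apply (filterlim_cross_zero _ _ _ _ _ _ _ _ _ HP Lz Lx K3 K1).
        apply Hw. intros s Hs. destruct (Hst s Hs) as [Q1 [Q2 Q3]].
        rewrite Q1, Q3. ring.
      + apply Rminus_diag_eq.
        apply (filterlim_cross_zero _ _ _ _ _ _ _ _ _ HP Lx Ly K1 K2).
        apply Hw. intros s Hs. destruct (Hst s Hs) as [Q1 [Q2 Q3]].
        rewrite Q1, Q2. ring. }
  destruct (tangent_line_slope t _ _ _ l Hl0 HlM Hinf Hver Hsl) as [H3 Hpos].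
  exists M1, M2, M3. split; [|exact Hpos].
  destruct (csmooth_neq0 M3 t HM3 H3) as [d [Hd HM3d]].
  split; (split; [assumption|]); (split; [assumption|]); (split; [exact H3|]);
    exists d; (split; [exact Hd|]); intros s Hs; specialize (HM3d s Hs); split.
  - intros Hne'. rewrite E3. apply Rmult_integral_contrapositive_currified; lra.
  - rewrite E1, E3. ring.
  - intros Hne'. rewrite E3. apply Rmult_integral_contrapositive_currified; lra.
  - rewrite E2, E3. ring.
Qed.

Local Lemma dual_at_seg (t : R) :
  seg L t ->
  exists M1 M2 M3, dual_at t M1 M2 M3 /\ (0 < t < L -> 0 < M1 t / M3 t).
Proof.
  intros Ht.
  destruct (classic (wr Y Z t = 0 /\ wr Z X t = 0 /\ wr X Y t = 0)) as [H|H].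
  - now apply dual_at_singular.
  - now apply dual_at_regular.
Qed.

Local Lemma dual_at_opp (t : R) (M1 M2 M3 : R -> R) :
  dual_at t M1 M2 M3 ->
  dual_at (- t) (fun s => -1 * M1 (- s)) (fun s => 1 * M2 (- s)) (fun s => M3 (- s)).
Proof.
  intros [H1 H2].
  assert (Hs : csmooth everywhere (fun s => - s)) by apply csmooth_opp, csmooth_id.
  assert (Ht : - - t = t) by ring.
  assert (Hd : forall s, Rabs (- s - t) = Rabs (s - - t)).
  { intros s. rewrite <- Rabs_Ropp. f_equal. ring. }
  split; [apply (local_quotient_transport _ _ M1 M3 (fun s => - s) t)
         |apply (local_quotient_transport _ _ M2 M3 (fun s => - s) t)]; auto;
    intros s; destruct (wr_Gam_opp s) as [m [Hm [E1 [E2 E3]]]]; now exists m.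
Qed.

Local Lemma dual_at_shift (t : R) (M1 M2 M3 : R -> R) :
  dual_at t M1 M2 M3 ->
  dual_at (t + 2 * L) (fun s => 1 * M1 (s - 2 * L)) (fun s => 1 * M2 (s - 2 * L))
    (fun s => M3 (s - 2 * L)).
Proof.
  intros [H1 H2].
  assert (Hs : csmooth everywhere (fun s => s - 2 * L)).
  { apply csmooth_minus; [apply csmooth_id | apply csmooth_const]. }
  assert (Ht : t + 2 * L - 2 * L = t) by ring.
  assert (Hd : forall s, Rabs (s - 2 * L - t) = Rabs (s - (t + 2 * L))).
  { intros s. f_equal. ring. }
  split; [apply (local_quotient_transport _ _ M1 M3 (fun s => s - 2 * L) t)
         |apply (local_quotient_transport _ _ M2 M3 (fun s => s - 2 * L) t)]; auto;
    intros s; destruct (wr_Gam_shift s) as [m [Hm [E1 [E2 E3]]]]; now exists m.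
Qed.

Local Lemma dual_at_everywhere (t : R) : exists M1 M2 M3, dual_at t M1 M2 M3.
Proof.
  revert t. apply (symmetric_ind L).
  - exact length_pos.
  - intros t Ht. destruct (dual_at_seg t Ht) as [M1 [M2 [M3 [H _]]]]. eauto.
  - intros t [M1 [M2 [M3 H]]]. apply dual_at_opp in H. eauto.
  - intros t [M1 [M2 [M3 H]]]. apply dual_at_shift in H. eauto.
Qed.

Let F := quotient_limit (wr Y Z) (wr X Y).
Let Lm := quotient_limit (wr Z X) (wr X Y).

Local Lemma dual_at_values (t : R) (M1 M2 M3 : R -> R) :
  dual_at t M1 M2 M3 -> F t = M1 t / M3 t /\ Lm t = M2 t / M3 t.
Proof. intros [H1 H2]. split; now apply quotient_limit_eq. Qed.

Local Lemma F_quotients (t : R) : exists M N, local_quotient (wr Y Z) (wr X Y) t M N.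
Proof. destruct (dual_at_everywhere t) as [M1 [M2 [M3 [H _]]]]. eauto. Qed.

Local Lemma Lm_quotients (t : R) : exists M N, local_quotient (wr Z X) (wr X Y) t M N.
Proof. destruct (dual_at_everywhere t) as [M1 [M2 [M3 [_ H]]]]. eauto. Qed.

Local Lemma F_smooth : smooth F.
Proof.
  apply quotient_limit_smooth; [now apply csmooth_wr | now apply csmooth_wr
    | exact F_quotients].
Qed.

Local Lemma Lm_smooth : smooth Lm.
Proof.
  apply quotient_limit_smooth; [now apply csmooth_wr | now apply csmooth_wr
    | exact Lm_quotients].
Qed.

Local Lemma F_odd : odd F.
Proof.
  intros t. destruct (dual_at_everywhere t) as [M1 [M2 [M3 H]]].
  destruct (dual_at_values _ _ _ _ (dual_at_opp _ _ _ _ H)) as [E _].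
  destruct (dual_at_values _ _ _ _ H) as [E0 _].
  rewrite E, E0, Ropp_involutive. unfold Rdiv. ring.
Qed.

Local Lemma Lm_even : even Lm.
Proof.
  intros t. destruct (dual_at_everywhere t) as [M1 [M2 [M3 H]]].
  destruct (dual_at_values _ _ _ _ (dual_at_opp _ _ _ _ H)) as [_ E].
  destruct (dual_at_values _ _ _ _ H) as [_ E0].
  rewrite E, E0, Ropp_involutive. unfold Rdiv. ring.
Qed.

Local Lemma F_periodic : periodic (2 * L) F.
Proof.
  intros t. destruct (dual_at_everywhere t) as [M1 [M2 [M3 H]]].
  destruct (dual_at_values _ _ _ _ (dual_at_shift _ _ _ _ H)) as [E _].
  destruct (dual_at_values _ _ _ _ H) as [E0 _].
  rewrite E, E0. replace (t + 2 * L - 2 * L) with t by ring. unfold Rdiv. ring.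
Qed.

Local Lemma Lm_periodic : periodic (2 * L) Lm.
Proof.
  intros t. destruct (dual_at_everywhere t) as [M1 [M2 [M3 H]]].
  destruct (dual_at_values _ _ _ _ (dual_at_shift _ _ _ _ H)) as [_ E].
  destruct (dual_at_values _ _ _ _ H) as [_ E0].
  rewrite E, E0. replace (t + 2 * L - 2 * L) with t by ring. unfold Rdiv. ring.
Qed.

Local Lemma F_pos (t : R) : 0 < t < L -> 0 < F t.
Proof.
  intros Ht. destruct (dual_at_seg t) as [M1 [M2 [M3 [H Hp]]]]; [split; lra|].
  destruct (dual_at_values _ _ _ _ H) as [-> _]. now apply Hp.
Qed.

(** The other two components are multiples of [wr X Y], by F and Lm, even at its zeros. *)
Local Lemma Gam_singular_iff (t : R) :
  wr X Y t = 0 -> wr Y Z t = 0 /\ wr Z X t = 0 /\ wr X Y t = 0.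
Proof.
  intros H0.
  pose proof (quotient_limit_spec (wr Y Z) (wr X Y) (csmooth_wr _ Y Z HY HZ)
                (csmooth_wr _ X Y HX HY) F_quotients t) as E1.
  pose proof (quotient_limit_spec (wr Z X) (wr X Y) (csmooth_wr _ Z X HZ HX)
                (csmooth_wr _ X Y HX HY) Lm_quotients t) as E2.
  rewrite H0, Rmult_0_l in E1, E2. auto.
Qed.

Local Lemma Gam_cusp (t : R) : seg L t -> wr X Y t = 0 -> X t <> 0 /\ Y t <> 0.
Proof.
  intros Ht H0.
  destruct (Gam_singular t Ht (Gam_singular_iff t H0)) as [HC _].
  destruct (Hcusps t Ht HC) as [Hf Hv].
  destruct G_scale as [c [_ [_ E]]]. destruct (E t Ht) as [Ex [Ey _]].
  split; intros N; [apply Hv | apply Hf].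
  - unfold on_vertical_axis. rewrite Ex, N. ring.
  - rewrite Ey, N. ring.
Qed.

Local Lemma Gam_dual : dual_curve L X Y Z F Lm.
Proof.
  constructor; auto.
  - exact length_pos.
  - exact F_smooth.
  - exact Lm_smooth.
  - intros t _. exact (vec_neq0_inv _ (Hne t)).
  - exact (quotient_limit_spec (wr Y Z) (wr X Y) (csmooth_wr _ Y Z HY HZ)
             (csmooth_wr _ X Y HX HY) F_quotients).
  - exact (quotient_limit_spec (wr Z X) (wr X Y) (csmooth_wr _ Z X HZ HX)
             (csmooth_wr _ X Y HX HY) Lm_quotients).
  - exact Gam_regular.
  - intros t Ht H0. now apply Gam_singular, Gam_singular_iff.
  - exact Gam_cusp.
Qed.

Local Lemma Gam_chart (r : R) :
  punctured L rs r -> Y r <> 0 /\ a r = - X r / Y r /\ k r = - Z r / Y r.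
Proof.
  intros Hr. destruct HG as [[_ Hp] _].
  pose proof (proj_eq_trans _ _ _ (HGam r (proj1 Hr)) (Hp r Hr)) as E.
  apply proj_eq_iff in E. destruct E as [c [Hc [E1 [E2 E3]]]].
  fold (X r) in E1. fold (Y r) in E2. fold (Z r) in E3.
  unfold px, py, pz in E1, E2, E3; cbn [fst snd] in E1, E2, E3.
  assert (HYr : Y r <> 0) by (rewrite E2; lra).
  split; [exact HYr|]. rewrite E1, E2, E3. split; field; exact Hc.
Qed.

Local Lemma Gam_domain (r : R) :
  punctured L rs r <-> seg L r /\ Derive_n F 1 r <> 0.
Proof.
  pose proof Gam_dual as HD. split.
  - intros Hr. destruct (Gam_chart r Hr) as [HYr _]. destruct Hr as [Hr _].
    split; [exact Hr|]. now rewrite (dual_infinite L X Y Z F Lm HD r Hr).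
  - intros [Hr H1]. split; [exact Hr|]. intros Hin. apply H1.
    apply (dual_infinite L X Y Z F Lm HD r Hr).
    destruct HG as [_ [Hinf _]]. destruct (Hinf r Hin) as [fp [_ E]].
    pose proof (proj_eq_trans _ _ _ (HGam r Hr) E) as E'.
    apply proj_eq_iff in E'. destruct E' as [c [_ [_ [E2 _]]]].
    fold (Y r) in E2. rewrite E2. unfold py; cbn [fst snd]. ring.
Qed.

Local Lemma Gam_charts (r : R) :
  punctured L rs r -> a r = chart_a F Lm r /\ k r = chart_k F Lm r.
Proof.
  pose proof Gam_dual as HD. intros Hr.
  destruct (Gam_chart r Hr) as [HYr [-> ->]].
  destruct (proj1 (Gam_domain r) Hr) as [Hs H1].
  pose proof (dual_point_1 L X Y Z F Lm HD r Hs) as E1.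
  pose proof (dual_incidence L X Y Z F Lm HD r Hs) as E0.
  assert (Ea : chart_a F Lm r = - X r / Y r).
  { unfold chart_a. apply Rmult_eq_reg_r with (Derive_n F 1 r * Y r);
      [|now apply Rmult_integral_contrapositive_currified].
    transitivity (Derive_n Lm 1 r * Y r); [field; auto|].
    transitivity (- (Derive_n F 1 r * X r)); [lra | field; auto]. }
  split; [now symmetry|]. unfold chart_k. rewrite Ea.
  apply Rmult_eq_reg_r with (Y r); [|exact HYr].
  transitivity (- Z r); [field; auto|].
  transitivity (F r * X r + Lm r * Y r); [lra | field; auto].
Qed.

(** The equal norms read |W / F'^2| = |W / F'|, so |F'| = 1 once W is nonzero. A zero of W would be
    a cusp, but Lm' = 0 puts the endpoint on the axis, where cusps are excluded. *)
Local Lemma endpoint_slope (e : R) :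
  e = 0 \/ e = L -> Rabs (Derive_n F 1 e) = 1.
Proof.
  intros He. pose proof Gam_dual as HD. pose proof length_pos as HL.
  destruct (global_pair_endpoint L F Lm e F_smooth Lm_smooth F_odd Lm_even
              F_periodic Lm_periodic He) as [F0 [F2 [L1 L3]]].
  assert (Hs : seg L e) by (destruct He as [-> | ->]; split; lra).
  assert (H1 : Derive_n F 1 e <> 0).
  { intros N. exact (dual_immersed L X Y Z F Lm HD e Hs N L1). }
  assert (HW : dual_wronsk F Lm e <> 0).
  { intros N. pose proof (dual_wronsk_zero L X Y Z F Lm HD e Hs N) as H0.
    destruct (Gam_cusp e Hs H0) as [HXe _].
    now apply HXe, (dual_on_axis L X Y Z F Lm HD e Hs). }
  destruct (chart_norm_endpoint (punctured L rs) a k F Lm e) as [C1 C2]; auto.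
  - now apply perfect_punctured.
  - now apply Gam_domain.
  - exact F_smooth.
  - exact Lm_smooth.
  - intros r Hr. now apply Gam_domain.
  - intros r Hr. now apply Gam_charts.
  - intros r Hr. now apply Gam_charts.
  - pose proof (Hnorm e He) as E. rewrite C1, C2 in E.
    assert (E' : Rabs (dual_wronsk F Lm e / Derive_n F 1 e)
      = Rabs (dual_wronsk F Lm e / Derive_n F 1 e ^ 2) * Rabs (Derive_n F 1 e)).
    { rewrite <- Rabs_mult. f_equal. field. exact H1. }
    rewrite <- E in E'.
    apply Rmult_eq_reg_l
      with (Rabs (dual_wronsk F Lm e / Derive_n F 1 e ^ 2)); [lra|].
    apply Rabs_no_R0. apply Rmult_integral_contrapositive_currified; [exact HW|].
    now apply Rinv_neq_0_compat, pow_nonzero.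
Qed.

Local Lemma endpoint_sign :
  0 <= Derive_n F 1 0 /\ Derive_n F 1 L <= 0.
Proof.
  pose proof length_pos as HL.
  destruct (global_pair_endpoint L F Lm 0 F_smooth Lm_smooth F_odd Lm_even
              F_periodic Lm_periodic (or_introl eq_refl)) as [F0 _].
  destruct (global_pair_endpoint L F Lm L F_smooth Lm_smooth F_odd Lm_even
              F_periodic Lm_periodic (or_intror eq_refl)) as [FL _].
  split; apply Rnot_lt_le; intros N.
  (* With tolerance - F'(0) the difference quotients near 0 would be negative, although F(0) = 0 and
     F > 0 to the right. *)
  - destruct (smooth_hd (seg L) F 0 0 F_smooth (- Derive_n F 1 0))
      as [d [Hd H]]; [lra|].
    destruct (seg_dense L nil 0 d HL) as [y [Hy [Hne' [Hlt _]]]]; [split; lra | lra |].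
    assert (Hys : D_x (seg L) 0 y) by (split; [split; lra | lra]).
    specialize (H y (conj Hys Hlt)). pose proof (F_pos y Hy) as HFy.
    simpl in H. unfold Rdist in H. apply Rabs_def2 in H.
    fold (F y) in H. fold (F 0) in H. rewrite F0 in H.
    change (Derive (fun x => F x) 0) with (Derive_n F 1 0) in H.
    assert (0 < (F y - 0) / (y - 0)) by (apply Rdiv_lt_0_compat; lra). lra.
  - destruct (smooth_hd (seg L) F 0 L F_smooth (Derive_n F 1 L))
      as [d [Hd H]]; [lra|].
    destruct (seg_dense L nil L d HL) as [y [Hy [Hne' [Hlt _]]]]; [split; lra | lra |].
    assert (Hys : D_x (seg L) L y) by (split; [split; lra | lra]).
    specialize (H y (conj Hys Hlt)). pose proof (F_pos y Hy) as HFy.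
    simpl in H. unfold Rdist in H. apply Rabs_def2 in H.
    fold (F y) in H. fold (F L) in H. rewrite FL in H.
    change (Derive (fun x => F x) L) with (Derive_n F 1 L) in H.
    assert (0 < F y / (L - y)) by (apply Rdiv_lt_0_compat; lra).
    replace ((F y - 0) / (y - L)) with (- (F y / (L - y))) in H by (field; lra). lra.
Qed.

Lemma curve_realization :
  exists F Lm, global_realization L (punctured L rs) a k F Lm.
Proof.
  exists F, Lm. pose proof Gam_dual as HD.
  destruct endpoint_sign as [S0 SL].
  constructor.
  - constructor.
    + exact length_pos.
    + exact F_smooth.
    + exact Lm_smooth.
    + exact F_odd.
    + exact Lm_even.
    + exact F_periodic.
    + exact Lm_periodic.
    + exact F_pos.
    + pose proof (endpoint_slope 0 (or_introl eq_refl)) as E.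
      rewrite Rabs_pos_eq in E; assumption.
    + pose proof (endpoint_slope L (or_intror eq_refl)) as E.
      rewrite Rabs_left1 in E; lra.
    + exact (dual_morse_F L X Y Z F Lm HD).
    + exact (dual_morse_Lm L X Y Z F Lm HD).
    + exact (dual_immersed L X Y Z F Lm HD).
    + exact (dual_simple_zeros L X Y Z F Lm HD).
  - exact Gam_domain.
  - intros r Hr. now apply Gam_charts.
  - intros r Hr. now apply Gam_charts.
Qed.

End CurveToPair.

(** * Uniqueness and parameter changes *)

(** Here a' = W / F'^2 is nonzero and k' = - F a', so F is recovered by division and Lm from k = Lm
    - F a. *)
Lemma realization_formulas (L : R) (I : R -> Prop) (a k F Lm : R -> R) (r : R) :
  global_realization L I a k F Lm -> I r -> dual_wronsk F Lm r <> 0 ->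
  deriv_in I a r <> 0 /\ F r = - (deriv_in I k r / deriv_in I a r) /\
  Lm r = k r - a r * (deriv_in I k r / deriv_in I a r).
Proof.
  intros [HG HI Ha Hk] Hr HW.
  pose proof (perfect_regular L F Lm I HG HI) as HP.
  destruct (proj1 (HI r) Hr) as [_ H1].
  assert (Da : deriv_in I a r = dual_wronsk F Lm r / (Derive_n F 1 r) ^ 2).
  { apply deriv_in_eq; auto. apply hd_ext with (chart_a F Lm); auto.
    - intros y Hy. now rewrite Ha.
    - apply hd_chart_a; auto; apply HG. }
  assert (Dk : deriv_in I k r
               = - F r * (dual_wronsk F Lm r / (Derive_n F 1 r) ^ 2)).
  { apply deriv_in_eq; auto. apply hd_ext with (chart_k F Lm); auto.
    - intros y Hy. now rewrite Hk.
    - apply hd_chart_k; auto; apply HG. }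
  assert (Hq : dual_wronsk F Lm r / (Derive_n F 1 r) ^ 2 <> 0).
  { apply Rmult_integral_contrapositive_currified; [exact HW|].
    now apply Rinv_neq_0_compat, pow_nonzero. }
  rewrite Da, Dk. split; [exact Hq|].
  replace (- F r * (dual_wronsk F Lm r / Derive_n F 1 r ^ 2)
           / (dual_wronsk F Lm r / Derive_n F 1 r ^ 2)) with (- F r)
    by (field; auto).
  rewrite (Hk r Hr), (Ha r Hr). unfold chart_k. split; ring.
Qed.

(** Off a finite list both pairs are given by the same formulas in [a] and [k]; continuity does the
    rest. *)
Lemma realization_unique (L : R) (rs : list R) (a k F Lm F2 Lm2 : R -> R) :
  global_realization L (punctured L rs) a k F Lm ->
  global_realization L (punctured L rs) a k F2 Lm2 ->
  forall r, seg L r -> F2 r = F r /\ Lm2 r = Lm r.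
Proof.
  intros H H2.
  pose proof (glr_pair _ _ _ _ _ _ H) as HP.
  pose proof (glr_pair _ _ _ _ _ _ H2) as HP2.
  destruct (global_pair_wronsk_zeros L F Lm HP) as [l Hl].
  destruct (global_pair_wronsk_zeros L F2 Lm2 HP2) as [l2 Hl2].
  assert (E : forall y, 0 < y < L -> ~ In y (rs ++ l ++ l2) ->
            F2 y = F y /\ Lm2 y = Lm y).
  { intros y Hy Hn. assert (Hs : seg L y) by (split; lra).
    assert (Hp : punctured L rs y).
    { split; [exact Hs|]. intros N. apply Hn, in_or_app. now left. }
    destruct (realization_formulas _ _ _ _ _ _ y H Hp) as [_ [E1 E2]].
    { intros N. apply Hn, in_or_app. right. apply in_or_app. left. now apply Hl. }
    destruct (realization_formulas _ _ _ _ _ _ y H2 Hp) as [_ [E3 E4]].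
    { intros N. apply Hn, in_or_app. right. apply in_or_app. right. now apply Hl2. }
    rewrite E1, E2, E3, E4. auto. }
  pose proof (glp_length _ _ _ HP) as HL.
  intros r Hr. split; apply Rminus_diag_uniq.
  - apply (zero_of_dense L (rs ++ l ++ l2) (fun t => F2 t - F t)
             (fun t => Derive_n F2 1 t - Derive_n F 1 t)); auto.
    + intros t _. apply hd_minus; [apply (smooth_hd _ F2 0) | apply (smooth_hd _ F 0)];
        [apply HP2 | apply HP].
    + intros y Hy Hn. destruct (E y Hy Hn) as [-> _]. ring.
  - apply (zero_of_dense L (rs ++ l ++ l2) (fun t => Lm2 t - Lm t)
             (fun t => Derive_n Lm2 1 t - Derive_n Lm 1 t)); auto.
    + intros t _. apply hd_minus; [apply (smooth_hd _ Lm2 0) | apply (smooth_hd _ Lm 0)];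
        [apply HP2 | apply HP].
    + intros y Hy Hn. destruct (E y Hy Hn) as [_ ->]. ring.
Qed.

(** * Admissible parameter changes *)

Lemma const_of_hd_zero (L : R) (u : R -> R) (x : R) :
  0 < L -> deriv_on (seg L) u (fun _ => 0) -> seg L x -> u x = u 0.
Proof.
  intros HL Hu Hx.
  (* Clamping to [0, L] turns continuity relative to the segment into continuity on the line, which
     the mean value theorem asks for at the endpoints too. *)
  set (cl := fun t => Rmax 0 (Rmin L t)).
  assert (Hcl : forall t, seg L (cl t)).
  { intros t. unfold cl, seg, Rmax, Rmin.
    destruct (Rle_dec L t); destruct (Rle_dec 0 _); lra. }
  assert (Hid : forall t, seg L t -> cl t = t).
  { intros t [H1 H2]. unfold cl. rewrite Rmin_right, Rmax_right; lra. }
  assert (Hlip : forall s t, Rabs (cl s - cl t) <= Rabs (s - t)).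
  { intros s t. unfold cl, Rmax, Rmin, Rabs.
    destruct (Rle_dec L t); destruct (Rle_dec L s);
      repeat destruct (Rle_dec 0 _); repeat destruct (Rcase_abs _); lra. }
  destruct (MVT_gen (fun t => u (cl t)) 0 x (fun _ => 0)) as [c [_ E]].
  - intros y Hy. rewrite Rmin_left, Rmax_right in Hy by apply Hx.
    apply (hd_open (fun t => 0 < t < L)).
    + intros z Hz. apply (locally_interval _ z 0 L); simpl; try lra.
      intros w H1 H2. simpl in *. lra.
    + destruct Hx; lra.
    + apply hd_ext with u.
      * intros z Hz. rewrite Hid; [reflexivity | split; lra].
      * destruct Hx; lra.
      * apply hd_mono with (seg L); [intros z Hz; split; lra|].
        apply Hu. destruct Hx; split; lra.
  - intros y _ e He. destruct (hd_cont _ _ _ _ (Hu (cl y) (Hcl y)) e He) as [d [Hd H]].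
    exists d; split; [exact Hd|]. intros z [_ Hz]. apply H; [apply Hcl|].
    eapply Rle_lt_trans; [apply Hlip | exact Hz].
  - rewrite !Hid in E by (auto; split; lra). lra.
Qed.

Lemma const_of_is_derive_zero (u : R -> R) (x y : R) :
  (forall t, is_derive u t 0) -> u x = u y.
Proof.
  intros Hu. destruct (MVT_gen u x y (fun _ => 0)) as [c [_ E]].
  - auto.
  - intros t _. apply continuity_pt_filterlim, (ex_derive_continuous u).
    exists 0. apply Hu.
  - lra.
Qed.

Lemma smooth_comp (F P : R -> R) : smooth F -> smooth P -> smooth (fun t => F (P t)).
Proof.
  rewrite !smooth_everywhere. intros HF HP.
  apply csmooth_comp with everywhere; auto.
Qed.

Lemma Derive_n_comp_chain (F P : R -> R) (t : R) :
  smooth F -> smooth P ->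
  Derive_n (fun s => F (P s)) 1 t = Derive_n P 1 t * Derive_n F 1 (P t) /\
  Derive_n (fun s => F (P s)) 2 t
    = Derive_n P 2 t * Derive_n F 1 (P t)
      + Derive_n P 1 t * (Derive_n P 1 t * Derive_n F 2 (P t)) /\
  Derive_n (fun s => F (P s)) 3 t
    = Derive_n P 3 t * Derive_n F 1 (P t)
      + 3 * (Derive_n P 1 t * (Derive_n P 2 t * Derive_n F 2 (P t)))
      + Derive_n P 1 t * (Derive_n P 1 t * (Derive_n P 1 t * Derive_n F 3 (P t))).
Proof.
  intros HF HP.
  assert (C : forall n s, is_derive (fun s => Derive_n F n (P s)) s
                            (Derive_n P 1 s * Derive_n F (S n) (P s))).
  { intros n s. apply (is_derive_comp (Derive_n F n) P).
    - now apply smooth_is_derive.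
    - exact (smooth_is_derive P 0 s HP). }
  assert (E1 : forall s, Derive_n (fun s => F (P s)) 1 s
                         = Derive_n P 1 s * Derive_n F 1 (P s)).
  { intros s. apply (is_derive_Derive_n_S _ 0 (fun s => F (P s))); [reflexivity|].
    apply (C 0%nat). }
  assert (E2 : forall s, Derive_n (fun s => F (P s)) 2 s
    = Derive_n P 2 s * Derive_n F 1 (P s)
      + Derive_n P 1 s * (Derive_n P 1 s * Derive_n F 2 (P s))).
  { intros s. apply (is_derive_Derive_n_S _ 1 _ _ _ E1).
    apply hd_everywhere.
    apply (hd_mult everywhere (Derive_n P 1) (fun s => Derive_n F 1 (P s)));
      [now apply smooth_hd|].
    apply hd_everywhere. exact (C 1%nat s). }
  split; [apply E1|]. split; [apply E2|].
  apply (is_derive_Derive_n_S _ 2 _ _ _ E2).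
  apply hd_everywhere. eapply hd_eq.
  - apply hd_plus; apply hd_mult.
    + now apply smooth_hd.
    + apply hd_everywhere. exact (C 1%nat t).
    + now apply smooth_hd.
    + apply hd_mult; [now apply smooth_hd | apply hd_everywhere; exact (C 2%nat t)].
  - cbv beta. ring.
Qed.

(* The extension of an admissible parameter change by the integral of its
   derivative. *)
Record global_change (L Lt : R) (P : R -> R) : Prop := {
  gc_length : 0 < Lt;
  gc_smooth : smooth P;
  gc_maps : forall t, seg Lt t -> seg L (P t);
  gc_interior : forall t, 0 < t < Lt -> 0 < P t < L;
  gc_regular : forall t, seg Lt t -> Derive_n P 1 t <> 0;
  gc_ends :
    (P 0 = 0 /\ P Lt = L /\ Derive_n P 1 0 = 1 /\ Derive_n P 1 Lt = 1) \/
    (P 0 = L /\ P Lt = 0 /\ Derive_n P 1 0 = -1 /\ Derive_n P 1 Lt = -1);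
  gc_opp : forall t, P (- t) = 2 * P 0 - P t;
  gc_shift : forall t, P (t + 2 * Lt) = P t + 2 * (P Lt - P 0)
}.

(** [g] has no zero on the segment, so by the intermediate value theorem it keeps the sign [sg] of
    its initial value. The factor [sg] treats both orientations at once. *)
Lemma strict_monotone_change (Lt : R) (P g : R -> R) (sg : R) :
  0 < Lt -> sg = 1 \/ sg = -1 ->
  (forall t, is_derive P t (g t)) -> (forall t, continuity_pt g t) ->
  (forall t, seg Lt t -> g t <> 0) -> g 0 = sg ->
  forall x y, 0 <= x -> x < y -> y <= Lt -> 0 < sg * (P y - P x).
Proof.
  intros HLt Hsg HP Hg Hn H0.
  assert (Hpos : forall t, seg Lt t -> 0 < sg * g t).
  { intros t Ht. apply Rnot_le_lt. intros Hle.
    destruct (IVT_gen g 0 t 0) as [z [Hz E]].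
    - exact Hg.
    - rewrite H0. unfold Rmin, Rmax. destruct (Rle_dec sg (g t)); nra.
    - rewrite Rmin_left, Rmax_right in Hz by apply Ht.
      apply (Hn z); [|exact E]. destruct Ht; split; lra. }
  intros x y Hx Hxy Hy. destruct (MVT_gen P x y g) as [z [Hz E]].
  - auto.
  - intros t _. apply continuity_pt_filterlim, (ex_derive_continuous P).
    eexists. apply HP.
  - rewrite Rmin_left, Rmax_right in Hz by lra. rewrite E.
    specialize (Hpos z). assert (seg Lt z) by (split; lra). specialize (Hpos H). nra.
Qed.

Lemma global_of_admissible (L Lt : R) (rho : R -> R) :
  0 < L -> admissible L Lt rho ->
  exists P, global_change L Lt P /\ forall t, seg Lt t -> P t = rho t.
Proof.
  intros HL H. pose proof (adm_length _ _ _ H) as HLt.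
  pose proof (perfect_seg Lt HLt) as HD.
  destruct (adm_ext _ _ _ H) as [g [Hg [Heven [Hper Hgr]]]].
  assert (Hgc : forall t, continuous g t).
  { intros t. apply (ex_derive_continuous g). exact (Hg 1%nat t). }
  set (P := fun t => rho 0 + RInt g 0 t).
  assert (DP : forall t, is_derive P t (g t)).
  { intros t. unfold P. apply hd_everywhere.
    apply (hd_eq _ _ _ (0 + g t)); [|ring].
    apply hd_plus; [apply hd_const|]. apply hd_everywhere.
    apply (is_derive_RInt g (fun t => RInt g 0 t) 0 t); [|apply Hgc].
    apply filter_forall. intros y. apply (RInt_correct g).
    apply (ex_RInt_continuous (V := R_CompleteNormedModule)). auto. }
  assert (HPs : smooth P).
  { apply smooth_everywhere. intros n. destruct n as [|n]; [exact Logic.I|].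
    exists g. split; [|now apply smooth_everywhere].
    intros t _. now apply hd_everywhere. }
  assert (P0 : P 0 = rho 0).
  { unfold P. rewrite (RInt_point 0 g). apply Rplus_0_r. }
  assert (HPr : forall t, seg Lt t -> P t = rho t).
  { intros t Ht.
    pose proof (const_of_hd_zero Lt (fun s => P s - rho s) t HLt) as E.
    cbv beta in E. rewrite P0 in E.
    rewrite Rminus_diag in E. apply Rminus_diag_uniq, E; [|exact Ht].
    intros s Hs. apply (hd_eq _ _ _ (g s - g s)); [|ring].
    apply hd_minus; [now apply hd_of_is_derive|].
    rewrite Hgr by exact Hs. apply hd_deriv_in; auto.
    exact (adm_smooth _ _ _ H 0%nat s Hs). }
  assert (P1 : forall t, Derive_n P 1 t = g t).
  { intros t. now apply is_derive_unique. }
  assert (Hgn : forall t, seg Lt t -> g t <> 0).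
  { intros t Ht. rewrite Hgr by exact Ht. now apply (adm_regular _ _ _ H). }
  (* As [g] is even, P (- t) + P t has derivative zero. *)
  assert (Hopp : forall t, P (- t) = 2 * P 0 - P t).
  { intros t.
    assert (E : P (- t) + P t = P (- 0) + P 0).
    { apply (const_of_is_derive_zero (fun s => P (- s) + P s)).
      intros s. apply hd_everywhere.
      apply (hd_eq _ _ _ (-1 * g (- s) + g s)); [|rewrite Heven; ring].
      apply hd_plus; apply hd_everywhere; [|apply DP].
      apply (is_derive_comp P (fun s => - s)); [apply DP|].
      auto_derive; [easy | ring]. }
    rewrite Ropp_0 in E. lra. }
  (* As [g] is periodic, the increment over a period is constant; it is evaluated at - Lt, where
     [Hopp] gives it. *)
  assert (Hshift : forall t, P (t + 2 * Lt) = P t + 2 * (P Lt - P 0)).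
  { intros t.
    assert (E : P (t + 2 * Lt) - P t = P (- Lt + 2 * Lt) - P (- Lt)).
    { apply (const_of_is_derive_zero (fun s => P (s + 2 * Lt) - P s)).
      intros s. apply hd_everywhere.
      apply (hd_eq _ _ _ (1 * g (s + 2 * Lt) - g s)); [|rewrite Hper; ring].
      apply hd_minus; apply hd_everywhere; [|apply DP].
      apply (is_derive_comp P (fun s => s + 2 * Lt)); [apply DP|].
      auto_derive; [easy | ring]. }
    replace (- Lt + 2 * Lt) with Lt in E by ring. rewrite Hopp in E. lra. }
  assert (Hmaps : forall t, seg Lt t -> seg L (P t)).
  { intros t Ht. rewrite HPr by exact Ht. now apply (adm_maps _ _ _ H). }
  assert (Hsurj : forall r, seg L r -> exists t, seg Lt t /\ P t = r).
  { intros r Hr. destruct (adm_bij _ _ _ H r Hr) as [t [[Ht E] _]].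
    exists t. split; [exact Ht|]. now rewrite HPr. }
  assert (s0 : seg Lt 0) by (split; lra). assert (sL : seg Lt Lt) by (split; lra).
  pose proof (Hmaps 0 s0) as M0. pose proof (Hmaps Lt sL) as ML.
  destruct (Hsurj 0) as [z0 [Z0 E0]]; [split; lra|].
  destruct (Hsurj L) as [z1 [Z1 E1]]; [split; lra|].
  unfold seg in M0, ML, Z0, Z1.
  assert (Hgcp : forall t, continuity_pt g t).
  { intros t. apply continuity_pt_filterlim, Hgc. }
  exists P. split; [|exact HPr].
  destruct (adm_ends _ _ _ H) as [[A0 A1]|[A0 A1]];
    rewrite <- Hgr in A0, A1 by assumption.
  - pose proof (strict_monotone_change Lt P g 1 HLt (or_introl eq_refl) DP Hgcp
      Hgn A0) as Hm.
    (* [P] is onto and increasing: if 0 were attained only later, P 0 would be negative, outside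
       [0, L]. *)
    assert (Q0 : P 0 = 0).
    { destruct (Req_dec z0 0) as [->|N]; [exact E0|].
      pose proof (Hm 0 z0). lra. }
    assert (QL : P Lt = L).
    { destruct (Req_dec z1 Lt) as [->|N]; [exact E1|].
      pose proof (Hm z1 Lt). lra. }
    constructor; auto.
    + intros t Ht. pose proof (Hm 0 t). pose proof (Hm t Lt). lra.
    + intros t Ht. rewrite P1. auto.
    + left. rewrite !P1. auto.
  - pose proof (strict_monotone_change Lt P g (-1) HLt (or_intror eq_refl) DP Hgcp
      Hgn A0) as Hm.
    assert (Q0 : P 0 = L).
    { destruct (Req_dec z1 0) as [->|N]; [exact E1|].
      pose proof (Hm 0 z1). lra. }
    assert (QL : P Lt = 0).
    { destruct (Req_dec z0 Lt) as [->|N]; [exact E0|].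
      pose proof (Hm z0 Lt). lra. }
    constructor; auto.
    + intros t Ht. pose proof (Hm 0 t). pose proof (Hm t Lt). lra.
    + intros t Ht. rewrite P1. auto.
    + right. rewrite !P1. auto.
Qed.

(** The P'' terms of the second derivatives cancel in the Wronskian. In its derivative the P'' term
    vanishes at zeros of W, so simple zeros stay simple. *)
Lemma dual_wronsk_comp (F Lm P : R -> R) (t : R) :
  smooth F -> smooth Lm -> smooth P ->
  dual_wronsk (fun s => F (P s)) (fun s => Lm (P s)) t
    = (Derive_n P 1 t) ^ 3 * dual_wronsk F Lm (P t) /\
  dual_wronsk' (fun s => F (P s)) (fun s => Lm (P s)) t
    = (Derive_n P 1 t) ^ 4 * dual_wronsk' F Lm (P t)
      + 3 * (Derive_n P 1 t) ^ 2 * Derive_n P 2 t * dual_wronsk F Lm (P t).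
Proof.
  intros HF HL HP.
  destruct (Derive_n_comp_chain F P t HF HP) as [F1 [F2 F3]].
  destruct (Derive_n_comp_chain Lm P t HL HP) as [L1 [L2 L3]].
  unfold dual_wronsk, dual_wronsk'. rewrite F1, F2, F3, L1, L2, L3. split; ring.
Qed.

Lemma global_pair_comp (L Lt : R) (F Lm P : R -> R) :
  global_pair L F Lm -> global_change L Lt P ->
  global_pair Lt (fun t => F (P t)) (fun t => Lm (P t)).
Proof.
  intros HG HC.
  pose proof (glp_smooth_F _ _ _ HG) as HF.
  pose proof (glp_smooth_Lm _ _ _ HG) as HLm.
  pose proof (gc_smooth _ _ _ HC) as HP.
  pose proof (gc_opp _ _ _ HC) as Hopp. pose proof (gc_shift _ _ _ HC) as Hsh.
  assert (PF : forall t, F (t - 2 * L) = F t).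
  { intros t. rewrite <- (glp_per_F _ _ _ HG (t - 2 * L)). f_equal. ring. }
  assert (PL : forall t, Lm (t - 2 * L) = Lm t).
  { intros t. rewrite <- (glp_per_Lm _ _ _ HG (t - 2 * L)). f_equal. ring. }
  assert (Hp1 : forall n t, seg Lt t -> (Derive_n P 1 t) ^ n <> 0).
  { intros n t Ht. apply pow_nonzero. now apply (gc_regular _ _ _ HC). }
  assert (Hlast : forall t q, seg Lt t -> Derive_n P 1 t * q = 0 -> q = 0).
  { intros t q Ht E. apply Rmult_eq_reg_l with (Derive_n P 1 t); [lra|].
    now apply (gc_regular _ _ _ HC). }
  pose proof (fun t => Derive_n_comp_chain F P t HF HP) as CF.
  pose proof (fun t => Derive_n_comp_chain Lm P t HLm HP) as CL.
  constructor.
  - exact (gc_length _ _ _ HC).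
  - now apply smooth_comp.
  - now apply smooth_comp.
  (* [P] is odd about P 0, which is 0 or L; by its period, F is odd about either point. *)
  - intros t. rewrite Hopp. destruct (gc_ends _ _ _ HC) as [[E _]|[E _]]; rewrite E.
    + rewrite <- (glp_odd _ _ _ HG). f_equal. ring.
    + rewrite <- (glp_odd _ _ _ HG), <- PF. f_equal. ring.
  - intros t. rewrite Hopp. destruct (gc_ends _ _ _ HC) as [[E _]|[E _]]; rewrite E.
    + rewrite <- (glp_even _ _ _ HG (P t)). f_equal. ring.
    + rewrite <- (glp_even _ _ _ HG (P t)), <- PL. f_equal. ring.
  - intros t. rewrite Hsh. destruct (gc_ends _ _ _ HC) as [[E [E' _]]|[E [E' _]]];
      rewrite E, E'.
    + rewrite <- (glp_per_F _ _ _ HG (P t)). f_equal. ring.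
    + rewrite <- PF. rewrite <- (PF (P t)), <- (PF (P t - 2 * L)). f_equal. ring.
  - intros t. rewrite Hsh. destruct (gc_ends _ _ _ HC) as [[E [E' _]]|[E [E' _]]];
      rewrite E, E'.
    + rewrite <- (glp_per_Lm _ _ _ HG (P t)). f_equal. ring.
    + rewrite <- PL. rewrite <- (PL (P t)), <- (PL (P t - 2 * L)). f_equal. ring.
  - intros t Ht. apply (glp_pos _ _ _ HG). now apply (gc_interior _ _ _ HC).
  - destruct (CF 0) as [-> _].
    (* For a reversing change P' = -1 meets the slope -1 of F at L, so the initial slope is 1
       again. *)
    destruct (gc_ends _ _ _ HC) as [[-> [_ [-> _]]]|[-> [_ [-> _]]]].
    + rewrite (glp_start _ _ _ HG). ring.
    + rewrite (glp_end _ _ _ HG). ring.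
  - destruct (CF Lt) as [-> _].
    destruct (gc_ends _ _ _ HC) as [[_ [-> [_ ->]]]|[_ [-> [_ ->]]]].
    + rewrite (glp_end _ _ _ HG). ring.
    + rewrite (glp_start _ _ _ HG). ring.
  - intros t Ht E1 E2. destruct (CF t) as [C1 [C2 _]].
    rewrite C1 in E1. apply (Hlast t _ Ht) in E1.
    rewrite C2, E1, Rmult_0_r, Rplus_0_l in E2.
    apply (Hlast t _ Ht), (Hlast t _ Ht) in E2.
    now apply (glp_morse_F _ _ _ HG (P t) (gc_maps _ _ _ HC t Ht)).
  - intros t Ht E1 E2. destruct (CL t) as [C1 [C2 _]].
    rewrite C1 in E1. apply (Hlast t _ Ht) in E1.
    rewrite C2, E1, Rmult_0_r, Rplus_0_l in E2.
    apply (Hlast t _ Ht), (Hlast t _ Ht) in E2.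
    now apply (glp_morse_Lm _ _ _ HG (P t) (gc_maps _ _ _ HC t Ht)).
  - intros t Ht E1 E2. destruct (CF t) as [C1 _]. destruct (CL t) as [C2 _].
    rewrite C1 in E1. rewrite C2 in E2.
    apply (Hlast t _ Ht) in E1. apply (Hlast t _ Ht) in E2.
    now apply (glp_immersed _ _ _ HG (P t) (gc_maps _ _ _ HC t Ht)).
  - intros t Ht E1 E2. destruct (dual_wronsk_comp F Lm P t HF HLm HP) as [W1 W2].
    rewrite W1 in E1. assert (E0 : dual_wronsk F Lm (P t) = 0).
    { apply Rmult_eq_reg_l with ((Derive_n P 1 t) ^ 3); [lra | now apply Hp1]. }
    rewrite W2, E0 in E2.
    apply (glp_simple _ _ _ HG (P t) (gc_maps _ _ _ HC t Ht) E0).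
    apply Rmult_eq_reg_l with ((Derive_n P 1 t) ^ 4); [lra | now apply Hp1].
Qed.

Lemma realization_reparametrized (L Lt : R) (I : R -> Prop) (a k F Lm P rho : R -> R) :
  global_realization L I a k F Lm -> global_change L Lt P ->
  (forall t, seg Lt t -> P t = rho t) ->
  global_realization Lt (fun t => seg Lt t /\ I (rho t))
    (fun t => a (rho t)) (fun t => k (rho t)) (fun t => F (P t)) (fun t => Lm (P t)).
Proof.
  intros [HG HI Ha Hk] HC HPr.
  pose proof (glp_smooth_F _ _ _ HG) as HF.
  pose proof (glp_smooth_Lm _ _ _ HG) as HLm.
  pose proof (gc_smooth _ _ _ HC) as HP.
  assert (Hchart : forall t, seg Lt t -> I (rho t) ->
    chart_a (fun t => F (P t)) (fun t => Lm (P t)) t = chart_a F Lm (rho t)).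
  { intros t Ht Hr. destruct (proj1 (HI _) Hr) as [_ H1]. unfold chart_a.
    rewrite (proj1 (Derive_n_comp_chain F P t HF HP)),
      (proj1 (Derive_n_comp_chain Lm P t HLm HP)), HPr by exact Ht.
    field. split; [exact H1 | now apply (gc_regular _ _ _ HC)]. }
  constructor.
  - now apply global_pair_comp with L.
  - intros t. rewrite (proj1 (Derive_n_comp_chain F P t HF HP)).
    split; intros [Ht Hr]; (split; [exact Ht|]).
    + apply Rmult_integral_contrapositive_currified.
      * now apply (gc_regular _ _ _ HC).
      * rewrite HPr by exact Ht. now apply HI.
    + apply HI. rewrite <- HPr by exact Ht. split; [now apply (gc_maps _ _ _ HC)|].
      intros E. apply Hr. rewrite E. ring.
  - intros t [Ht Hr]. rewrite Hchart by assumption. now apply Ha.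
  - intros t [Ht Hr]. unfold chart_k. rewrite Hchart, HPr by assumption. now apply Hk.
Qed.

Theorem theorem5p18 (L : R) (rs : list R) (a k : R -> R)
    (Hrs : StronglySorted Rlt (0 :: rs ++ L :: nil))
    (Ha : smooth_on (punctured L rs) a)
    (Hk : smooth_on (punctured L rs) k) :
  ((exists G : R -> vec,
      extends_to_good L rs a k G /\
      tangents_condition L G /\
      cusps_condition L G /\
      gluing_condition L rs a k G)
   <->
   (exists f Lam : R -> R, realized_by L (punctured L rs) a k f Lam))
  /\
  (forall f Lam : R -> R,
     realized_by L (punctured L rs) a k f Lam ->
     ((forall f2 Lam2 : R -> R,
         realized_by L (punctured L rs) a k f2 Lam2 ->
         forall r, seg L r -> f2 r = f r /\ Lam2 r = Lam r) /\
      (exists ro : list R,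
         (forall r, In r ro <-> seg L r /\ wronsk L f Lam r = 0) /\
         (forall r, punctured L rs r -> ~ In r ro ->
            deriv_in (punctured L rs) a r <> 0 /\
            f r = - (deriv_in (punctured L rs) k r
                     / deriv_in (punctured L rs) a r) /\
            Lam r = k r - a r * (deriv_in (punctured L rs) k r
                                 / deriv_in (punctured L rs) a r))) /\
      (forall G : R -> vec, lifts_gamma L rs a k G ->
         forall r, seg L r ->
           tangent_line (seg L) G r (f r, Lam r, 1))) /\
     (forall (Lt : R) (rho : R -> R), admissible L Lt rho ->
        realized_by Lt (fun t => seg Lt t /\ punctured L rs (rho t))
          (fun t => a (rho t)) (fun t => k (rho t))
          (fun t => f (rho t)) (fun t => Lam (rho t)))).
Proof.
  split; [split|].
  - intros [G [Hext [Htan [Hcusps [Hglue [Hn0 HnL]]]]]].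
    destruct Hglue as [Gam [HX [HY [HZ [Hne [Hper [HGam Hrefl]]]]]]].
    destruct (curve_realization L rs a k G Gam) as [F [Lm HR]]; auto.
    { intros e [-> | ->]; assumption. }
    exists F, Lm. now apply realized_of_global with F Lm.
  - intros [f [Lam H]].
    destruct (global_of_realized _ _ _ _ _ _ H) as [F [Lm [HR _]]].
    now apply curve_of_realization with F Lm.
  - intros f Lam H.
    destruct (global_of_realized _ _ _ _ _ _ H) as [F [Lm [HR [Hf HLam]]]].
    pose proof (glr_pair _ _ _ _ _ _ HR) as HP.
    pose proof (glp_length _ _ _ HP) as HL.
    split; [split; [|split]|].
    + intros f2 Lam2 H2 r Hr.
      destruct (global_of_realized _ _ _ _ _ _ H2) as [F2 [Lm2 [HR2 [Hf2 HLam2]]]].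
      rewrite <- Hf, <- HLam, <- Hf2, <- HLam2 by exact Hr.
      exact (realization_unique L rs a k F Lm F2 Lm2 HR HR2 r Hr).
    + destruct (global_pair_wronsk_zeros L F Lm HP) as [ro Hro].
      assert (EW : forall r, seg L r -> wronsk L f Lam r = dual_wronsk F Lm r).
      { intros r Hr. apply wronsk_global; auto; apply HP. }
      exists ro. split.
      * intros r. rewrite Hro. split; intros [Hr E]; (split; [exact Hr|]).
        -- now rewrite EW.
        -- now rewrite <- EW.
      * intros r Hr Hn. rewrite <- Hf, <- HLam by apply Hr.
        apply (realization_formulas L (punctured L rs) a k F Lm r HR Hr).
        intros E. apply Hn, Hro. split; [apply Hr | exact E].
    + intros G HG r Hr. rewrite <- Hf, <- HLam by exact Hr.
      now apply lift_tangent_line with rs a k.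
    + intros Lt rho Hadm.
      destruct (global_of_admissible L Lt rho HL Hadm) as [P [HC HPr]].
      pose proof (realization_reparametrized _ _ _ _ _ _ _ _ _ HR HC HPr) as HRt.
      apply realized_of_global with (1 := HRt); intros t Ht; cbv beta;
        rewrite HPr by exact Ht.
      * apply Hf. now apply (adm_maps _ _ _ Hadm).
      * apply HLam. now apply (adm_maps _ _ _ Hadm).
Qed.
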